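(* Let $n\ge 1$ be an integer and $L>0$. Suppose that $a\colon [0,L]\to\mathbb{R}$ is a continuous function and that there are $2n$ points $$0=\sigma_1<\tau_1<\sigma_2<\tau_2<\dots<\sigma_n<\tau_n=L$$ such that $\tau_1,\sigma_2,\tau_2,\dots,\sigma_n$ (the $2n-2$ points lying in the open interval $(0,L)$) are simple zeros of $a$ and, moreover, $a(x)\ge 0$ for all $x\in I_i:=[\sigma_i,\tau_i]$, $i=1,\dots,n$, and $a(x)\le 0$ for all $x\in[\tau_i,\sigma_{i+1}]$, $i=1,\dots,n-1$; assume $a\not\equiv 0$. Let $g\colon[0,+\infty)\to[0,+\infty)$ be a continuous function with $g(0)=0$, $g(s)>0$ for all $s>0$, and $$\limsup_{s\to0^+}\frac{g(s)}{s}<\lambda_0\qquad\text{and}\qquad \liminf_{s\to+\infty}\frac{g(s)}{s}>\max_{i=1,\dots,n}\lambda_1^i .$$ Then there exists $\mu^*>0$ such that, for each $\mu>\mu^*$, the problem $$u''+\bigl(a^+(x)-\mu a^-(x)\bigr)g(u)=0,\qquad u(0)=u(L)=0,$$ has at least $2^n-1$ positive solutions.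
   Context: Here $a^+(x)=\max\{a(x),0\}$ and $a^-(x)=\max\{-a(x),0\}$. $\lambda_0>0$ denotes the first (smallest positive) eigenvalue of $\varphi''+\lambda a^+(x)\varphi=0$, $\varphi(0)=\varphi(L)=0$, and $\lambda_1^i>0$ denotes the first eigenvalue of $\varphi''+\lambda a^+(x)\varphi=0$ on $I_i$ with $\varphi(\sigma_i)=\varphi(\tau_i)=0$. A simple zero of $a$ is a point where $a$ vanishes and is differentiable with nonzero derivative. A positive solution is a solution $u$ with $u(x)>0$ for every $x\in(0,L)$. The value $+\infty$ is allowed for the $\liminf$. *)

(* Defs.v *)
From Stdlib Require Export Reals List.
From Stdlib.Reals Require Export RList.
From Coquelicot Require Export Coquelicot.
Open Scope R_scope.

Definition pos_part (a : R -> R) (x : R) : R := Rmax (a x) 0.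
Definition neg_part (a : R -> R) (x : R) : R := Rmax (- a x) 0.

Definition Icc (p q x : R) : Prop := p <= x <= q.

(** Limits superior and inferior of a function along a filter: the infimum over
    the sets of the filter of the suprema of [f] on these sets, and dually. *)
Definition LimSup (F : (R -> Prop) -> Prop) (f : R -> R) : Rbar :=
  Rbar_glb (fun y => exists A, F A /\
    y = Lub_Rbar (fun z => exists s, A s /\ z = f s)).

Definition LimInf (F : (R -> Prop) -> Prop) (f : R -> R) : Rbar :=
  Rbar_lub (fun y => exists A, F A /\
    y = Glb_Rbar (fun z => exists s, A s /\ z = f s)).

Definition simple_zero (a : R -> R) (x : R) : Prop :=
  a x = 0 /\ exists l, is_derive a x l /\ l <> 0.

(** [D_in] is differentiation relative to the domain: on [Icc p q] it is
    two-sided inside and one-sided at [p] and [q], so the values of the total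
    function [f] outside the interval are irrelevant. *)
Definition is_derive2_on (D : R -> Prop) (f f2 : R -> R) : Prop :=
  exists f1 : R -> R,
    (forall x, D x -> D_in f f1 D x) /\ (forall x, D x -> D_in f1 f2 D x).

Definition is_eigenvalue (w : R -> R) (p q lam : R) : Prop :=
  exists phi phi2 : R -> R,
    is_derive2_on (Icc p q) phi phi2 /\
    (forall x, Icc p q x -> phi2 x + lam * w x * phi x = 0) /\
    phi p = 0 /\ phi q = 0 /\
    exists x, Icc p q x /\ phi x <> 0.

Definition is_first_eigenvalue (w : R -> R) (p q lam : R) : Prop :=
  0 < lam /\ is_eigenvalue w p q lam /\
  forall nu, 0 < nu -> is_eigenvalue w p q nu -> lam <= nu.

(** Positive solutions of u'' + c(x) g(u) = 0, u(0) = u(L) = 0. *)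
Definition positive_solution (c g : R -> R) (L : R) (u : R -> R) : Prop :=
  (exists u2 : R -> R,
    is_derive2_on (Icc 0 L) u u2 /\
    forall x, Icc 0 L x -> u2 x + c x * g (u x) = 0) /\
  u 0 = 0 /\ u L = 0 /\
  forall x, 0 < x < L -> 0 < u x.

(** At least [N] functions satisfy [P], functions being identified when they
    agree on [D]. *)
Definition at_least (N : nat) (D : R -> Prop) (P : (R -> R) -> Prop) : Prop :=
  exists us : nat -> R -> R,
    (forall k, (k < N)%nat -> P (us k)) /\
    forall j k, (j < N)%nat -> (k < N)%nat -> j <> k ->
      exists x, D x /\ us j x <> us k x.

(* Main.v *)
Require Import Defs.
From Stdlib Require Import Reals List.
From Stdlib.Reals Require Import RList.
From Coquelicot Require Import Coquelicot.
From Stdlib Require Import Lra Lia Classical IndefiniteDescription.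
From mathcomp Require classical.filter.
Open Scope R_scope.

(** The solutions are found by shooting from [u 0 = 0], [u' 0 = s], and the intermediate
    value theorem in the single parameter [s]. The nonlinearity is continued by [0] to the
    negative axis, so that a solution which becomes negative never comes back, and is first
    replaced by Lipschitz approximations. Fix a small level [r]. On a hump [[sigma i, tau i]]
    two facts hold, with constants independent of [mu]: a nonnegative solution stays below
    some [M] (comparison with an eigenfunction for [lambda1 i]); if its maximum is exactly [r]
    and [u (sigma i)] is small, then [u (tau i)] is bounded away from [0] (comparison with a
    positive solution of the linear equation, which exists below [lambda0]). For [mu] large, the
    negative part of the weight makes [u (sigma i)] small and drives [u] above [M] before
    [sigma (i + 1)] whenever the maximum on the i-th hump is exactly [r].
    Now take a segment of slopes such that at [sigma i] the solution vanishes for one end and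
    enters the hump too high for the other. For both ends the solution is nonpositive at
    [sigma (i + 1)], but it is above [M] there when the maximum on the hump equals [r].
    Hence there are two shorter segments of the same kind for the next hump, one with maximum
    at most [r] and one with maximum at least [r]. Iterating, each of the [2 ^ n] words in
    "small" and "large" is realized, and all but the word without "large" give nontrivial
    solutions. *)

(** * Qualitative properties of solutions *)

(** Since [g] is only continuous, its initial value problems may lack uniqueness and a shooting map
    for [g] itself may be discontinuous; the Lipschitz approximations repair this, but everything
    proved for them must survive a limit. Three choices achieve it. First, the conditions coded by a
    word are closed: on a hump either [u <= r] throughout or [u >= r] somewhere. They pass to limits
    and become exclusive only at the end, when the same estimates, applied to the limit equation,
    forbid a maximum equal to [r]. Second, the truncated nonlinearity satisfies
    [0 <= h s <= K * Rmax s 0]; this alone gives uniqueness at a double zero, hence positivity of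
    the limit solutions. Third, the constants come in a non-circular order: [r] and [q0] from the
    limsup; [M], [eps] and [kap] from linear comparisons on the humps, where [mu] is invisible; then
    [h], equal to [g] on [[0, M]]; then a lower bound [gam] of [h] away from [0]; and [mustar]
    last. *)

Lemma is_derive_continuity_pt (f : R -> R) (x l : R) :
  is_derive f x l -> continuity_pt f x.
Proof.
  intros H. apply continuity_pt_filterlim. apply (ex_derive_continuous f x).
  exists l. exact H.
Qed.

Lemma Derive_at (f : R -> R) (x l : R) :
  is_derive f x l -> Derive (fun y => f y) x = l.
Proof. apply is_derive_unique. Qed.

Lemma MVT_ex (f df : R -> R) (a b : R) :
  a <= b -> (forall x, a <= x <= b -> is_derive f x (df x)) ->
  exists c, a <= c <= b /\ f b - f a = df c * (b - a).
Proof.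
  intros Hab Hd.
  destruct (MVT_gen f a b df) as [c [Hc E]].
  - intros x Hx. rewrite Rmin_left, Rmax_right in Hx by lra. apply Hd. lra.
  - intros x Hx. rewrite Rmin_left, Rmax_right in Hx by lra.
    apply is_derive_continuity_pt with (df x). apply Hd. lra.
  - rewrite Rmin_left, Rmax_right in Hc by lra. exists c. split; [lra | exact E].
Qed.

Lemma MVT_upper (f df : R -> R) (a b m : R) :
  a <= b -> (forall x, a <= x <= b -> is_derive f x (df x)) ->
  (forall x, a <= x <= b -> df x <= m) -> f b - f a <= m * (b - a).
Proof.
  intros Hab Hd Hm. destruct (MVT_ex f df a b Hab Hd) as [c [Hc ->]].
  apply Rmult_le_compat_r; [lra | apply Hm; lra].
Qed.

Lemma MVT_lower (f df : R -> R) (a b m : R) :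
  a <= b -> (forall x, a <= x <= b -> is_derive f x (df x)) ->
  (forall x, a <= x <= b -> m <= df x) -> m * (b - a) <= f b - f a.
Proof.
  intros Hab Hd Hm. destruct (MVT_ex f df a b Hab Hd) as [c [Hc ->]].
  apply Rmult_le_compat_r; [lra | apply Hm; lra].
Qed.

(** The zero is the supremum of the points up to which [f] stays nonpositive. The intermediate value
    theorem would not give the sign before the zero, which is what nodal intervals and crossings of
    a level require. *)
Lemma first_zero (f : R -> R) (a b : R) :
  a <= b -> (forall x, continuity_pt f x) -> f a <= 0 -> 0 <= f b ->
  exists z, a <= z <= b /\ f z = 0 /\ forall x, a <= x <= z -> f x <= 0.
Proof.
  intros Hab Hc Ha Hb.
  destruct (completeness (fun z => a <= z <= b /\ forall x, a <= x <= z -> f x <= 0))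
    as [z [Hz1 Hz2]].
  - exists b. intros z [Hz _]. lra.
  - exists a. split; [lra |]. intros x Hx. replace x with a by lra. exact Ha.
  - assert (Hz : a <= z <= b).
    { split.
      - apply Hz1. split; [lra |]. intros x Hx. replace x with a by lra. exact Ha.
      - apply Hz2. intros y [Hy _]. lra. }
    assert (Hlt : forall x, a <= x < z -> f x <= 0).
    { intros x Hx. destruct (Rle_lt_dec (f x) 0) as [|Hp]; [assumption |].
      exfalso. apply (Rlt_not_le z x); [lra |].
      apply Hz2. intros y [Hy Hfy]. destruct (Rle_lt_dec y x); [assumption |].
      specialize (Hfy x). lra. }
    assert (Hle : f z <= 0).
    { destruct (Rle_lt_dec (f z) 0) as [|Hp]; [assumption |].
      destruct (Hc z (f z) Hp) as [d [Hd Hdd]].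
      destruct (Req_dec z a) as [->|Hne]; [lra |].
      set (y := Rmax a (z - d / 2)).
      assert (Hy : a <= y < z /\ Rabs (y - z) < d).
      { unfold y, Rmax. destruct (Rle_dec a (z - d / 2));
          (split; [lra |]); rewrite Rabs_left1; lra. }
      destruct Hy as [Hy1 Hy2].
      assert (Hq := Hdd y). simpl in Hq. unfold R_dist in Hq.
      assert (Hq' : Rabs (f y - f z) < f z).
      { apply Hq. split; [split; [exact I | lra] | exact Hy2]. }
      specialize (Hlt y Hy1). apply Rabs_def2 in Hq'. lra. }
    exists z. split; [exact Hz |]. split.
    + destruct (Rle_lt_or_eq_dec _ _ Hle) as [Hn|]; [exfalso | assumption].
      destruct (Req_dec z b) as [->|Hne]; [lra |].
      destruct (Hc z (- f z)) as [d [Hd Hdd]]; [lra |].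
      set (y := Rmin b (z + d / 2)).
      assert (Hy : z < y <= b /\ y <= z + d / 2).
      { unfold y, Rmin. destruct (Rle_dec b (z + d / 2)); lra. }
      apply (Rlt_not_le y z); [lra |]. apply Hz1. split; [lra |].
      intros x Hx. destruct (Rlt_le_dec x z) as [Hxz|Hxz]; [apply Hlt; lra |].
      destruct (Req_dec x z) as [->|Hxne]; [lra |].
      assert (Hq' : Rabs (f x - f z) < - f z).
      { apply Hdd. simpl. unfold R_dist. split; [split; [exact I | lra] |].
        rewrite Rabs_right; lra. }
      apply Rabs_def2 in Hq'. lra.
    + intros x Hx. destruct (Req_dec x z) as [->|]; [lra | apply Hlt; lra].
Qed.

Lemma continuity_pt_reflect (f : R -> R) (k x : R) :
  (forall y, continuity_pt f y) -> continuity_pt (fun y => f (k - y)) x.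
Proof.
  intros Hc. apply (continuity_pt_comp (fun y => k - y) f); [| apply Hc].
  apply continuity_pt_minus; [apply continuity_pt_const; intros ? ?; reflexivity |].
  apply derivable_continuous_pt, derivable_pt_id.
Qed.

Lemma last_zero (f : R -> R) (a b : R) :
  a <= b -> (forall x, continuity_pt f x) -> f a <= 0 -> 0 <= f b ->
  exists z, a <= z <= b /\ f z = 0 /\ forall x, z <= x <= b -> 0 <= f x.
Proof.
  intros Hab Hc Ha Hb.
  destruct (first_zero (fun x => - f (a + b - x)) a b) as [z [Hz [Ez Hx]]].
  - exact Hab.
  - intros x. apply continuity_pt_opp. apply continuity_pt_reflect, Hc.
  - replace (a + b - a) with b by ring. lra.
  - replace (a + b - b) with a by ring. lra.
  - exists (a + b - z). split; [lra |]. split; [lra |].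
    intros x Hxz. specialize (Hx (a + b - x)). simpl in Hx.
    replace (a + b - (a + b - x)) with x in Hx by ring. lra.
Qed.

(** The defect [eta] enters the energy as a constant component, which makes the
    differential inequality homogeneous. *)
Lemma gronwall (w z d : R -> R) (x0 X M eta : R) :
  0 <= M -> 0 <= eta -> x0 <= X ->
  (forall x, x0 <= x <= X -> is_derive w x (z x) /\ is_derive z x (d x)) ->
  (forall x, x0 <= x <= X -> Rabs (d x) <= M * (Rabs (w x) + eta)) ->
  (w X)^2 + (z X)^2 + eta^2 <=
    ((w x0)^2 + (z x0)^2 + eta^2) * exp ((1 + 2 * M) * (X - x0)).
Proof.
  intros HM He HX Hd Hb.
  set (e := fun x => (w x)^2 + (z x)^2 + eta^2).
  set (E := fun x => e x * exp (- ((1 + 2 * M) * (x - x0)))).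
  assert (H : E X - E x0 <= 0 * (X - x0)).
  { apply (MVT_upper E (fun x =>
       (2 * w x * z x + 2 * z x * d x - (1 + 2 * M) * e x)
         * exp (- ((1 + 2 * M) * (x - x0))))); [exact HX | |].
    - intros x Hx. destruct (Hd x Hx) as [H1 H2].
      unfold E, e. auto_derive.
      + split; [exists (z x); exact H1 |]. split; [exists (d x); exact H2 | exact I].
      + rewrite (Derive_at w x _ H1),
          (Derive_at z x _ H2).
        unfold Rminus. ring.
    - intros x Hx.
      assert (Hp := exp_pos (- ((1 + 2 * M) * (x - x0)))).
      assert (Hq : 2 * w x * z x + 2 * z x * d x <= (1 + 2 * M) * e x).
      { unfold e.
        assert (A1 : 2 * w x * z x <= (w x)^2 + (z x)^2)
          by (assert (0 <= (w x - z x)^2) by apply pow2_ge_0; lra).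
        assert (A2 : z x * d x <= Rabs (z x) * (M * (Rabs (w x) + eta))).
        { apply Rle_trans with (Rabs (z x * d x)); [apply Rle_abs |].
          rewrite Rabs_mult. apply Rmult_le_compat_l; [apply Rabs_pos | apply Hb, Hx]. }
        assert (A3 : 2 * (Rabs (z x) * (Rabs (w x) + eta))
                     <= 2 * (z x)^2 + (w x)^2 + eta^2).
        { rewrite <- (pow2_abs (z x)), <- (pow2_abs (w x)).
          assert (0 <= (Rabs (z x) - Rabs (w x))^2) by apply pow2_ge_0.
          assert (0 <= (Rabs (z x) - eta)^2) by apply pow2_ge_0. lra. }
        assert (A4 : 0 <= M * (2 * (z x)^2 + (w x)^2 + eta^2
                          - 2 * (Rabs (z x) * (Rabs (w x) + eta))))
          by (apply Rmult_le_pos; lra).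
        assert (0 <= M * (w x)^2) by (apply Rmult_le_pos; [lra | apply pow2_ge_0]).
        assert (0 <= M * eta^2) by (apply Rmult_le_pos; [lra | apply pow2_ge_0]).
        assert (0 <= eta^2) by apply pow2_ge_0.
        lra. }
      apply Rmult_le_reg_r with (/ exp (- ((1 + 2 * M) * (x - x0))));
        [apply Rinv_0_lt_compat, Hp |].
      rewrite Rmult_assoc, Rinv_r, Rmult_1_r, Rmult_0_l by lra. lra. }
  unfold E in H.
  replace (x0 - x0) with 0 in H by ring.
  rewrite Rmult_0_r, Ropp_0, exp_0, Rmult_1_r, exp_Ropp in H.
  assert (Hp := exp_pos ((1 + 2 * M) * (X - x0))).
  fold (e X). fold (e x0).
  apply Rmult_le_reg_r with (/ exp ((1 + 2 * M) * (X - x0)));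
    [apply Rinv_0_lt_compat, Hp |].
  rewrite Rmult_assoc, Rinv_r by lra. lra.
Qed.

(** * The equation on the whole line: sign, uniqueness at double zeros, convexity *)

Definition ode (c h u v : R -> R) : Prop :=
  forall x, is_derive u x (v x) /\ is_derive v x (- (c x * h (u x))).

Lemma ode_continuity (c h u v : R -> R) (x : R) :
  ode c h u v -> continuity_pt u x.
Proof. intros H. apply is_derive_continuity_pt with (v x), H. Qed.

Lemma ode_reflect (c h u v : R -> R) :
  ode c h u v -> ode (fun x => c (- x)) h (fun x => u (- x)) (fun x => - v (- x)).
Proof.
  intros H x. destruct (H (- x)) as [H1 H2]. split.
  - replace (- v (- x)) with (scal (-1) (v (- x))) by (unfold scal; simpl; unfold mult; simpl; ring).
    apply (is_derive_comp u (fun x => - x)); [exact H1 |].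
    auto_derive; [exact I | ring].
  - replace (- (c (- x) * h (u (- x))))
      with (opp (scal (-1) (- (c (- x) * h (u (- x))))))
      by (unfold opp, scal; simpl; unfold mult; simpl; ring).
    apply (is_derive_opp (fun x => v (- x))).
    apply (is_derive_comp v (fun x => - x)); [exact H2 |].
    auto_derive; [exact I | ring].
Qed.

Definition sublinear (K : R) (h : R -> R) : Prop :=
  forall s, 0 <= h s <= K * Rmax s 0.

Lemma sublinear_nonpos (K : R) (h : R -> R) (s : R) :
  sublinear K h -> s <= 0 -> h s = 0.
Proof.
  intros H Hs. specialize (H s). rewrite Rmax_right in H by lra. lra.
Qed.

Lemma sublinear_const (K : R) (h : R -> R) : sublinear K h -> 0 <= K.
Proof. intros H. specialize (H 1). rewrite Rmax_left in H by lra. lra. Qed.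

(** The linear function is itself a solution, because [h] vanishes on the negative axis. *)
Lemma linear_right (c h u v : R -> R) (K C : R) :
  sublinear K h -> (forall x, Rabs (c x) <= C) -> ode c h u v ->
  forall x0 x, u x0 <= 0 -> v x0 <= 0 -> x0 <= x ->
  u x = u x0 + v x0 * (x - x0) /\ v x = v x0.
Proof.
  intros Hh HC Hode x0 x Hu Hv Hx.
  assert (HK := sublinear_const K h Hh).
  assert (HC0 : 0 <= C) by (apply Rle_trans with (2 := HC 0), Rabs_pos).
  set (l := fun y => u x0 + v x0 * (y - x0)).
  assert (H := gronwall (fun y => u y - l y) (fun y => v y - v x0)
                 (fun y => - (c y * h (u y))) x0 x (C * K) 0).
  assert (H0 : (u x - l x)^2 + (v x - v x0)^2 <= 0).
  { unfold l in *. replace (x0 - x0) with 0 in H by ring.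
    rewrite Rmult_0_r, Rplus_0_r in H.
    replace (u x0 - u x0) with 0 in H by ring.
    replace (v x0 - v x0) with 0 in H by ring.
    replace ((0 ^ 2 + 0 ^ 2 + 0 ^ 2) * exp ((1 + 2 * (C * K)) * (x - x0))) with 0 in H by ring.
    replace (0 ^ 2) with 0 in H by ring. rewrite Rplus_0_r in H.
    apply H.
    - apply Rmult_le_pos; lra.
    - lra.
    - exact Hx.
    - intros y Hy. destruct (Hode y) as [H1 H2]. split.
      + auto_derive.
        * exists (v y). exact H1.
        * rewrite (Derive_at u y _ H1). ring.
      + auto_derive.
        * eexists. exact H2.
        * rewrite (Derive_at v y _ H2). ring.
    - intros y Hy. rewrite Rabs_Ropp, Rabs_mult, Rplus_0_r, Rmult_assoc.
      apply Rmult_le_compat; [apply Rabs_pos | apply Rabs_pos | apply HC |].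
      (* Because the line [l] is nonpositive, the positive part of [u] is at most [Rabs (u - l)];
         the growth bound [sublinear] thus plays the part of a Lipschitz estimate for the
         difference. *)
      assert (Hl : u x0 + v x0 * (y - x0) <= 0).
      { assert (v x0 * (y - x0) <= 0); [| lra].
        rewrite <- (Rmult_0_l (y - x0)). apply Rmult_le_compat_r; lra. }
      assert (Hy2 := Hh (u y)). rewrite Rabs_right by lra.
      apply Rle_trans with (1 := proj2 Hy2). apply Rmult_le_compat_l; [exact HK |].
      apply Rmax_lub; [| apply Rabs_pos].
      apply Rle_trans with (u y - (u x0 + v x0 * (y - x0))); [lra | apply Rle_abs]. }
  assert (P1 := pow2_ge_0 (u x - l x)). assert (P2 := pow2_ge_0 (v x - v x0)).
  assert (Z1 : u x - l x = 0) by (apply Rsqr_0_uniq; unfold Rsqr; lra).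
  assert (Z2 : v x - v x0 = 0) by (apply Rsqr_0_uniq; unfold Rsqr; lra).
  unfold l in Z1. lra.
Qed.

Lemma linear_left (c h u v : R -> R) (K C x0 x : R) :
  sublinear K h -> (forall x, Rabs (c x) <= C) -> ode c h u v ->
  u x0 <= 0 -> 0 <= v x0 -> x <= x0 ->
  u x = u x0 + v x0 * (x - x0) /\ v x = v x0.
Proof.
  intros Hh HC Ho Hu Hv Hx.
  destruct (linear_right (fun x => c (- x)) h (fun x => u (- x)) (fun x => - v (- x)) K C
     Hh (fun x => HC (- x)) (ode_reflect c h u v Ho) (- x0) (- x)) as [E1 E2];
    rewrite ?Ropp_involutive in *; lra.
Qed.

(** If [u] were negative at [x], then between its last zero before [x] and [x] there would be a
    point with nonpositive value and negative slope; from there [linear_right] makes [u] decrease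
    for ever, contradicting [0 <= u y]. *)
Lemma nonneg_between (c h u v : R -> R) (K C p y x : R) :
  sublinear K h -> (forall x, Rabs (c x) <= C) -> ode c h u v ->
  0 <= u p -> 0 <= u y -> p <= x <= y -> 0 <= u x.
Proof.
  intros Hh HC Ho Hp Hy Hx. destruct (Rle_lt_dec 0 (u x)) as [|Hn]; [assumption | exfalso].
  destruct (last_zero (fun t => - u t) p x) as [z [Hz [Ez Hzx]]].
  - lra.
  - intros t. apply continuity_pt_opp. apply (ode_continuity c h u v t Ho).
  - lra.
  - lra.
  - destruct (MVT_ex u v z x) as [t [Ht Et]]; [lra | intros; apply Ho |].
    assert (Hzx' : z < x).
    { destruct (Req_dec z x) as [->|]; lra. }
    assert (Hvt : v t < 0).
    { apply Rmult_lt_reg_r with (x - z); lra. }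
    specialize (Hzx t Ht).
    destruct (linear_right c h u v K C Hh HC Ho t x) as [E1 E2]; [lra | lra | lra |].
    destruct (linear_right c h u v K C Hh HC Ho x y) as [E3 _]; [lra | lra | lra |].
    assert (v x * (y - x) <= 0); [| lra].
    rewrite <- (Rmult_0_l (y - x)). apply Rmult_le_compat_r; lra.
Qed.

Lemma interior_min_derive (u : R -> R) (x l d : R) :
  0 < d -> is_derive u x l -> (forall y, Rabs (y - x) < d -> u x <= u y) -> l = 0.
Proof.
  intros Hd H Hm. apply is_derive_Reals in H.
  assert (pr : derivable_pt u x) by (exists l; exact H).
  rewrite <- (derive_pt_eq_0 u x l pr H).
  apply (deriv_minimum u (x - d) (x + d) x pr); [lra | lra |].
  intros y Hy1 Hy2. apply Hm. apply Rabs_def1; lra.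
Qed.

(** An interior zero of a nonnegative solution is a double zero, where uniqueness holds. *)
Lemma interior_zero_trivial (c h u v : R -> R) (K C a b x0 : R) :
  sublinear K h -> (forall x, Rabs (c x) <= C) -> ode c h u v ->
  (forall x, a <= x <= b -> 0 <= u x) -> a < x0 < b -> u x0 = 0 ->
  forall x, u x = 0.
Proof.
  intros Hh HC Ho Hn Hx0 E0 x.
  assert (Ev : v x0 = 0).
  { apply (interior_min_derive u x0 (v x0) (Rmin (x0 - a) (b - x0))).
    - apply Rmin_pos; lra.
    - apply Ho.
    - intros y Hy. rewrite E0. apply Hn.
      assert (H1 := Rmin_l (x0 - a) (b - x0)). assert (H2 := Rmin_r (x0 - a) (b - x0)).
      apply Rabs_def2 in Hy. lra. }
  destruct (Rle_lt_dec x0 x).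
  - destruct (linear_right c h u v K C Hh HC Ho x0 x) as [E _]; try lra.
    rewrite E0, Ev in E. lra.
  - destruct (linear_left c h u v K C x0 x Hh HC Ho) as [E _]; try lra.
    rewrite E0, Ev in E. lra.
Qed.

Lemma v_decreasing (c h u v : R -> R) (K p q : R) :
  sublinear K h -> ode c h u v -> (forall x, p <= x <= q -> 0 <= c x) ->
  forall x y, p <= x -> x <= y -> y <= q -> v y <= v x.
Proof.
  intros Hh Ho Hc x y Hx Hxy Hy.
  assert (H := MVT_upper v (fun x => - (c x * h (u x))) x y 0 Hxy (fun t _ => proj2 (Ho t))).
  rewrite Rmult_0_l in H. apply Rminus_le, H. intros t Ht.
  assert (0 <= c t * h (u t)); [apply Rmult_le_pos; [apply Hc; lra | apply Hh] | lra].
Qed.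

Lemma v_increasing (c h u v : R -> R) (K p q : R) :
  sublinear K h -> ode c h u v -> (forall x, p <= x <= q -> c x <= 0) ->
  forall x y, p <= x -> x <= y -> y <= q -> v x <= v y.
Proof.
  intros Hh Ho Hc x y Hx Hxy Hy.
  assert (H := MVT_lower v (fun x => - (c x * h (u x))) x y 0 Hxy (fun t _ => proj2 (Ho t))).
  rewrite Rmult_0_l in H. apply Rminus_le_0, H. intros t Ht.
  assert (0 <= - c t * h (u t)); [apply Rmult_le_pos; [specialize (Hc t); lra | apply Hh] | lra].
Qed.

(** * Ultralimits *)

(** Limits along such an ultrafilter replace the extraction of subsequences. *)
Record free_ultrafilter (U : (nat -> Prop) -> Prop) : Prop := {
  uf_imp : forall P Q : nat -> Prop, U P -> (forall k, P k -> Q k) -> U Q;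
  uf_and : forall P Q : nat -> Prop, U P -> U Q -> U (fun k => P k /\ Q k);
  uf_ex : forall P : nat -> Prop, U P -> exists k, P k;
  uf_or : forall P : nat -> Prop, U P \/ U (fun k => ~ P k);
  uf_tail : forall N, U (fun k => (N <= k)%nat) }.

Lemma free_ultrafilter_exists : exists U, free_ultrafilter U.
Proof.
  set (F := fun P : nat -> Prop => exists N, forall k, (N <= k)%nat -> P k).
  destruct (@filter.ultraFilterLemma nat F) as [U [HU HF]].
  - constructor.
    + intros [N HN]. exact (HN N (le_n N)).
    + constructor.
      * exists 0%nat. intros k _. exact I.
      * intros P Q [N1 H1] [N2 H2]. exists (N1 + N2)%nat.
        intros k Hk. split; [apply H1 | apply H2]; lia.
      * intros P Q HPQ [N HN]. exists N. intros k Hk. apply HPQ, HN, Hk.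
  - assert (HP := @filter.ultra_proper nat U HU).
    assert (HFi := @filter.filter_filter nat U HP).
    exists U. constructor.
    + intros P Q HPu HPQ. exact (@filter.filterS nat U HFi P Q HPQ HPu).
    + intros P Q HPu HQu. exact (@filter.filterI nat U HFi P Q HPu HQu).
    + intros P HPu. apply NNPP. intros Hn. apply (@filter.filter_not_empty nat U HP).
      refine (@filter.filterS nat U HFi P _ _ HPu). intros k Hk. apply Hn. exists k. exact Hk.
    + intros P. exact (@filter.in_ultra_setVsetC nat U P HU).
    + intros N. apply HF. exists N. intros k Hk. exact Hk.
Qed.

(** The limit is the supremum of the levels that lie below the sequence for a set of indices in [U];
    the dichotomy [uf_or] turns failure of an upper bound into a larger such level. *)
Lemma ultralimit_exists (U : (nat -> Prop) -> Prop) (x : nat -> R) (B : R) :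
  free_ultrafilter U -> (forall k, Rabs (x k) <= B) ->
  exists l, forall eps, 0 < eps -> U (fun k => Rabs (x k - l) < eps).
Proof.
  intros HU HB.
  destruct (completeness (fun y => U (fun k => y <= x k))) as [l [Hl1 Hl2]].
  - exists B. intros y Hy. destruct (uf_ex U HU _ Hy) as [k Hk].
    apply Rle_trans with (1 := Hk), Rle_trans with (2 := HB k), Rle_abs.
  - exists (- B). apply (uf_imp U HU) with (1 := uf_tail U HU 0).
    intros k _. specialize (HB k). apply Rabs_le_between in HB. lra.
  - exists l. intros eps He.
    assert (H1 : U (fun k => x k < l + eps)).
    { destruct (uf_or U HU (fun k => x k < l + eps)) as [|H]; [assumption |].
      exfalso. assert (Hle : l + eps <= l); [| lra].
      apply Hl1. apply (uf_imp U HU) with (1 := H). intros k Hk. lra. }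
    assert (H2 : U (fun k => l - eps < x k)).
    { destruct (classic (exists y, U (fun k => y <= x k) /\ l - eps < y)) as [[y [Hy Hly]]|Hn].
      - apply (uf_imp U HU) with (1 := Hy). intros k Hk. lra.
      - exfalso. assert (Hle : l <= l - eps); [| lra].
        apply Hl2. intros y Hy. destruct (Rle_lt_dec y (l - eps)); [assumption |].
        exfalso. apply Hn. exists y. split; assumption. }
    apply (uf_imp U HU) with (1 := uf_and U HU _ _ H1 H2).
    intros k [Ha Hb]. apply Rabs_def1; lra.
Qed.

Lemma is_derive_of_bound (F : R -> R) (x0 l : R) :
  (forall eps, 0 < eps -> exists d, 0 < d /\ forall x, Rabs (x - x0) < d ->
     Rabs (F x - F x0 - l * (x - x0)) <= eps * Rabs (x - x0)) ->
  is_derive F x0 l.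
Proof.
  intros H. apply is_derive_Reals. intros eps He.
  destruct (H (eps / 2)) as [d [Hd Hx]]; [lra |].
  exists (mkposreal d Hd). intros y Hy0 Hy. simpl in Hy.
  specialize (Hx (x0 + y)). replace (x0 + y - x0) with y in Hx by ring.
  specialize (Hx Hy).
  replace ((F (x0 + y) - F x0) / y - l) with ((F (x0 + y) - F x0 - l * y) / y) by (field; exact Hy0).
  unfold Rdiv. rewrite Rabs_mult, Rabs_inv.
  assert (Hp := Rabs_pos_lt y Hy0).
  apply Rmult_lt_reg_r with (Rabs y); [exact Hp |].
  rewrite Rmult_assoc, Rinv_l, Rmult_1_r by lra.
  apply Rle_lt_trans with (1 := Hx). apply Rmult_lt_compat_r; lra.
Qed.

Lemma increment_bound (F dF : R -> R) (x0 x B : R) :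
  (forall y, Rabs (y - x0) <= Rabs (x - x0) -> is_derive F y (dF y) /\ Rabs (dF y) <= B) ->
  Rabs (F x - F x0) <= B * Rabs (x - x0).
Proof.
  intros H. assert (G : forall y, Rmin x0 x <= y <= Rmax x0 x -> Rabs (y - x0) <= Rabs (x - x0)).
  { intros y. unfold Rmin, Rmax. destruct (Rle_dec x0 x); intros Hy.
    - rewrite !Rabs_right; lra.
    - rewrite !Rabs_left1; lra. }
  destruct (MVT_gen F x0 x dF) as [t [Ht E]].
  - intros y Hy. apply H, G. lra.
  - intros y Hy. apply is_derive_continuity_pt with (dF y). apply H, G, Hy.
  - rewrite E, Rabs_mult. apply Rmult_le_compat_r; [apply Rabs_pos |]. apply H, G, Ht.
Qed.

Section Ultralimit.
Variable (U : (nat -> Prop) -> Prop).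
Hypothesis (HU : free_ultrafilter U).

Lemma ultralimit_unique (x : nat -> R) (l m : R) :
  (forall eps, 0 < eps -> U (fun k => Rabs (x k - l) < eps)) ->
  (forall eps, 0 < eps -> U (fun k => Rabs (x k - m) <= eps)) -> l = m.
Proof.
  intros Hl Hm. apply Rminus_diag_uniq. destruct (Req_dec (l - m) 0) as [|Hn]; [assumption |].
  assert (Hp := Rabs_pos_lt _ Hn).
  assert (Hp2 : 0 < Rabs (l - m) / 2) by lra. assert (Hp3 : 0 < Rabs (l - m) / 3) by lra.
  destruct (uf_ex U HU _ (uf_and U HU _ _ (Hl (Rabs (l - m) / 2) Hp2)
     (Hm (Rabs (l - m) / 3) Hp3))) as [k [H1 H2]].
  assert (H := Rabs_triang (l - x k) (x k - m)).
  replace (l - x k + (x k - m)) with (l - m) in H by ring.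
  rewrite (Rabs_minus_sym l (x k)) in H. lra.
Qed.

Lemma ultralimit_le (x : nat -> R) (l b : R) :
  (forall eps, 0 < eps -> U (fun k => Rabs (x k - l) < eps)) ->
  U (fun k => x k <= b) -> l <= b.
Proof.
  intros Hl Hb. destruct (Rle_lt_dec l b) as [|Hn]; [assumption |].
  destruct (uf_ex U HU _ (uf_and U HU _ _ (Hl (l - b) ltac:(lra)) Hb)) as [k [H1 H2]].
  apply Rabs_def2 in H1. lra.
Qed.

Lemma ultralimit_ge (x : nat -> R) (l b : R) :
  (forall eps, 0 < eps -> U (fun k => Rabs (x k - l) < eps)) ->
  U (fun k => b <= x k) -> b <= l.
Proof.
  intros Hl Hb. destruct (Rle_lt_dec b l) as [|Hn]; [assumption |].
  destruct (uf_ex U HU _ (uf_and U HU _ _ (Hl (b - l) ltac:(lra)) Hb)) as [k [H1 H2]].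
  apply Rabs_def2 in H1. lra.
Qed.

(** The last hypothesis gives a neighbourhood of [x0] that serves for all indices of a set in [U].
    On it the mean value theorem for [y k t - l * t] yields an increment inequality, which is closed
    and so passes to the limit. *)
Lemma ultralimit_derive (y z : nat -> R -> R) (Y : R -> R) (x0 l : R) :
  (forall k x, is_derive (y k) x (z k x)) ->
  (forall x eps, 0 < eps -> U (fun k => Rabs (y k x - Y x) < eps)) ->
  (forall eps, 0 < eps -> exists d, 0 < d /\
     U (fun k => forall x, Rabs (x - x0) < d -> Rabs (z k x - l) <= eps)) ->
  is_derive Y x0 l.
Proof.
  intros Hd HY Hz. apply is_derive_of_bound. intros eps He.
  destruct (Hz eps He) as [d [Hd0 HUd]]. exists d. split; [exact Hd0 |].
  intros x Hx. apply Rnot_lt_le. intros Hgap.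
  (* One index whose function is within half of the excess at both [x] and [x0] already gives the
     contradiction. *)
  set (gap := Rabs (Y x - Y x0 - l * (x - x0)) - eps * Rabs (x - x0)).
  assert (Hg : 0 < gap) by (unfold gap; lra).
  destruct (uf_ex U HU _ (uf_and U HU _ _ HUd (uf_and U HU _ _
     (HY x (gap / 2) ltac:(lra)) (HY x0 (gap / 2) ltac:(lra))))) as [k [H1 [H2 H3]]].
  assert (H := increment_bound (fun t => y k t - l * t) (fun t => z k t - l) x0 x eps).
  assert (H4 : Rabs (y k x - l * x - (y k x0 - l * x0)) <= eps * Rabs (x - x0)).
  { apply H. intros t Ht. split; [| apply H1; lra].
    auto_derive; [exists (z k t); apply Hd |].
    rewrite (Derive_at (y k) t _ (Hd k t)). ring. }
  apply Rabs_le_between in H4. apply Rabs_def2 in H2. apply Rabs_def2 in H3.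
  assert (Rabs (Y x - Y x0 - l * (x - x0)) < eps * Rabs (x - x0) + gap);
    [apply Rabs_def1; lra | unfold gap in *; lra].
Qed.

(** A substitute for the Arzela-Ascoli theorem: the bounds give pointwise limits, and the bounds on
    derivatives make [u k] and [v k] equi-Lipschitz near each point. The convergence of [w k] is
    required jointly in [x] and in the value of [u k], so that the lemma covers both Picard
    iterates, where [w k] involves the preceding iterate, and nonlinearities that vary with [k]. *)
Lemma ultralimit_C2 (u v w : nat -> R -> R) (f : R -> R -> R) :
  (forall k x, is_derive (u k) x (v k x) /\ is_derive (v k) x (w k x)) ->
  (forall X, exists B, forall k x, Rabs x <= X ->
     Rabs (u k x) <= B /\ Rabs (v k x) <= B /\ Rabs (w k x) <= B) ->
  (forall x0 s eps, 0 < eps -> exists eta, 0 < eta /\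
     U (fun k => forall x, Rabs (x - x0) < eta -> Rabs (u k x - s) < eta ->
                  Rabs (w k x - f x0 s) < eps)) ->
  exists u' v' : R -> R,
    (forall x eps, 0 < eps -> U (fun k => Rabs (u k x - u' x) < eps)) /\
    (forall x eps, 0 < eps -> U (fun k => Rabs (v k x - v' x) < eps)) /\
    (forall x, is_derive u' x (v' x) /\ is_derive v' x (f x (u' x))).
Proof.
  intros Hd HB Hw.
  destruct (functional_choice (fun x l => forall eps, 0 < eps -> U (fun k => Rabs (u k x - l) < eps)))
    as [u' Hu'].
  { intros x. destruct (HB (Rabs x)) as [B HBx].
    apply ultralimit_exists with B; [exact HU |]. intros k. apply HBx. lra. }
  destruct (functional_choice (fun x l => forall eps, 0 < eps -> U (fun k => Rabs (v k x - l) < eps)))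
    as [v' Hv'].
  { intros x. destruct (HB (Rabs x)) as [B HBx].
    apply ultralimit_exists with B; [exact HU |]. intros k. apply HBx. lra. }
  exists u', v'. split; [exact Hu' |]. split; [exact Hv' |].
  intros x0. destruct (HB (Rabs x0 + 1)) as [B HBx].
  assert (HB0 : 0 <= B).
  { apply Rle_trans with (2 := proj1 (HBx 0%nat x0 ltac:(lra))), Rabs_pos. }
  assert (Hnear : forall x, Rabs (x - x0) < 1 -> Rabs x <= Rabs x0 + 1).
  { intros x Hx. assert (H := Rabs_triang (x - x0) x0).
    replace (x - x0 + x0) with x in H by ring. lra. }
  assert (Hsmall : forall eps, 0 < eps -> exists d, 0 < d /\ d <= 1 /\ B * d <= eps / 2).
  { intros eps He. exists (Rmin 1 (eps / 2 / (B + 1))).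
    assert (Hq : 0 < eps / 2 / (B + 1)) by (apply Rdiv_lt_0_compat; lra).
    split; [apply Rmin_pos; lra |]. split; [apply Rmin_l |].
    apply Rle_trans with (B * (eps / 2 / (B + 1))).
    - apply Rmult_le_compat_l; [exact HB0 | apply Rmin_r].
    - apply Rle_trans with ((B + 1) * (eps / 2 / (B + 1))).
      + apply Rmult_le_compat_r; lra.
      + right. field. lra. }
  split.
  - apply (ultralimit_derive u v); [intros k x; apply Hd | exact Hu' |].
    intros eps He. destruct (Hsmall eps He) as [d [Hd0 [Hd1 Hd2]]].
    exists d. split; [exact Hd0 |].
    apply (uf_imp U HU) with (1 := Hv' x0 (eps / 2) ltac:(lra)).
    intros k Hk x Hx.
    assert (H := increment_bound (v k) (w k) x0 x B).
    assert (H1 : Rabs (v k x - v k x0) <= B * Rabs (x - x0)).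
    { apply H. intros t Ht. split; [apply Hd | apply HBx, Hnear; lra]. }
    assert (H2 : B * Rabs (x - x0) <= B * d) by (apply Rmult_le_compat_l; lra).
    assert (H3 := Rabs_triang (v k x - v k x0) (v k x0 - v' x0)).
    replace (v k x - v k x0 + (v k x0 - v' x0)) with (v k x - v' x0) in H3 by ring. lra.
  - apply (ultralimit_derive v w); [intros k x; apply Hd | exact Hv' |].
    intros eps He. destruct (Hw x0 (u' x0) eps He) as [eta [Heta HUe]].
    destruct (Hsmall eta Heta) as [d [Hd0 [Hd1 Hd2]]].
    exists (Rmin d eta). split; [apply Rmin_pos; lra |].
    apply (uf_imp U HU) with (1 := uf_and U HU _ _ HUe (Hu' x0 (eta / 2) ltac:(lra))).
    intros k [Hk1 Hk2] x Hx.
    assert (Hxd : Rabs (x - x0) < d) by (apply Rlt_le_trans with (1 := Hx), Rmin_l).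
    assert (Hxe : Rabs (x - x0) < eta) by (apply Rlt_le_trans with (1 := Hx), Rmin_r).
    left. apply Hk1; [exact Hxe |].
    assert (H := increment_bound (u k) (v k) x0 x B).
    assert (H1 : Rabs (u k x - u k x0) <= B * Rabs (x - x0)).
    { apply H. intros t Ht. split; [apply Hd | apply HBx, Hnear; lra]. }
    assert (H2 : B * Rabs (x - x0) <= B * d) by (apply Rmult_le_compat_l; lra).
    assert (H3 := Rabs_triang (u k x - u k x0) (u k x0 - u' x0)).
    replace (u k x - u k x0 + (u k x0 - u' x0)) with (u k x - u' x0) in H3 by ring. lra.
Qed.

End Ultralimit.

(** * Global solution of initial value problems for a Lipschitz nonlinearity *)

Section Picard.
Variables (c h : R -> R) (C K : R).
Hypothesis (Hc : forall x, continuity_pt c x) (HC : forall x, Rabs (c x) <= C)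
  (Hlip : forall s t, Rabs (h s - h t) <= K * Rabs (s - t)).

Lemma picard_constants : 0 <= C /\ 0 <= K.
Proof.
  split.
  - apply Rle_trans with (2 := HC 0), Rabs_pos.
  - assert (H := Hlip 1 0). rewrite (Rabs_right (1 - 0)) in H by lra.
    assert (H1 := Rabs_pos (h 1 - h 0)). lra.
Qed.

Lemma lipschitz_continuity (s : R) : continuity_pt h s.
Proof.
  destruct picard_constants as [_ HK].
  intros eps He. exists (eps / (K + 1)). split; [apply Rdiv_lt_0_compat; lra |].
  intros t [_ Ht]. simpl in *. unfold R_dist in *.
  apply Rle_lt_trans with (1 := Hlip t s).
  apply Rle_lt_trans with ((K + 1) * Rabs (t - s)).
  - assert (H := Rabs_pos (t - s)). apply Rmult_le_compat_r; lra.
  - apply Rmult_lt_reg_r with (/ (K + 1)); [apply Rinv_0_lt_compat; lra |].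
    replace ((K + 1) * Rabs (t - s) * / (K + 1)) with (Rabs (t - s)) by (field; lra).
    exact Ht.
Qed.

Lemma is_derive_primitive (f : R -> R) (k x : R) :
  (forall y, continuity_pt f y) -> is_derive (fun x => k + RInt f 0 x) x (f x).
Proof.
  intros Hf.
  assert (Hfc : forall y, continuous f y)
    by (intros y; apply continuity_pt_filterlim, Hf).
  replace (f x) with (plus 0 (f x)) by (unfold plus; simpl; ring).
  apply (is_derive_plus (fun _ => k) (RInt f 0)).
  - apply (is_derive_const (K := R_AbsRing) (V := R_NormedModule)).
  - apply (is_derive_RInt f (RInt f 0) 0 x); [| apply Hfc].
    exists (mkposreal 1 Rlt_0_1). intros y _.
    apply (RInt_correct (V := R_CompleteNormedModule)).
    apply (ex_RInt_continuous (V := R_CompleteNormedModule)). intros; apply Hfc.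
Qed.

Definition picard_v (be : R) (u : R -> R) (x : R) : R :=
  be + RInt (fun t => - (c t * h (u t))) 0 x.

Definition picard_u (al be : R) (u : R -> R) (x : R) : R :=
  al + RInt (picard_v be u) 0 x.

Fixpoint picard (al be : R) (n : nat) : R -> R :=
  match n with
  | O => fun _ => al
  | S n => picard_u al be (picard al be n)
  end.

Lemma is_derive_picard_v (be : R) (u : R -> R) (x : R) :
  (forall x, continuity_pt u x) ->
  is_derive (picard_v be u) x (- (c x * h (u x))).
Proof.
  intros Hu. apply (is_derive_primitive (fun t => - (c t * h (u t)))).
  intros y. apply continuity_pt_opp, continuity_pt_mult; [apply Hc |].
  apply (continuity_pt_comp u h); [apply Hu | apply lipschitz_continuity].
Qed.

Lemma is_derive_picard_u (al be : R) (u : R -> R) (x : R) :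
  (forall x, continuity_pt u x) ->
  is_derive (picard_u al be u) x (picard_v be u x).
Proof.
  intros Hu. apply is_derive_primitive. intros y.
  exact (is_derive_continuity_pt _ _ _ (is_derive_picard_v be u y Hu)).
Qed.

Lemma picard_continuity (al be : R) (n : nat) (x : R) : continuity_pt (picard al be n) x.
Proof.
  revert x. induction n as [|n IH]; intros x; simpl.
  - apply continuity_pt_const. intros ? ?. reflexivity.
  - exact (is_derive_continuity_pt _ _ _ (is_derive_picard_u al be (picard al be n) x IH)).
Qed.

Lemma picard_at_0 (al be : R) (n : nat) : picard al be n 0 = al.
Proof.
  destruct n as [|n]; simpl; [reflexivity |].
  unfold picard_u. rewrite RInt_point. unfold zero; simpl. ring.
Qed.

Lemma picard_v_at_0 (be : R) (u : R -> R) : picard_v be u 0 = be.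
Proof. unfold picard_v. rewrite RInt_point. unfold zero; simpl. ring. Qed.

Definition weight (b x : R) : R := exp (b * x) + exp (- (b * x)).

Lemma weight_ge_1 (b x : R) : 1 <= weight b x.
Proof.
  unfold weight. assert (H := exp_pos (b * x)). assert (H' := exp_pos (- (b * x))).
  destruct (Rle_lt_dec 0 (b * x)) as [Hb|Hb].
  - assert (H1 := exp_ineq1_le (b * x)). lra.
  - assert (H1 := exp_ineq1_le (- (b * x))). lra.
Qed.

Lemma weight_bound (b x X : R) : 0 <= b -> Rabs x <= X -> weight b x <= 2 * exp (b * X).
Proof.
  intros Hb Hx. apply Rabs_le_between in Hx. unfold weight.
  assert (H : forall y, y <= b * X -> exp y <= exp (b * X)).
  { intros y [Hy|Hy]; [left; apply exp_increasing, Hy | right; f_equal; exact Hy]. }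
  assert (H1 : exp (b * x) <= exp (b * X))
    by (apply H, Rmult_le_compat_l; lra).
  assert (H2 : exp (- (b * x)) <= exp (b * X)).
  { apply H. replace (- (b * x)) with (b * (- x)) by ring.
    apply Rmult_le_compat_l; lra. }
  lra.
Qed.

(** The primitive [(exp (b x) - exp (- b x)) / b] of the weight is bounded by the weight over [b].
    Each integration thus gains a factor [1 / b], on both half-lines at once, and the two
    integrations of a Picard step gain [1 / b^2]. *)
Lemma weight_primitive (y z : R -> R) (b m : R) :
  0 < b -> (forall x, is_derive y x (z x)) -> (forall x, Rabs (z x) <= m * weight b x) ->
  forall x, Rabs (y x - y 0) <= m / b * weight b x.
Proof.
  intros Hb Hd Hz x.
  assert (Hm : 0 <= m).
  { assert (H := Hz 0). assert (H1 := Rabs_pos (z 0)). assert (H2 := weight_ge_1 b 0).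
    apply Rmult_le_reg_r with (weight b 0); lra. }
  set (G := fun x => m / b * (exp (b * x) - exp (- (b * x)))).
  assert (HG : forall x, is_derive G x (m * weight b x)).
  { intros t. unfold G, weight. auto_derive; [exact I | field; lra]. }
  assert (HG0 : G 0 = 0).
  { unfold G. rewrite Rmult_0_r, Ropp_0. ring. }
  assert (Hmb : 0 <= m / b) by (apply Rmult_le_pos; [exact Hm | left; apply Rinv_0_lt_compat, Hb]).
  assert (HGx : Rabs (G x) <= m / b * weight b x).
  { unfold G. rewrite Rabs_mult, (Rabs_right (m / b)) by lra.
    apply Rmult_le_compat_l; [exact Hmb |]. unfold weight.
    assert (H1 := exp_pos (b * x)). assert (H2 := exp_pos (- (b * x))).
    apply Rabs_le_between. lra. }
  assert (Hp : forall t, is_derive (fun x => G x + y x) t (m * weight b t + z t)).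
  { intros t. apply (is_derive_plus G y); [apply HG | apply Hd]. }
  assert (Hq : forall t, is_derive (fun x => G x - y x) t (m * weight b t - z t)).
  { intros t. apply (is_derive_minus G y); [apply HG | apply Hd]. }
  assert (Hzb : forall t, - (m * weight b t) <= z t <= m * weight b t)
    by (intros t; apply Rabs_le_between, Hz).
  apply Rle_trans with (2 := HGx).
  destruct (Rle_lt_dec 0 x) as [Hx|Hx].
  - assert (H1 := MVT_lower _ _ 0 x 0 Hx (fun t _ => Hp t) (fun t _ => ltac:(specialize (Hzb t); lra))).
    assert (H2 := MVT_lower _ _ 0 x 0 Hx (fun t _ => Hq t) (fun t _ => ltac:(specialize (Hzb t); lra))).
    apply Rle_trans with (2 := Rle_abs _). apply Rabs_le_between. lra.
  - assert (Hx' : x <= 0) by lra.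
    assert (H1 := MVT_lower _ _ x 0 0 Hx' (fun t _ => Hp t) (fun t _ => ltac:(specialize (Hzb t); lra))).
    assert (H2 := MVT_lower _ _ x 0 0 Hx' (fun t _ => Hq t) (fun t _ => ltac:(specialize (Hzb t); lra))).
    rewrite <- (Rabs_Ropp (G x)).
    apply Rle_trans with (2 := Rle_abs _). apply Rabs_le_between. lra.
Qed.

(** The weight [exp (b x) + exp (- b x)] with [b] large makes the Picard operator a
    contraction of ratio 1/2 on the whole line. *)
Lemma picard_increment (al be b A0 : R) (n : nat) (x : R) :
  0 < b -> 2 * (C * K) <= b * b ->
  (forall x, Rabs (picard al be 1 x - al) <= A0 * weight b x) ->
  Rabs (picard al be (S n) x - picard al be n x) <= A0 * (1 / 2) ^ n * weight b x.
Proof.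
  intros Hb Hbb H0. destruct picard_constants as [HC0 HK].
  revert x. induction n as [|n IH]; intros x.
  - rewrite pow_O, Rmult_1_r. apply H0.
  - set (p := picard al be n) in *. set (q := picard al be (S n)) in *.
    assert (Hcp : forall x, continuity_pt p x) by apply picard_continuity.
    assert (Hcq : forall x, continuity_pt q x) by apply picard_continuity.
    change (picard al be (S (S n)) x) with (picard_u al be q x).
    change (q x) with (picard_u al be p x).
    assert (Hm : 0 <= A0 * (1 / 2) ^ n).
    { assert (H := IH 0). assert (H1 := weight_ge_1 b 0).
      assert (H2 := Rabs_pos (q 0 - p 0)). apply Rmult_le_reg_r with (weight b 0); lra. }
    set (m := A0 * (1 / 2) ^ n) in *.
    assert (Hw := weight_primitive
       (fun x => picard_v be q x - picard_v be p x)
       (fun x => - (c x * h (q x)) - - (c x * h (p x))) b (C * K * m) Hb).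
    assert (Hw1 : forall x, Rabs (picard_v be q x - picard_v be p x)
                     <= C * K * m / b * weight b x).
    { intros t. assert (Hw' := fun a1 a2 => Hw a1 a2 t). cbv beta in Hw'.
      rewrite !picard_v_at_0 in Hw'.
      replace (picard_v be q t - picard_v be p t - (be - be))
        with (picard_v be q t - picard_v be p t) in Hw' by ring.
      apply Hw'.
      - intros y. apply (is_derive_minus (picard_v be q) (picard_v be p));
          apply is_derive_picard_v; assumption.
      - intros y. replace (- (c y * h (q y)) - - (c y * h (p y)))
          with (c y * (h (p y) - h (q y))) by ring.
        rewrite Rabs_mult.
        apply Rle_trans with (C * (K * (m * weight b y))); [| right; ring].
        apply Rmult_le_compat; try apply Rabs_pos; [apply HC |].
        apply Rle_trans with (1 := Hlip _ _). apply Rmult_le_compat_l; [exact HK |].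
        rewrite Rabs_minus_sym. apply IH. }
    assert (Hv := weight_primitive
       (fun x => picard_u al be q x - picard_u al be p x)
       (fun x => picard_v be q x - picard_v be p x) b (C * K * m / b) Hb).
    assert (Hv' : Rabs (picard_u al be q x - picard_u al be p x)
                     <= C * K * m / b / b * weight b x).
    { assert (Hw' := fun a1 a2 => Hv a1 a2 x). cbv beta in Hw'.
      replace (picard_u al be q x - picard_u al be p x)
        with (picard_u al be q x - picard_u al be p x
               - (picard_u al be q 0 - picard_u al be p 0)).
      - apply Hw'; [| exact Hw1].
        intros y. apply (is_derive_minus (picard_u al be q) (picard_u al be p));
          apply is_derive_picard_u; assumption.
      - change (picard_u al be q 0) with (picard al be (S (S n)) 0).
        change (picard_u al be p 0) with (picard al be (S n) 0).
        rewrite !picard_at_0. ring. }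
    apply Rle_trans with (1 := Hv').
    apply Rmult_le_compat_r; [assert (H1 := weight_ge_1 b x); lra |].
    simpl pow. unfold m.
    replace (A0 * (1 / 2 * (1 / 2) ^ n)) with (1 / 2 * (A0 * (1 / 2) ^ n)) by ring.
    fold m. replace (C * K * m / b / b) with (C * K / (b * b) * m) by (field; lra).
    apply Rmult_le_compat_r; [exact Hm |].
    apply Rmult_le_reg_r with (b * b); [apply Rmult_lt_0_compat; lra |].
    replace (C * K / (b * b) * (b * b)) with (C * K) by (field; lra). lra.
Qed.

(** The iterates form a geometric Cauchy sequence in the weighted norm. Their limit is taken along
    an ultrafilter because [ultralimit_C2] then delivers the limit together with its two
    derivatives. *)
Lemma ivp_exists (al be : R) :
  exists u v, ode c h u v /\ u 0 = al /\ v 0 = be.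
Proof.
  destruct picard_constants as [HC0 HK].
  destruct free_ultrafilter_exists as [U HU].
  assert (HCK : 0 <= C * K) by (apply Rmult_le_pos; lra).
  set (b := 2 * (C * K) + 1).
  assert (Hb : 0 < b) by (unfold b; lra).
  assert (Hbb : 2 * (C * K) <= b * b).
  { unfold b. assert (0 <= (C * K) * (C * K)) by (apply Rmult_le_pos; lra). lra. }
  set (pic := picard al be).
  set (m0 := C * Rabs (h al)).
  assert (Hm0 : 0 <= m0) by (apply Rmult_le_pos; [exact HC0 | apply Rabs_pos]).
  assert (Hcont : forall n x, continuity_pt (pic n) x) by (intros; apply picard_continuity).
  (* A weighted bound on the source propagates through both integrations. It is used first for the
     constant iterate, which gives [A0], and then for every iterate, which bounds the slopes. *)
  assert (Hchain : forall n m, 0 <= m ->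
    (forall x, Rabs (c x * h (pic n x)) <= m * weight b x) ->
    (forall x, Rabs (picard_v be (pic n) x) <= (Rabs be + m / b) * weight b x) /\
    (forall x, Rabs (pic (S n) x - al) <= (Rabs be + m / b) / b * weight b x)).
  { intros n m Hm Hn.
    assert (Hn' : forall x, Rabs (- (c x * h (pic n x))) <= m * weight b x)
      by (intros x; rewrite Rabs_Ropp; apply Hn).
    assert (H1 : forall x, Rabs (picard_v be (pic n) x) <= (Rabs be + m / b) * weight b x).
    { intros x.
      assert (H := weight_primitive (picard_v be (pic n)) (fun x => - (c x * h (pic n x))) b m Hb
         (fun x => is_derive_picard_v be (pic n) x (Hcont n))
         Hn' x).
      rewrite picard_v_at_0 in H.
      assert (Ht := Rabs_triang (picard_v be (pic n) x - be) be).
      replace (picard_v be (pic n) x - be + be) with (picard_v be (pic n) x) in Ht by ring.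
      assert (Hw := weight_ge_1 b x).
      assert (Rabs be * 1 <= Rabs be * weight b x)
        by (apply Rmult_le_compat_l; [apply Rabs_pos | exact Hw]).
      lra. }
    split; [exact H1 |]. intros x.
    assert (H := weight_primitive (pic (S n)) (picard_v be (pic n)) b _ Hb
         (fun x => is_derive_picard_u al be (pic n) x (Hcont n)) H1 x).
    unfold pic in H at 2. rewrite picard_at_0 in H. exact H. }
  set (A0 := (Rabs be + m0 / b) / b).
  assert (H1 : forall x, Rabs (pic 1%nat x - al) <= A0 * weight b x).
  { apply Hchain; [exact Hm0 |]. intros x. simpl.
    rewrite Rabs_mult. assert (Hw := weight_ge_1 b x).
    apply Rle_trans with (m0 * 1); [| apply Rmult_le_compat_l; lra].
    rewrite Rmult_1_r. apply Rmult_le_compat_r; [apply Rabs_pos | apply HC]. }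
  assert (HA0 : 0 <= A0).
  { assert (H := H1 0). assert (H2 := weight_ge_1 b 0).
    assert (H3 := Rabs_pos (pic 1%nat 0 - al)).
    apply Rmult_le_reg_r with (weight b 0); lra. }
  assert (Hinc : forall n x, Rabs (pic (S n) x - pic n x) <= A0 * (1 / 2) ^ n * weight b x)
    by (intros; apply picard_increment; assumption).
  assert (Hpow : forall n, 0 < (1 / 2) ^ n) by (intros; apply pow_lt; lra).
  (* The factor [2 - 2 * (1 / 2) ^ n] is the partial sum of the geometric series of increments. *)
  assert (Hu : forall n x, Rabs (pic n x - al) <= (2 - 2 * (1 / 2) ^ n) * A0 * weight b x).
  { intros n x. induction n as [|n IH].
    - change (pic 0%nat x) with al. rewrite Rminus_diag, Rabs_R0, pow_O. lra.
    - assert (Ht := Rabs_triang (pic (S n) x - pic n x) (pic n x - al)).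
      replace (pic (S n) x - pic n x + (pic n x - al)) with (pic (S n) x - al) in Ht by ring.
      specialize (Hinc n x). simpl pow. lra. }
  assert (Hu2 : forall n x, Rabs (pic n x - al) <= 2 * A0 * weight b x).
  { intros n x. apply Rle_trans with (1 := Hu n x).
    apply Rmult_le_compat_r; [assert (H := weight_ge_1 b x); lra |].
    apply Rmult_le_compat_r; [exact HA0 | specialize (Hpow n); lra]. }
  set (m1 := m0 + C * K * (2 * A0)).
  assert (Hm1 : 0 <= m1).
  { assert (0 <= C * K * (2 * A0)) by (apply Rmult_le_pos; lra). unfold m1. lra. }
  assert (Hw : forall n x, Rabs (c x * h (pic n x)) <= m1 * weight b x).
  { intros n x. assert (Hwt := weight_ge_1 b x).
    assert (Hh : Rabs (h (pic n x)) <= Rabs (h al) + K * (2 * A0 * weight b x)).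
    { assert (Ht := Rabs_triang (h (pic n x) - h al) (h al)).
      replace (h (pic n x) - h al + h al) with (h (pic n x)) in Ht by ring.
      assert (Hl := Hlip (pic n x) al).
      assert (K * Rabs (pic n x - al) <= K * (2 * A0 * weight b x))
        by (apply Rmult_le_compat_l; [exact HK | apply Hu2]). lra. }
    rewrite Rabs_mult.
    apply Rle_trans with (C * (Rabs (h al) + K * (2 * A0 * weight b x))).
    - apply Rmult_le_compat; try apply Rabs_pos; [apply HC | exact Hh].
    - unfold m1, m0. assert (C * Rabs (h al) * 1 <= C * Rabs (h al) * weight b x)
        by (apply Rmult_le_compat_l; [exact Hm0 | exact Hwt]). lra. }
  (* The second derivative of [pic (S k)] involves [pic k], one index behind; the shift is harmless
     because consecutive iterates approach each other, locally uniformly. *)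
  destruct (ultralimit_C2 U HU (fun k => pic (S k)) (fun k => picard_v be (pic k))
    (fun k x => - (c x * h (pic k x))) (fun x s => - (c x * h s))) as [u [v [Lu [Lv Hode]]]].
  - intros k x. split; [apply is_derive_picard_u, Hcont | apply is_derive_picard_v, Hcont].
  - intros X. set (W := 2 * exp (b * X)).
    exists (Rabs al + 2 * A0 * W + (Rabs be + m1 / b) * W + m1 * W).
    intros k x Hx. assert (HwX := weight_bound b x X (Rlt_le _ _ Hb) Hx). fold W in HwX.
    assert (Hw1 := weight_ge_1 b x).
    assert (Hmb : 0 <= m1 / b) by (apply Rmult_le_pos; [exact Hm1 | left; apply Rinv_0_lt_compat, Hb]).
    assert (P1 := Rabs_pos al). assert (P2 := Rabs_pos be).
    assert (Q1 : 2 * A0 * weight b x <= 2 * A0 * W) by (apply Rmult_le_compat_l; lra).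
    assert (Q2 : (Rabs be + m1 / b) * weight b x <= (Rabs be + m1 / b) * W)
      by (apply Rmult_le_compat_l; lra).
    assert (Q3 : m1 * weight b x <= m1 * W) by (apply Rmult_le_compat_l; lra).
    assert (S1 : 0 <= 2 * A0 * weight b x) by (apply Rmult_le_pos; lra).
    assert (S2 : 0 <= (Rabs be + m1 / b) * weight b x) by (apply Rmult_le_pos; lra).
    assert (S3 : 0 <= m1 * weight b x) by (apply Rmult_le_pos; lra).
    split; [| split].
    + assert (Ht := Rabs_triang (pic (S k) x - al) al).
      replace (pic (S k) x - al + al) with (pic (S k) x) in Ht by ring.
      specialize (Hu2 (S k) x). lra.
    + destruct (Hchain k m1 Hm1 (Hw k)) as [Hv _]. specialize (Hv x). lra.
    + rewrite Rabs_Ropp. specialize (Hw k x). lra.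
  - intros x0 s eps He.
    set (M := C * K + Rabs (h s) + 1).
    assert (HM : 0 < M) by (assert (H := Rabs_pos (h s)); unfold M; lra).
    set (e1 := eps / (4 * M)).
    assert (He1 : 0 < e1) by (apply Rdiv_lt_0_compat; lra).
    destruct (Hc x0 e1 He1) as [d [Hd Hdc]].
    exists (Rmin 1 (Rmin e1 d)). split; [repeat apply Rmin_pos; lra |].
    set (W := 2 * exp (b * (Rabs x0 + 1))).
    assert (HW : 0 < W) by (assert (H := exp_pos (b * (Rabs x0 + 1))); unfold W; lra).
    destruct (pow_lt_1_zero (1 / 2) ltac:(rewrite Rabs_right; lra)
       (e1 / ((A0 + 1) * W))) as [N HN].
    { apply Rdiv_lt_0_compat; [exact He1 | apply Rmult_lt_0_compat; lra]. }
    apply (uf_imp U HU) with (1 := uf_tail U HU N). intros k Hk x Hx Hux.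
    assert (Hx1 : Rabs (x - x0) < 1) by (apply Rlt_le_trans with (1 := Hx), Rmin_l).
    assert (Hx2 : Rabs (x - x0) < d).
    { apply Rlt_le_trans with (1 := Hx), Rle_trans with (1 := Rmin_r _ _), Rmin_r. }
    assert (Hu1 : Rabs (pic (S k) x - s) < e1).
    { apply Rlt_le_trans with (1 := Hux), Rle_trans with (1 := Rmin_r _ _), Rmin_l. }
    assert (HxW : weight b x <= W).
    { apply weight_bound; [lra |]. assert (H := Rabs_triang (x - x0) x0).
      replace (x - x0 + x0) with x in H by ring. lra. }
    assert (Hk2 : Rabs (pic (S k) x - pic k x) < e1).
    { apply Rle_lt_trans with (1 := Hinc k x).
      specialize (HN k Hk). rewrite Rabs_right in HN by (specialize (Hpow k); lra).
      assert (Hw1 := weight_ge_1 b x). specialize (Hpow k).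
      apply Rle_lt_trans with ((A0 + 1) * (1 / 2) ^ k * W).
      - apply Rmult_le_compat; [apply Rmult_le_pos; lra | lra | | exact HxW].
        apply Rmult_le_compat_r; lra.
      - apply Rmult_lt_reg_r with (/ ((A0 + 1) * W)).
        + apply Rinv_0_lt_compat, Rmult_lt_0_compat; lra.
        + replace ((A0 + 1) * (1 / 2) ^ k * W * / ((A0 + 1) * W)) with ((1 / 2) ^ k)
            by (field; lra). exact HN. }
    assert (Hcx : Rabs (c x - c x0) < e1).
    { destruct (Req_dec x x0) as [->|Hne].
      - replace (c x0 - c x0) with 0 by ring. rewrite Rabs_R0. exact He1.
      - apply Hdc. simpl. unfold R_dist. split; [split; [exact I | auto] | exact Hx2]. }
    replace (- (c x * h (pic k x)) - - (c x0 * h s))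
      with (c x * (h s - h (pic k x)) + (c x0 - c x) * h s) by ring.
    apply Rle_lt_trans with (1 := Rabs_triang _ _). rewrite !Rabs_mult.
    assert (G1 : Rabs (h s - h (pic k x)) <= K * (2 * e1)).
    { apply Rle_trans with (1 := Hlip _ _). apply Rmult_le_compat_l; [exact HK |].
      assert (Ht := Rabs_triang (s - pic (S k) x) (pic (S k) x - pic k x)).
      replace (s - pic (S k) x + (pic (S k) x - pic k x)) with (s - pic k x) in Ht by ring.
      rewrite (Rabs_minus_sym s (pic (S k) x)) in Ht. lra. }
    assert (G2 : Rabs (c x) * Rabs (h s - h (pic k x)) <= C * (K * (2 * e1))).
    { apply Rmult_le_compat; try apply Rabs_pos; [apply HC | exact G1]. }
    assert (G3 : Rabs (c x0 - c x) * Rabs (h s) <= e1 * Rabs (h s)).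
    { apply Rmult_le_compat_r; [apply Rabs_pos |]. rewrite Rabs_minus_sym. lra. }
    assert (G4 : e1 * (4 * M) = eps) by (unfold e1; field; lra).
    assert (G5 : 0 <= e1 * (C * K)) by (apply Rmult_le_pos; lra).
    assert (G6 : 0 <= e1 * Rabs (h s)) by (apply Rmult_le_pos; [lra | apply Rabs_pos]).
    unfold M in G4. lra.
  - exists u, v. split; [| split].
    + intros x. apply Hode.
    + apply (ultralimit_unique U HU (fun k => pic (S k) 0)); [apply Lu |].
      intros eps He. apply (uf_imp U HU) with (1 := uf_tail U HU 0). intros k _.
      unfold pic. rewrite picard_at_0. rewrite Rminus_diag, Rabs_R0. lra.
    + apply (ultralimit_unique U HU (fun k => picard_v be (pic k) 0)); [apply Lv |].
      intros eps He. apply (uf_imp U HU) with (1 := uf_tail U HU 0). intros k _.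
      rewrite picard_v_at_0. rewrite Rminus_diag, Rabs_R0. lra.
Qed.

End Picard.

(** The defect [eta] of [gronwall] absorbs the difference of the coefficients. One statement thus
    gives dependence on the initial data (with [eta = 0]) and on the eigenvalue parameter. *)
Lemma ode_dependence (c1 c2 h u1 v1 u2 v2 : R -> R) (C K eta X : R) :
  0 <= X -> 0 <= eta ->
  (forall x, Rabs (c1 x) <= C) ->
  (forall s t, Rabs (h s - h t) <= K * Rabs (s - t)) ->
  ode c1 h u1 v1 -> ode c2 h u2 v2 ->
  (forall x, 0 <= x <= X -> Rabs ((c1 x - c2 x) * h (u2 x)) <= C * K * eta) ->
  (u1 X - u2 X)^2 <=
    ((u1 0 - u2 0)^2 + (v1 0 - v2 0)^2 + eta^2) * exp ((1 + 2 * (C * K)) * X).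
Proof.
  intros HX He HC Hlip Ho1 Ho2 Hdiff.
  destruct (picard_constants c1 h C K HC Hlip) as [HC0 HK].
  assert (H := gronwall (fun x => u1 x - u2 x) (fun x => v1 x - v2 x)
     (fun x => - (c1 x * h (u1 x)) - - (c2 x * h (u2 x))) 0 X (C * K) eta).
  cbv beta in H. rewrite Rminus_0_r in H.
  apply Rle_trans with ((u1 X - u2 X) ^ 2 + (v1 X - v2 X) ^ 2 + eta ^ 2).
  - assert (P1 := pow2_ge_0 (v1 X - v2 X)). assert (P2 := pow2_ge_0 eta). lra.
  - apply H; [apply Rmult_le_pos; lra | exact He | exact HX | |].
    + intros x _. split.
      * apply (is_derive_minus u1 u2); [apply Ho1 | apply Ho2].
      * apply (is_derive_minus v1 v2); [apply Ho1 | apply Ho2].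
    + intros x Hx.
      replace (- (c1 x * h (u1 x)) - - (c2 x * h (u2 x)))
        with (- (c1 x * (h (u1 x) - h (u2 x)) + (c1 x - c2 x) * h (u2 x))) by ring.
      rewrite Rabs_Ropp. apply Rle_trans with (1 := Rabs_triang _ _).
      rewrite Rmult_plus_distr_l. apply Rplus_le_compat; [| apply Hdiff, Hx].
      rewrite Rabs_mult, Rmult_assoc.
      apply Rmult_le_compat; try apply Rabs_pos; [apply HC | apply Hlip].
Qed.

(** * Large humps *)

Definition clamp (p q x : R) : R := Rmax p (Rmin x q).

Lemma clamp_Icc (p q x : R) : p <= q -> p <= clamp p q x <= q.
Proof.
  intros H. unfold clamp, Rmax, Rmin. destruct (Rle_dec x q);
    match goal with |- context [Rle_dec ?a ?b] => destruct (Rle_dec a b) end; lra.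
Qed.

Lemma clamp_id (p q x : R) : p <= x <= q -> clamp p q x = x.
Proof. intros H. unfold clamp. rewrite Rmin_left, Rmax_right; lra. Qed.

Lemma clamp_lipschitz (p q x y : R) : Rabs (clamp p q x - clamp p q y) <= Rabs (x - y).
Proof.
  unfold clamp, Rmin. destruct (Rle_dec x q), (Rle_dec y q); unfold Rmax;
    repeat match goal with |- context [Rle_dec p ?b] => destruct (Rle_dec p b) end;
    unfold Rabs;
    repeat match goal with |- context [Rcase_abs ?a] => destruct (Rcase_abs a) end; lra.
Qed.

Lemma continuity_pt_eps (f : R -> R) (x : R) :
  (forall eps, 0 < eps -> exists d, 0 < d /\
     forall y, Rabs (y - x) < d -> Rabs (f y - f x) < eps) -> continuity_pt f x.
Proof.
  intros H eps He. destruct (H eps He) as [d [Hd Hy]]. exists d. split; [exact Hd |].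
  intros y [_ Hyd]. apply Hy, Hyd.
Qed.

Lemma continuity_pt_eps_inv (f : R -> R) (x eps : R) :
  continuity_pt f x -> 0 < eps ->
  exists d, 0 < d /\ forall y, Rabs (y - x) < d -> Rabs (f y - f x) < eps.
Proof.
  intros H He. destruct (H eps He) as [d [Hd Hy]]. exists d. split; [exact Hd |].
  intros y Hyd. destruct (Req_dec y x) as [->|Hne].
  - rewrite Rminus_diag, Rabs_R0. exact He.
  - apply Hy. simpl. unfold R_dist. split; [split; [exact I | auto] | exact Hyd].
Qed.

Lemma continuous_on_eps (D : R -> Prop) (f : R -> R) (x eps : R) :
  continuous_on D f -> D x -> 0 < eps ->
  exists d, 0 < d /\ forall y, D y -> Rabs (y - x) < d -> Rabs (f y - f x) < eps.
Proof.
  intros Hf Hx He.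
  destruct (proj1 (filterlim_locally (F := within D (locally x)) f (f x)) (Hf x Hx)
    (mkposreal eps He)) as [d Hd].
  exists d. split; [apply cond_pos |]. intros y Hy Hyx. exact (Hd y Hyx Hy).
Qed.

Lemma continuity_clamp (f : R -> R) (p q : R) :
  p <= q ->
  (forall x, p <= x <= q -> forall eps, 0 < eps -> exists d, 0 < d /\
     forall y, p <= y <= q -> Rabs (y - x) < d -> Rabs (f y - f x) < eps) ->
  forall x, continuity_pt (fun x => f (clamp p q x)) x.
Proof.
  intros Hpq H x. apply continuity_pt_eps. intros eps He.
  destruct (H (clamp p q x) (clamp_Icc p q x Hpq) eps He) as [d [Hd Hy]].
  exists d. split; [exact Hd |]. intros y Hyx. apply Hy; [apply clamp_Icc, Hpq |].
  apply Rle_lt_trans with (1 := clamp_lipschitz p q y x), Hyx.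
Qed.

Lemma D_in_bound (f f1 : R -> R) (p q x eps : R) :
  D_in f f1 (Icc p q) x -> 0 < eps ->
  exists d, 0 < d /\ forall y, p <= y <= q -> Rabs (y - x) < d ->
    Rabs (f y - f x - f1 x * (y - x)) <= eps * Rabs (y - x).
Proof.
  intros H He. destruct (H eps He) as [d [Hd Hy]]. exists d. split; [exact Hd |].
  intros y Hyq Hyx. destruct (Req_dec y x) as [->|Hne].
  - rewrite !Rminus_diag, Rmult_0_r, Rminus_0_r, Rabs_R0. lra.
  - assert (Hq : Rabs ((f y - f x) / (y - x) - f1 x) < eps).
    { apply Hy. simpl. unfold R_dist, D_x. split; [split; [exact Hyq | auto] | exact Hyx]. }
    replace (f y - f x - f1 x * (y - x)) with (((f y - f x) / (y - x) - f1 x) * (y - x))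
      by (field; lra).
    rewrite Rabs_mult. apply Rmult_le_compat_r; [apply Rabs_pos | lra].
Qed.

Lemma D_in_continuity (f f1 : R -> R) (p q x eps : R) :
  D_in f f1 (Icc p q) x -> 0 < eps ->
  exists d, 0 < d /\ forall y, p <= y <= q -> Rabs (y - x) < d -> Rabs (f y - f x) < eps.
Proof.
  intros H He. destruct (D_in_bound f f1 p q x 1 H Rlt_0_1) as [d [Hd Hy]].
  assert (Hp := Rabs_pos (f1 x)).
  exists (Rmin d (eps / (Rabs (f1 x) + 1))). split.
  - apply Rmin_pos; [exact Hd | apply Rdiv_lt_0_compat; lra].
  - intros y Hyq Hyx.
    assert (H1 : Rabs (y - x) < d) by (apply Rlt_le_trans with (1 := Hyx), Rmin_l).
    assert (H2 : Rabs (y - x) < eps / (Rabs (f1 x) + 1))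
      by (apply Rlt_le_trans with (1 := Hyx), Rmin_r).
    specialize (Hy y Hyq H1).
    assert (H3 := Rabs_triang (f y - f x - f1 x * (y - x)) (f1 x * (y - x))).
    replace (f y - f x - f1 x * (y - x) + f1 x * (y - x)) with (f y - f x) in H3 by ring.
    rewrite (Rabs_mult (f1 x)) in H3.
    apply Rle_lt_trans with ((Rabs (f1 x) + 1) * Rabs (y - x)); [lra |].
    apply Rmult_lt_reg_r with (/ (Rabs (f1 x) + 1)); [apply Rinv_0_lt_compat; lra |].
    replace ((Rabs (f1 x) + 1) * Rabs (y - x) * / (Rabs (f1 x) + 1)) with (Rabs (y - x))
      by (field; lra). exact H2.
Qed.

(** A function differentiable relatively to a closed interval becomes differentiable
    in the usual sense, up to the endpoints, when it is extended by its tangents. *)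
Definition tangent_extension (p q : R) (f f1 : R -> R) (x : R) : R :=
  f (clamp p q x) + f1 (clamp p q x) * (x - clamp p q x).

Lemma tangent_extension_id (p q : R) (f f1 : R -> R) (x : R) :
  p <= x <= q -> tangent_extension p q f f1 x = f x.
Proof. intros H. unfold tangent_extension. rewrite clamp_id by exact H. ring. Qed.

Lemma is_derive_tangent_extension (p q : R) (f f1 : R -> R) (x : R) :
  p < q -> p <= x <= q -> D_in f f1 (Icc p q) x ->
  is_derive (tangent_extension p q f f1) x (f1 x).
Proof.
  intros Hpq Hx HD. apply is_derive_of_bound. intros eps He.
  destruct (D_in_bound f f1 p q x eps HD He) as [d [Hd Hy]].
  (* With these radii a point [y] can leave [[p, q]] only through an endpoint equal to [x], and
     there the extension is exactly the tangent at [x]. *)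
  set (dl := if Rlt_dec p x then x - p else 1).
  set (dr := if Rlt_dec x q then q - x else 1).
  assert (Hdl : 0 < dl) by (unfold dl; destruct (Rlt_dec p x); lra).
  assert (Hdr : 0 < dr) by (unfold dr; destruct (Rlt_dec x q); lra).
  exists (Rmin d (Rmin dl dr)). split; [repeat apply Rmin_pos; assumption |].
  intros y Hyx. rewrite (tangent_extension_id p q f f1 x Hx).
  assert (H1 : Rabs (y - x) < d) by (apply Rlt_le_trans with (1 := Hyx), Rmin_l).
  assert (H2 : Rabs (y - x) < dl).
  { apply Rlt_le_trans with (1 := Hyx), Rle_trans with (1 := Rmin_r _ _), Rmin_l. }
  assert (H3 : Rabs (y - x) < dr).
  { apply Rlt_le_trans with (1 := Hyx), Rle_trans with (1 := Rmin_r _ _), Rmin_r. }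
  apply Rabs_def2 in H2. apply Rabs_def2 in H3.
  destruct (Rlt_le_dec y p) as [Hp|Hp]; [| destruct (Rlt_le_dec q y) as [Hq|Hq]].
  - unfold dl in H2. destruct (Rlt_dec p x); [lra |].
    assert (x = p) by lra. subst x. unfold tangent_extension, clamp.
    rewrite Rmin_left, Rmax_left by lra.
    replace (f p + f1 p * (y - p) - f p - f1 p * (y - p)) with 0 by ring.
    rewrite Rabs_R0. apply Rmult_le_pos; [lra | apply Rabs_pos].
  - unfold dr in H3. destruct (Rlt_dec x q); [lra |].
    assert (x = q) by lra. subst x. unfold tangent_extension, clamp.
    rewrite Rmin_right, Rmax_right by lra.
    replace (f q + f1 q * (y - q) - f q - f1 q * (y - q)) with 0 by ring.
    rewrite Rabs_R0. apply Rmult_le_pos; [lra | apply Rabs_pos].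
  - rewrite tangent_extension_id by lra. apply Hy; [lra | exact H1].
Qed.

Lemma is_derive_D_in (f f1 : R -> R) (D : R -> Prop) (x : R) :
  is_derive f x (f1 x) -> D_in f f1 D x.
Proof.
  intros H. apply is_derive_Reals in H. apply derivable_pt_lim_D_in in H.
  intros eps He. destruct (H eps He) as [d [Hd Hy]]. exists d. split; [exact Hd |].
  intros y [[_ Hy1] Hy2]. apply Hy. split; [split; [exact I | exact Hy1] | exact Hy2].
Qed.

Lemma is_eigenvalue_ext (w w' : R -> R) (p q lam : R) :
  (forall x, p <= x <= q -> w x = w' x) -> is_eigenvalue w p q lam -> is_eigenvalue w' p q lam.
Proof.
  intros Hw (phi & phi2 & H1 & H2 & H3). exists phi, phi2.
  split; [exact H1 |]. split; [| exact H3].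
  intros x Hx. rewrite <- Hw by exact Hx. apply H2, Hx.
Qed.

(** [hk] is the inf-convolution of [h] with [k |.|]. *)
Lemma lipschitz_minorant (h : R -> R) (k : R) :
  0 <= k -> (forall s, 0 <= h s) ->
  exists hk : R -> R,
    (forall s t, hk s <= h t + k * Rabs (s - t)) /\
    (forall s m, (forall t, m <= h t + k * Rabs (s - t)) -> m <= hk s) /\
    (forall s t, Rabs (hk s - hk t) <= k * Rabs (s - t)).
Proof.
  intros Hk Hh.
  destruct (functional_choice (fun s y => (forall t, y <= h t + k * Rabs (s - t)) /\
     forall m, (forall t, m <= h t + k * Rabs (s - t)) -> m <= y)) as [hk Hhk].
  { intros s.
    destruct (completeness (fun y => forall t, y <= h t + k * Rabs (s - t))) as [y [Hy1 Hy2]].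
    - exists (h s + k * Rabs (s - s)). intros y Hy. apply Hy.
    - exists 0. intros t. specialize (Hh t).
      assert (0 <= k * Rabs (s - t)) by (apply Rmult_le_pos; [exact Hk | apply Rabs_pos]). lra.
    - exists y. split.
      + intros t. apply Hy2. intros m Hm. apply Hm.
      + intros m Hm. apply Hy1, Hm. }
  assert (Hhalf : forall s t, hk s - k * Rabs (s - t) <= hk t).
  { intros s t. apply (proj2 (Hhk t)). intros t'.
    assert (H1 := proj1 (Hhk s) t'). assert (H2 := Rabs_triang (s - t) (t - t')).
    replace (s - t + (t - t')) with (s - t') in H2 by ring.
    assert (k * Rabs (s - t') <= k * (Rabs (s - t) + Rabs (t - t')))
      by (apply Rmult_le_compat_l; assumption). lra. }
  exists hk. split; [intros s t; apply (Hhk s) |].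
  split; [intros s m; apply (Hhk s) |].
  intros s t. apply Rabs_le_between. assert (H1 := Hhalf s t). assert (H2 := Hhalf t s).
  rewrite (Rabs_minus_sym t s) in H2. lra.
Qed.

Lemma deriv_sign_right (f : R -> R) (p z l : R) :
  p < z -> is_derive f p l -> f p = 0 -> (forall x, p <= x <= z -> 0 <= f x) -> 0 <= l.
Proof.
  intros Hpz Hd E Hf. apply Rnot_lt_le. intros Hl.
  apply is_derive_Reals in Hd. destruct (Hd (- l) ltac:(lra)) as [d Hd'].
  assert (Hd0 := cond_pos d).
  set (y := Rmin (d / 2) (z - p)).
  assert (Hy : 0 < y) by (apply Rmin_pos; lra).
  assert (Hy1 : y <= d / 2) by apply Rmin_l. assert (Hy2 : y <= z - p) by apply Rmin_r.
  specialize (Hd' y ltac:(lra)). rewrite (Rabs_right y) in Hd' by lra.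
  specialize (Hd' ltac:(lra)). rewrite E, Rminus_0_r in Hd'. apply Rabs_def2 in Hd'.
  specialize (Hf (p + y) ltac:(lra)).
  assert (0 <= f (p + y) / y); [| lra].
  apply Rmult_le_pos; [exact Hf | left; apply Rinv_0_lt_compat, Hy].
Qed.

Lemma deriv_sign_left (f : R -> R) (p z l : R) :
  p < z -> is_derive f z l -> f z = 0 -> (forall x, p <= x <= z -> 0 <= f x) -> l <= 0.
Proof.
  intros Hpz Hd E Hf.
  assert (H : 0 <= - l); [| lra].
  apply (deriv_sign_right (fun x => f (- x)) (- z) (- p)).
  - lra.
  - replace (- l) with (scal (-1) l) by (unfold scal; simpl; unfold mult; simpl; ring).
    apply (is_derive_comp f (fun x => - x)); [rewrite Ropp_involutive; exact Hd |].
    auto_derive; [exact I | ring].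
  - rewrite Ropp_involutive. exact E.
  - intros x Hx. apply Hf. lra.
Qed.

(** Restricting an eigenfunction to one of its nodal intervals makes its sign constant. *)
Lemma nodal_interval (w : R -> R) (sig tau lam : R) :
  sig < tau -> is_eigenvalue w sig tau lam ->
  exists (F F1 : R -> R) (p z x1 : R),
    sig <= p /\ p < x1 < z /\ z <= tau /\ F p = 0 /\ F z = 0 /\
    (forall x, p <= x <= z -> 0 <= F x) /\ w x1 * F x1 <> 0 /\
    (forall x, p <= x <= z -> is_derive F x (F1 x) /\ is_derive F1 x (- (lam * w x * F x))).
Proof.
  intros Hst (phi & phi2 & (phi1 & HD1 & HD2) & Heq & Ep & Eq & xs & Hxs & Hne).
  assert (Hsgn : exists s, (s = 1 \/ s = -1) /\ 0 < s * phi xs).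
  { destruct (Rlt_le_dec 0 (phi xs)); [exists 1 | exists (-1)]; (split; [auto | lra]). }
  destruct Hsgn as [s [Hs Hpos]].
  set (F := fun x => s * tangent_extension sig tau phi phi1 x).
  set (F1 := fun x => s * tangent_extension sig tau phi1 phi2 x).
  assert (HF : forall x, sig <= x <= tau -> F x = s * phi x).
  { intros x Hx. unfold F. rewrite tangent_extension_id by exact Hx. reflexivity. }
  assert (HdF : forall x, sig <= x <= tau ->
     is_derive F x (F1 x) /\ is_derive F1 x (- (lam * w x * F x))).
  { intros x Hx. split.
    - unfold F1. rewrite tangent_extension_id by exact Hx.
      apply (is_derive_scal (tangent_extension sig tau phi phi1)).
      apply is_derive_tangent_extension; [exact Hst | exact Hx | apply HD1, Hx].
    - replace (- (lam * w x * F x)) with (s * phi2 x)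
        by (rewrite HF by exact Hx; specialize (Heq x Hx);
            replace (phi2 x) with (- (lam * w x * phi x)) by lra; ring).
      apply (is_derive_scal (tangent_extension sig tau phi1 phi2)).
      apply is_derive_tangent_extension; [exact Hst | exact Hx | apply HD2, Hx]. }
  (* [F] is extended by tangents, and continuity is wanted on the whole line for [first_zero] and
     [last_zero]; [G] is a globally continuous function that agrees with [F] on the interval. *)
  set (G := fun x => s * phi (clamp sig tau x)).
  assert (HG : forall x, continuity_pt G x).
  { intros x. unfold G. apply continuity_pt_scal.
    apply (continuity_clamp phi); [lra |].
    intros y Hy eps He. apply D_in_continuity with phi1; [apply HD1, Hy | exact He]. }
  assert (HGF : forall x, sig <= x <= tau -> G x = F x).
  { intros x Hx. unfold G. rewrite clamp_id, HF by exact Hx. reflexivity. }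
  unfold Icc in Hxs.
  assert (HFxs : 0 < F xs) by (rewrite HF by exact Hxs; exact Hpos).
  assert (HFs : F sig = 0) by (rewrite HF, Ep by lra; ring).
  assert (HFt : F tau = 0) by (rewrite HF, Eq by lra; ring).
  destruct (last_zero G sig xs) as [p [Hp [Gp Gp']]]; [lra | exact HG | rewrite HGF; lra | rewrite HGF; lra |].
  destruct (first_zero (fun x => - G x) xs tau) as [z [Hz [Gz Gz']]].
  { lra. } { intros x. apply continuity_pt_opp, HG. }
  { rewrite HGF; lra. } { rewrite HGF; lra. }
  rewrite HGF in Gp, Gz by lra.
  assert (Hpx : p <> xs) by (intros E; rewrite E in Gp; lra).
  assert (Hzx : z <> xs) by (intros E; rewrite E in Gz; lra).
  assert (HFn : forall x, p <= x <= z -> 0 <= F x).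
  { intros x Hx. rewrite <- HGF by lra. destruct (Rle_lt_dec x xs).
    - apply Gp'. lra.
    - specialize (Gz' x ltac:(lra)). simpl in Gz'. lra. }
  (* Otherwise [F''] would vanish on [[p, z]], so [F] would be affine there with zeros at both ends,
     against [0 < F xs]. *)
  assert (Hx1 : exists x1, p < x1 < z /\ w x1 * F x1 <> 0).
  { apply NNPP. intros Hn.
    assert (Hz0 : forall x, p <= x <= z -> w x * F x = 0).
    { intros x Hx. destruct (Req_dec x p) as [->|]; [rewrite Gp; ring |].
      destruct (Req_dec x z) as [->|]; [replace (F z) with 0 by lra; ring |].
      apply NNPP. intros Hw. apply Hn. exists x. split; [lra | exact Hw]. }
    assert (Hc : forall x y, p <= x -> x <= y -> y <= z -> F1 y = F1 x).
    { intros x y Hx Hxy Hy.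
      destruct (MVT_ex F1 (fun x => - (lam * w x * F x)) x y Hxy) as [t [Ht Et]].
      - intros t Ht. apply HdF. lra.
      - rewrite Rmult_assoc, (Hz0 t) in Et by lra. lra. }
    destruct (MVT_ex F F1 p xs) as [t1 [Ht1 Et1]]; [lra | intros; apply HdF; lra |].
    destruct (MVT_ex F F1 xs z) as [t2 [Ht2 Et2]]; [lra | intros; apply HdF; lra |].
    rewrite (Hc t1 t2) in Et2 by lra.
    assert (0 < F1 t1) by (apply Rmult_lt_reg_r with (xs - p); lra).
    assert (0 < F1 t1 * (z - xs)) by (apply Rmult_lt_0_compat; lra). lra. }
  destruct Hx1 as [x1 [Hx1 Hwx1]].
  exists F, F1, p, z, x1.
  split; [lra |]. split; [exact Hx1 |]. split; [lra |]. split; [exact Gp |].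
  split; [lra |]. split; [exact HFn |]. split; [exact Hwx1 |].
  intros x Hx. apply HdF. lra.
Qed.

(** By concavity [u] lies above the chords from its value at [xi] to the nonnegative endpoint
    values; the bound uses the worst position of [xi]. This converts one large value into large
    values on a fixed inner interval. *)
Lemma concave_lower (u v : R -> R) (sig tau xi x : R) :
  sig < tau -> (forall x, is_derive u x (v x)) ->
  (forall x y, sig <= x -> x <= y -> y <= tau -> v y <= v x) ->
  0 <= u sig -> 0 <= u tau -> 0 <= u xi -> sig <= xi <= tau -> sig <= x <= tau ->
  u xi * Rmin (x - sig) (tau - x) <= u x * (tau - sig).
Proof.
  intros Hst Hd Hv Us Ut Uxi Hxi Hx.
  assert (Hm1 := Rmin_l (x - sig) (tau - x)). assert (Hm2 := Rmin_r (x - sig) (tau - x)).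
  assert (Hm0 : 0 <= Rmin (x - sig) (tau - x)) by (apply Rmin_glb; lra).
  set (m := Rmin (x - sig) (tau - x)) in *.
  destruct (Rle_lt_dec (u xi) (u x)) as [Hle|Hlt].
  { apply Rmult_le_compat; lra. }
  destruct (Rle_lt_dec x xi) as [Hxx|Hxx].
  - destruct (MVT_ex u v sig x) as [t1 [Ht1 E1]]; [lra | intros; apply Hd |].
    destruct (MVT_ex u v x xi) as [t2 [Ht2 E2]]; [lra | intros; apply Hd |].
    assert (Hvv := Hv t1 t2 ltac:(lra) ltac:(lra) ltac:(lra)).
    assert (Hxxi : x < xi) by (destruct (Req_dec x xi) as [E|]; [rewrite E in Hlt; lra | lra]).
    assert (G1 : v t2 * (x - sig) <= u x).
    { assert (v t2 * (x - sig) <= v t1 * (x - sig)) by (apply Rmult_le_compat_r; lra). lra. }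
    assert (G2 : (u xi - u x) * (x - sig) <= u x * (xi - x)).
    { rewrite E2. replace (v t2 * (xi - x) * (x - sig)) with (v t2 * (x - sig) * (xi - x)) by ring.
      apply Rmult_le_compat_r; lra. }
    assert (Hux : 0 <= u x).
    { apply Rmult_le_reg_r with (xi - sig); [lra |].
      assert (0 <= u xi * (x - sig)) by (apply Rmult_le_pos; lra). lra. }
    apply Rle_trans with (u xi * (x - sig)); [apply Rmult_le_compat_l; lra |].
    apply Rle_trans with (u x * (xi - sig)); [lra | apply Rmult_le_compat_l; lra].
  - destruct (MVT_ex u v x tau) as [t1 [Ht1 E1]]; [lra | intros; apply Hd |].
    destruct (MVT_ex u v xi x) as [t2 [Ht2 E2]]; [lra | intros; apply Hd |].
    assert (Hvv := Hv t2 t1 ltac:(lra) ltac:(lra) ltac:(lra)).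
    assert (G1 : - v t2 * (tau - x) <= u x).
    { assert (v t1 * (tau - x) <= v t2 * (tau - x)) by (apply Rmult_le_compat_r; lra). lra. }
    assert (G2 : (u xi - u x) * (tau - x) <= u x * (x - xi)).
    { replace ((u xi - u x) * (tau - x)) with (- v t2 * (tau - x) * (x - xi))
        by (replace (u xi - u x) with (- (u x - u xi)) by ring; rewrite E2; ring).
      apply Rmult_le_compat_r; lra. }
    assert (Hux : 0 <= u x).
    { apply Rmult_le_reg_r with (tau - xi); [lra |].
      assert (0 <= u xi * (tau - x)) by (apply Rmult_le_pos; lra). lra. }
    apply Rle_trans with (u xi * (tau - x)); [apply Rmult_le_compat_l; lra |].
    apply Rle_trans with (u x * (tau - xi)); [lra | apply Rmult_le_compat_l; lra].
Qed.

Lemma wronskian_derive (u v F F1 : R -> R) (x du dF : R) :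
  is_derive u x (v x) -> is_derive v x du -> is_derive F x (F1 x) -> is_derive F1 x dF ->
  is_derive (fun x => v x * F x - u x * F1 x) x (du * F x - u x * dF).
Proof.
  intros H1 H2 H3 H4. auto_derive.
  - repeat split; eexists; eassumption.
  - rewrite (Derive_at u x _ H1), (Derive_at v x _ H2), (Derive_at F x _ H3),
      (Derive_at F1 x _ H4). ring.
Qed.

Lemma positive_near (f : R -> R) (a b x : R) :
  continuity_pt f x -> 0 < f x -> a < x < b ->
  exists y1 y2, a < y1 /\ y1 < y2 /\ y2 < b /\ forall y, y1 <= y <= y2 -> f x / 2 <= f y.
Proof.
  intros Hc Hf Hx. destruct (continuity_pt_eps_inv f x (f x / 2) Hc ltac:(lra)) as [d [Hd Hy]].
  set (e := Rmin (d / 2) (Rmin ((x - a) / 2) ((b - x) / 2))).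
  assert (He : 0 < e) by (repeat apply Rmin_pos; lra).
  assert (He1 : e <= d / 2) by apply Rmin_l.
  assert (He2 : e <= (x - a) / 2) by (apply Rle_trans with (1 := Rmin_r _ _), Rmin_l).
  assert (He3 : e <= (b - x) / 2) by (apply Rle_trans with (1 := Rmin_r _ _), Rmin_r).
  exists (x - e), (x + e). repeat split; try lra.
  intros y Hye. specialize (Hy y ltac:(apply Rabs_def1; lra)). apply Rabs_def2 in Hy. lra.
Qed.

(** On a nodal interval of the eigenfunction [F], the Wronskian [W = v F - u F1] has derivative
    [w F (lam u - h u)], and [W p <= 0 <= W z] because [F] vanishes at both ends with known signs of
    [F1]. If [u] is huge somewhere, concavity makes it huge on [[y1, y2]], where [w F] is bounded
    below; [W] then drops there by more than it can rise elsewhere. *)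
Lemma hump_bound (w : R -> R) (sig tau lam q S : R) :
  sig < tau -> (forall x, continuity_pt w x) -> (forall x, sig <= x <= tau -> 0 <= w x) ->
  is_eigenvalue w sig tau lam -> 0 <= lam < q -> 0 <= S ->
  exists M, forall c h u v K,
    sublinear K h -> (forall s, S <= s -> q * s <= h s) -> ode c h u v ->
    (forall x, sig <= x <= tau -> c x = w x) ->
    (forall x, sig <= x <= tau -> 0 <= u x) ->
    forall x, sig <= x <= tau -> u x < M.
Proof.
  intros Hst Hwc Hw Hev Hlq HS.
  destruct (nodal_interval w sig tau lam Hst Hev)
    as (F & F1 & p & z & x1 & Hp & Hx1 & Hz & Fp & Fz & Fpos & Hne & HdF).
  assert (HwF : 0 < w x1 * F x1).
  { assert (0 <= w x1 * F x1); [| lra].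
    apply Rmult_le_pos; [apply Hw; lra | apply Fpos; lra]. }
  assert (HFc : forall x, p <= x <= z -> continuity_pt (fun x => w x * F x) x).
  { intros x Hx. apply continuity_pt_mult; [apply Hwc |].
    apply is_derive_continuity_pt with (F1 x). apply HdF, Hx. }
  destruct (positive_near (fun x => w x * F x) p z x1 (HFc x1 ltac:(lra)) HwF Hx1)
    as (y1 & y2 & Hy1 & Hy12 & Hy2 & Hb). cbv beta in Hb.
  set (b := w x1 * F x1 / 2) in *. assert (Hb0 : 0 < b) by (unfold b; lra).
  destruct (continuity_ab_maj (fun x => w x * F x) p z ltac:(lra) HFc) as [xm [Hxm Hxm']].
  set (B := w xm * F xm) in *.
  assert (HB : b <= B) by (apply Rle_trans with (1 := Hb y1 ltac:(lra)); apply Hxm; lra).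
  assert (HqS : 0 <= q * S) by (apply Rmult_le_pos; lra).
  set (A1 := B * (q * S)).
  assert (HA1 : 0 <= A1) by (apply Rmult_le_pos; lra).
  set (d0 := Rmin (y1 - sig) (tau - y2)).
  assert (Hd0 : 0 < d0) by (apply Rmin_pos; lra).
  set (d1 := d0 / (tau - sig)).
  assert (Hd1 : 0 < d1) by (apply Rdiv_lt_0_compat; lra).
  (* Chosen so that the drop [b * (y2 - y1) * N] of [W] on [[y1, y2]] exceeds by [1] the largest
     possible rise [A1 * (z - p)]. *)
  set (N := (A1 * (z - p) + 1) / (b * (y2 - y1))).
  assert (Hby : 0 < b * (y2 - y1)) by (apply Rmult_lt_0_compat; lra).
  assert (HN : b * (y2 - y1) * N = A1 * (z - p) + 1) by (unfold N; field; lra).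
  assert (HA1z : 0 <= A1 * (z - p)) by (apply Rmult_le_pos; lra).
  assert (HN0 : 0 <= N) by (left; apply Rdiv_lt_0_compat; lra).
  assert (Hqd : 0 < (q - lam) * d1) by (apply Rmult_lt_0_compat; lra).
  exists ((N + q * S) / ((q - lam) * d1)).
  intros c h u v K Hh Hq Ho Hcw Hu xi Hxi. apply Rnot_le_lt. intros Hbig.
  assert (HM : N + q * S <= (q - lam) * (d1 * u xi)).
  { apply Rmult_le_compat_l with (r := (q - lam) * d1) in Hbig; [| lra].
    replace ((q - lam) * d1 * ((N + q * S) / ((q - lam) * d1))) with (N + q * S) in Hbig
      by (field; lra). lra. }
  assert (Hvm : forall x y, sig <= x -> x <= y -> y <= tau -> v y <= v x).
  { intros x y Hx Hxy Hy. apply (v_decreasing c h u v K sig tau Hh Ho); try assumption.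
    intros t Ht. rewrite Hcw by exact Ht. apply Hw, Ht. }
  assert (Hux : forall x, y1 <= x <= y2 -> d1 * u xi <= u x).
  { intros x Hx.
    assert (Hcl := concave_lower u v sig tau xi x Hst (fun t => proj1 (Ho t)) Hvm
      (Hu sig ltac:(lra)) (Hu tau ltac:(lra)) (Hu xi Hxi) Hxi ltac:(lra)).
    assert (Hd : d0 <= Rmin (x - sig) (tau - x)).
    { apply Rmin_glb; [apply Rle_trans with (1 := Rmin_l _ _) | apply Rle_trans with (1 := Rmin_r _ _)]; lra. }
    apply Rmult_le_reg_r with (tau - sig); [lra |].
    apply Rle_trans with (2 := Hcl). unfold d1.
    replace (d0 / (tau - sig) * u xi * (tau - sig)) with (u xi * d0) by (field; lra).
    apply Rmult_le_compat_l; [apply Hu, Hxi | exact Hd]. }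
  set (W := fun x => v x * F x - u x * F1 x).
  set (dW := fun x => w x * F x * (lam * u x - h (u x))).
  assert (HdW : forall x, p <= x <= z -> is_derive W x (dW x)).
  { intros x Hx. destruct (HdF x Hx) as [HF1 HF2]. destruct (Ho x) as [Hu1 Hu2].
    replace (dW x) with (- (c x * h (u x)) * F x - u x * - (lam * w x * F x))
      by (unfold dW; rewrite Hcw by lra; ring).
    apply wronskian_derive; assumption. }
  (* One inequality for both ranges: it follows from [q u <= h u] when [u >= S], and from [0 <= h u]
     and [q u <= q S] when [u < S]. *)
  assert (Hpt : forall x, p <= x <= z -> lam * u x - h (u x) <= q * S - (q - lam) * u x).
  { intros x Hx. destruct (Rle_lt_dec S (u x)) as [Hs|Hs].
    - specialize (Hq (u x) Hs). lra.
    - assert (Hh0 := proj1 (Hh (u x))).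
      assert (q * u x <= q * S) by (apply Rmult_le_compat_l; lra). lra. }
  assert (HwFx : forall x, p <= x <= z -> 0 <= w x * F x <= B).
  { intros x Hx. split; [apply Rmult_le_pos; [apply Hw; lra | apply Fpos, Hx] | apply Hxm, Hx]. }
  assert (HdW1 : forall x, p <= x <= z -> dW x <= A1).
  { intros x Hx. destruct (HwFx x Hx) as [Ha1 Ha2]. unfold dW, A1.
    apply Rle_trans with (w x * F x * (q * S)).
    - apply Rmult_le_compat_l; [exact Ha1 |]. specialize (Hpt x Hx).
      assert (0 <= (q - lam) * u x) by (apply Rmult_le_pos; [lra | apply Hu; lra]). lra.
    - apply Rmult_le_compat_r; assumption. }
  assert (HdW2 : forall x, y1 <= x <= y2 -> dW x <= - (b * N)).
  { intros x Hx. unfold dW. specialize (Hb x Hx). specialize (Hpt x ltac:(lra)).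
    assert (Hn : lam * u x - h (u x) <= - N).
    { assert ((q - lam) * (d1 * u xi) <= (q - lam) * u x)
        by (apply Rmult_le_compat_l; [lra | apply Hux, Hx]). lra. }
    apply Rle_trans with (w x * F x * - N).
    - apply Rmult_le_compat_l; lra.
    - assert (b * N <= w x * F x * N) by (apply Rmult_le_compat_r; lra). lra. }
  assert (M1 := MVT_upper W dW p y1 A1 ltac:(lra) (fun x Hx => HdW x ltac:(lra)) (fun x Hx => HdW1 x ltac:(lra))).
  assert (M2 := MVT_upper W dW y1 y2 _ ltac:(lra) (fun x Hx => HdW x ltac:(lra)) HdW2).
  assert (M3 := MVT_upper W dW y2 z A1 ltac:(lra) (fun x Hx => HdW x ltac:(lra)) (fun x Hx => HdW1 x ltac:(lra))).
  assert (HWp : W p <= 0).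
  { unfold W. rewrite Fp.
    assert (0 <= F1 p) by (apply (deriv_sign_right F p z); [lra | apply HdF; lra | exact Fp | exact Fpos]).
    assert (0 <= u p * F1 p) by (apply Rmult_le_pos; [apply Hu; lra | assumption]). lra. }
  assert (HWz : 0 <= W z).
  { unfold W. rewrite Fz.
    assert (F1 z <= 0) by (apply (deriv_sign_left F p z); [lra | apply HdF; lra | exact Fz | exact Fpos]).
    assert (0 <= u z * - F1 z) by (apply Rmult_le_pos; [apply Hu; lra | lra]). lra. }
  assert (A1 * (y2 - y1) >= 0) by (apply Rle_ge, Rmult_le_pos; lra).
  lra.
Qed.

(** * Small humps *)

(** Since [exp Y >= 1], it is at most its own square; this avoids a square root at the price of a
    worse constant. *)
Lemma Rabs_le_of_pow2_exp (a b Y : R) :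
  0 <= b -> 0 <= Y -> a^2 <= b^2 * exp Y -> Rabs a <= b * exp Y.
Proof.
  intros Hb HY H. assert (HeY : 1 <= exp Y) by (assert (H1 := exp_ineq1_le Y); lra).
  apply Rsqr_incr_0_var; [| apply Rmult_le_pos; lra].
  rewrite <- Rsqr_abs. rewrite !Rsqr_pow2.
  apply Rle_trans with (1 := H). rewrite Rpow_mult_distr.
  apply Rmult_le_compat_l; [apply pow2_ge_0 |].
  replace (exp Y ^ 2) with (exp Y * exp Y) by ring.
  rewrite <- (Rmult_1_r (exp Y)) at 1. apply Rmult_le_compat_l; lra.
Qed.

Lemma sublinear_positive_part : sublinear 1 (fun s => Rmax s 0).
Proof. intros s. assert (H := Rmax_r s 0). lra. Qed.

Lemma positive_part_lipschitz (s t : R) : Rabs (Rmax s 0 - Rmax t 0) <= 1 * Rabs (s - t).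
Proof.
  unfold Rmax, Rabs. destruct (Rle_dec s 0), (Rle_dec t 0);
    repeat match goal with |- context [Rcase_abs ?a] => destruct (Rcase_abs a) end; lra.
Qed.

(** To keep control of the sign while the eigenvalue parameter moves, the nonlinearity
    [s -> max s 0] replaces [s -> s]. *)
Lemma positive_linear_solution (w : R -> R) (L q0 lam0 C : R) :
  0 < L -> (forall x, continuity_pt w x) -> (forall x, 0 <= w x <= C) ->
  is_first_eigenvalue w 0 L lam0 -> 0 <= q0 < lam0 ->
  exists psi psi1 : R -> R,
    forall x, 0 <= x <= L -> 0 < psi x /\ is_derive psi x (psi1 x) /\
                is_derive psi1 x (- (q0 * w x * psi x)).
Proof.
  intros HL Hwc Hw [Hlam0 [_ Hmin]] Hq0.
  set (h := fun s => Rmax s 0).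
  assert (Hh : sublinear 1 h) by exact sublinear_positive_part.
  assert (Hlip : forall s t, Rabs (h s - h t) <= 1 * Rabs (s - t))
    by exact positive_part_lipschitz.
  assert (HC0 : 0 <= C) by (specialize (Hw 0); lra).
  assert (Hcont : forall q x, continuity_pt (fun x => q * w x) x).
  { intros q x. apply continuity_pt_mult; [| apply Hwc].
    apply continuity_pt_const. intros ? ?. reflexivity. }
  assert (Habs : forall q x, Rabs (q * w x) <= Rabs q * C).
  { intros q x. rewrite Rabs_mult. apply Rmult_le_compat_l; [apply Rabs_pos |].
    rewrite Rabs_right; specialize (Hw x); lra. }
  destruct (functional_choice (fun q (y : (R -> R) * (R -> R)) =>
     ode (fun x => q * w x) h (fst y) (snd y) /\ fst y 0 = 0 /\ snd y 0 = 1)) as [Y HY].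
  { intros q. destruct (ivp_exists (fun x => q * w x) h (Rabs q * C) 1 (Hcont q) (Habs q) Hlip 0 1)
      as (u & v & H). exists (u, v). exact H. }
  (* The value at [L] of the solution with initial value [0] and slope [1]. It equals [L] at [q = 0]
     and is continuous in [q], and a zero in [(0, q0]] would be an eigenvalue smaller than [lam0];
     hence [E q0 > 0]. *)
  set (E := fun q => fst (Y q) L).
  set (C' := q0 * C + 1).
  assert (Hq0C : 0 <= q0 * C) by (apply Rmult_le_pos; lra).
  assert (HC' : forall q x, 0 <= q <= q0 -> Rabs (q * w x) <= C').
  { intros q x Hq. apply Rle_trans with (1 := Habs q x). rewrite Rabs_right by lra.
    assert (q * C <= q0 * C) by (apply Rmult_le_compat_r; lra). unfold C'. lra. }
  set (eY := exp ((1 + 2 * (C' * 1)) * L)).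
  assert (HYpos : 0 <= (1 + 2 * (C' * 1)) * L) by (unfold C'; apply Rmult_le_pos; lra).
  assert (HeY : 0 < eY) by apply exp_pos.
  assert (HE0 : E 0 = L).
  { unfold E. destruct (HY 0) as [Ho [E0 E1]].
    destruct (MVT_ex (fst (Y 0)) (snd (Y 0)) 0 L) as [t [Ht Et]]; [lra | intros; apply Ho |].
    destruct (MVT_ex (snd (Y 0)) (fun x => - (0 * w x * h (fst (Y 0) x))) 0 t) as [t' [Ht' Et']];
      [lra | intros; apply Ho |].
    rewrite E0 in Et. rewrite E1 in Et'.
    replace (snd (Y 0) t) with 1 in Et by lra. lra. }
  assert (HEc : forall q, continuity_pt (fun q => - E (clamp 0 q0 q)) q).
  { apply (continuity_clamp (fun q => - E q)); [lra |]. intros q Hq eps He.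
    destruct (HY q) as [Ho [E0 E1]].
    destruct (continuity_ab_maj (fst (Y q)) 0 L) as [xm [Hxm _]];
      [lra | intros; apply (ode_continuity _ _ _ _ _ Ho) |].
    set (B := h (fst (Y q) xm)).
    assert (HB0 : 0 <= B) by apply Rmax_r.
    assert (HB : forall x, 0 <= x <= L -> Rabs (h (fst (Y q) x)) <= B).
    { intros x Hx. unfold h at 1. rewrite Rabs_right by apply Rle_ge, Rmax_r.
      unfold B, h. apply Rmax_lub; [| apply Rmax_r].
      apply Rle_trans with (1 := Hxm x Hx), Rmax_l. }
    set (D := C * B / C' * eY).
    assert (HD : 0 <= D).
    { apply Rmult_le_pos; [| lra]. apply Rmult_le_pos; [apply Rmult_le_pos; lra |].
      left. apply Rinv_0_lt_compat. unfold C'. lra. }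
    exists (eps / (D + 1)). split; [apply Rdiv_lt_0_compat; lra |].
    intros q' Hq' Hqq'. destruct (HY q') as [Ho' [E0' E1']].
    assert (HCp : 0 < C') by (unfold C'; lra).
    (* The division by [C'] matches the form [C * K * eta] of the defect in [ode_dependence], here
       with constants [C'] and [1]; the summand [1] in [C'] keeps it positive. *)
    assert (Heta : 0 <= Rabs (q' - q) * (C * B / C')).
    { apply Rmult_le_pos; [apply Rabs_pos |]. apply Rmult_le_pos; [apply Rmult_le_pos; lra |].
      left. apply Rinv_0_lt_compat, HCp. }
    assert (Hdep := ode_dependence (fun x => q' * w x) (fun x => q * w x) h
      (fst (Y q')) (snd (Y q')) (fst (Y q)) (snd (Y q)) C' 1
      (Rabs (q' - q) * (C * B / C')) L ltac:(lra) Heta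
      (fun x => HC' q' x Hq') Hlip Ho' Ho).
    rewrite E0, E0', E1, E1', !Rminus_diag in Hdep.
    assert (Hd : Rabs (fst (Y q') L - fst (Y q) L) <= Rabs (q' - q) * (C * B / C') * eY).
    { apply Rabs_le_of_pow2_exp; [exact Heta | exact HYpos |].
      replace (0 ^ 2 + 0 ^ 2 + (Rabs (q' - q) * (C * B / C')) ^ 2)
        with ((Rabs (q' - q) * (C * B / C')) ^ 2) in Hdep by ring.
      apply Hdep. intros x Hx.
      replace ((q' * w x - q * w x) * h (fst (Y q) x))
        with ((q' - q) * (w x * h (fst (Y q) x))) by ring.
      replace (C' * 1 * (Rabs (q' - q) * (C * B / C'))) with (Rabs (q' - q) * (C * B))
        by (field; lra).
      rewrite !Rabs_mult. apply Rmult_le_compat_l; [apply Rabs_pos |].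
      apply Rmult_le_compat; try apply Rabs_pos; [| apply HB, Hx].
      rewrite Rabs_right; specialize (Hw x); lra. }
    replace (- E q' - - E q) with (- (fst (Y q') L - fst (Y q) L)) by (unfold E; ring).
    rewrite Rabs_Ropp. apply Rle_lt_trans with (1 := Hd).
    apply Rle_lt_trans with ((D + 1) * Rabs (q' - q)).
    - unfold D. assert (H := Rabs_pos (q' - q)). lra.
    - apply Rmult_lt_reg_r with (/ (D + 1)); [apply Rinv_0_lt_compat; lra |].
      replace ((D + 1) * Rabs (q' - q) * / (D + 1)) with (Rabs (q' - q)) by (field; lra).
      exact Hqq'. }
  assert (HEq0 : 0 < E q0).
  { apply Rnot_le_lt. intros Hle.
    destruct (first_zero (fun q => - E (clamp 0 q0 q)) 0 q0) as [z [Hz [Ez _]]].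
    - lra.
    - exact HEc.
    - rewrite clamp_id by lra. lra.
    - rewrite clamp_id by lra. lra.
    - rewrite clamp_id in Ez by lra.
      assert (Hz0 : z <> 0) by (intros ->; lra).
      destruct (HY z) as [Ho [E0 E1]].
      set (u := fst (Y z)) in *. set (v := snd (Y z)) in *.
      assert (HuL : u L = 0) by (unfold E in Ez; fold u in Ez; lra).
      (* As [u] vanishes at both ends it is nonnegative between them, so its positive part is [u]
         itself and [u] is a true eigenfunction. *)
      assert (Hu : forall x, 0 <= x <= L -> 0 <= u x).
      { intros x Hx. apply (nonneg_between _ h u v 1 (Rabs z * C) 0 L x Hh (Habs z) Ho); lra. }
      assert (Hev : is_eigenvalue w 0 L z).
      { exists u, (fun x => - (z * w x * h (u x))).
        split; [exists v; split; intros x Hx; apply is_derive_D_in, Ho |].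
        split; [| split; [exact E0 | split; [exact HuL |]]].
        - intros x Hx. unfold h. rewrite Rmax_left by (apply Hu, Hx). ring.
        - apply NNPP. intros Hn.
          assert (Hzero : forall x, 0 <= x <= L -> u x = 0).
          { intros x Hx. apply NNPP. intros Hne. apply Hn. exists x. split; [exact Hx | exact Hne]. }
          assert (H' := deriv_sign_right (fun x => - u x) 0 L (opp (v 0)) HL
            (is_derive_opp u 0 (v 0) (proj1 (Ho 0)))).
          assert (0 <= opp (v 0)).
          { apply H'; [lra |]. intros x Hx. rewrite Hzero by exact Hx. lra. }
          unfold opp in *; simpl in *. lra. }
      specialize (Hmin z ltac:(lra) Hev). lra. }
  (* A positive initial value makes the solution positive also at [0]; it is so small that the value
     at [L] moves by at most half of [E q0]. *)
  set (al := Rmin 1 (E q0 / 2 / eY)).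
  assert (Hal : 0 < al) by (apply Rmin_pos; [lra | apply Rdiv_lt_0_compat; lra]).
  destruct (ivp_exists (fun x => q0 * w x) h (Rabs q0 * C) 1 (Hcont q0) (Habs q0) Hlip al 1)
    as (u & v & Ho & E0 & E1).
  destruct (HY q0) as [Ho' [E0' E1']].
  assert (HuL : 0 < u L).
  { assert (Hdep := ode_dependence (fun x => q0 * w x) (fun x => q0 * w x) h
      u v (fst (Y q0)) (snd (Y q0)) C' 1 0 L ltac:(lra) ltac:(lra)
      (fun x => HC' q0 x ltac:(lra)) Hlip Ho Ho').
    rewrite E0, E0', E1, E1', Rminus_diag, Rminus_0_r in Hdep.
    assert (Hd : Rabs (u L - fst (Y q0) L) <= al * eY).
    { apply Rabs_le_of_pow2_exp; [lra | exact HYpos |].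
      replace (al ^ 2 + 0 ^ 2 + 0 ^ 2) with (al ^ 2) in Hdep by ring.
      apply Hdep. intros x Hx. rewrite Rminus_diag, Rmult_0_l, Rabs_R0. lra. }
    assert (al * eY <= E q0 / 2).
    { apply Rle_trans with (E q0 / 2 / eY * eY);
        [apply Rmult_le_compat_r; [lra | apply Rmin_r] | right; field; lra]. }
    apply Rabs_le_between in Hd. fold (E q0) in Hd. lra. }
  assert (Hu : forall x, 0 <= x <= L -> 0 < u x).
  { intros x Hx.
    assert (Hnn : forall x, 0 <= x <= L -> 0 <= u x).
    { intros t Ht. apply (nonneg_between _ h u v 1 (Rabs q0 * C) 0 L t Hh (Habs q0) Ho); lra. }
    destruct (Hnn x Hx) as [|Hz]; [assumption | exfalso].
    assert (x <> 0) by (intros ->; lra). assert (x <> L) by (intros ->; lra).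
    assert (Hall := interior_zero_trivial _ h u v 1 (Rabs q0 * C) 0 L x Hh (Habs q0) Ho Hnn
      ltac:(lra) (eq_sym Hz) L). lra. }
  exists u, v. intros x Hx. split; [apply Hu, Hx |]. split; [apply Ho |].
  replace (u x) with (h (u x)) at 1.
  - apply Ho.
  - unfold h. apply Rmax_left. left. apply Hu, Hx.
Qed.

Lemma is_derive_quotient_wronskian (u v F F1 : R -> R) (x : R) :
  F x <> 0 -> is_derive u x (v x) -> is_derive F x (F1 x) ->
  is_derive (fun x => u x / F x) x ((v x * F x - u x * F1 x) / (F x)^2).
Proof.
  intros HF H1 H2. auto_derive.
  - split; [eexists; exact H1 |]. split; [eexists; exact H2 | split; [exact HF | exact I]].
  - rewrite (Derive_at u x _ H1), (Derive_at F x _ H2). field. exact HF.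
Qed.

(** Sturm comparison with a positive solution of the linear equation of slope [q0]. *)
Lemma small_hump (w : R -> R) (L q0 lam0 C r : R) :
  0 < L -> (forall x, continuity_pt w x) -> (forall x, 0 <= w x <= C) ->
  is_first_eigenvalue w 0 L lam0 -> 0 <= q0 < lam0 -> 0 < r ->
  exists eps kap, 0 < eps /\ 0 < kap /\
    forall sig tau c h u v K Cc xi,
      0 <= sig -> sig < tau -> tau <= L ->
      sublinear K h -> (forall x, Rabs (c x) <= Cc) -> ode c h u v ->
      (forall s, 0 <= s <= r -> h s <= q0 * s) ->
      (forall x, sig <= x <= tau -> c x = w x) ->
      (forall x, sig <= x <= tau -> u x <= r) ->
      sig <= xi <= tau -> u xi = r -> 0 <= u sig <= eps ->
      kap <= u tau.
Proof.
  intros HL Hwc Hw Hlam Hq0 Hr.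
  destruct (positive_linear_solution w L q0 lam0 C HL Hwc Hw Hlam Hq0) as (F & F1 & HF).
  assert (HFc : forall x, 0 <= x <= L -> continuity_pt F x).
  { intros x Hx. apply is_derive_continuity_pt with (F1 x), HF, Hx. }
  assert (HF1c : forall x, 0 <= x <= L -> continuity_pt F1 x).
  { intros x Hx. eapply is_derive_continuity_pt, HF, Hx. }
  destruct (continuity_ab_min F 0 L ltac:(lra) HFc) as [x1 [Hx1 Hx1']].
  destruct (continuity_ab_maj F 0 L ltac:(lra) HFc) as [x2 [Hx2 Hx2']].
  destruct (continuity_ab_maj F1 0 L ltac:(lra) HF1c) as [x3 [Hx3 Hx3']].
  set (m := F x1) in *. set (B := F x2) in *.
  assert (Hm : 0 < m) by apply HF, Hx1'. assert (HB : 0 < B) by apply HF, Hx2'.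
  set (D := Rmax (F1 x3) 0).
  assert (HD : 0 <= D) by apply Rmax_r.
  assert (HDx : forall x, 0 <= x <= L -> F1 x <= D).
  { intros x Hx. apply Rle_trans with (1 := Hx3 x Hx), Rmax_l. }
  (* A lower bound for [v sig * F sig]: the slope is at least [r / (2 * L)] and [F] is at least
     [m]. *)
  set (e1 := r * m / (2 * L)).
  assert (He1 : 0 < e1) by (apply Rdiv_lt_0_compat; [apply Rmult_lt_0_compat |]; lra).
  (* The first bound on [u sig] forces a rise of at least [r / 2] up to [xi]; the second keeps
     [u sig * F1 sig] below [e1], so that the Wronskian starts nonnegative. *)
  exists (Rmin (r / 2) (e1 / (D + 1))), (r * m / B).
  split; [apply Rmin_pos; [lra | apply Rdiv_lt_0_compat; lra] |].
  split; [apply Rdiv_lt_0_compat; [apply Rmult_lt_0_compat |]; lra |].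
  intros sig tau c h u v K Cc xi Hsig Hst Htau Hh HCc Ho Hq Hcw Hur Hxi Exi Husig.
  assert (Hs1 : u sig <= r / 2) by (apply Rle_trans with (1 := proj2 Husig), Rmin_l).
  assert (Hs2 : u sig <= e1 / (D + 1)) by (apply Rle_trans with (1 := proj2 Husig), Rmin_r).
  assert (Hxis : sig < xi).
  { destruct (Req_dec sig xi) as [E|]; [rewrite E in Hs1; lra | lra]. }
  (* The mean slope from [sig] to [xi] is at least [r / (2 * L)], and concavity puts the initial
     slope above it. *)
  assert (Hvs : r / (2 * L) <= v sig).
  { destruct (MVT_ex u v sig xi) as [t [Ht Et]]; [lra | intros; apply Ho |].
    assert (Hv : v t <= v sig).
    { apply (v_decreasing c h u v K sig tau Hh Ho); try lra.
      intros x Hx. rewrite Hcw by exact Hx. apply Hw. }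
    assert (H1 : r / 2 <= v sig * (xi - sig)).
    { apply Rle_trans with (v t * (xi - sig)); [lra | apply Rmult_le_compat_r; lra]. }
    assert (Hv0 : 0 < v sig) by (apply Rmult_lt_reg_r with (xi - sig); lra).
    apply Rmult_le_reg_r with L; [exact HL |].
    replace (r / (2 * L) * L) with (r / 2) by (field; lra).
    apply Rle_trans with (1 := H1). apply Rmult_le_compat_l; lra. }
  set (W := fun x => v x * F x - u x * F1 x).
  assert (HW0 : 0 <= W sig).
  { unfold W.
    assert (G1 : e1 <= v sig * F sig).
    { unfold e1. replace (r * m / (2 * L)) with (r / (2 * L) * m) by (field; lra).
      apply Rmult_le_compat; [left; apply Rdiv_lt_0_compat; lra | lra | exact Hvs | apply Hx1; lra]. }
    assert (G2 : u sig * F1 sig <= e1).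
    { apply Rle_trans with (e1 / (D + 1) * (D + 1)); [| right; field; lra].
      apply Rle_trans with (u sig * D).
      - apply Rmult_le_compat_l; [lra | apply HDx; lra].
      - apply Rmult_le_compat; lra. }
    lra. }
  (* As long as [0 <= u <= r], the derivative [w F (q0 u - h u)] of [W] is nonnegative, so [W >= 0]
     and the quotient [u / F] is nondecreasing. *)
  assert (Hmain : forall y, xi <= y <= tau -> 0 <= u y -> r / F xi <= u y / F y).
  { intros y Hy Huy.
    assert (Hnn : forall x, sig <= x <= y -> 0 <= u x).
    { intros x Hx. apply (nonneg_between c h u v K Cc sig y x Hh HCc Ho); lra. }
    assert (HWx : forall x, sig <= x <= y -> 0 <= W x).
    { intros x Hx.
      assert (H := MVT_lower W (fun t => - (c t * h (u t)) * F t - u t * - (q0 * w t * F t)) sig x 0).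
      assert (H' : 0 * (x - sig) <= W x - W sig); [| lra]. apply H; [lra | |].
      - intros t Ht. apply wronskian_derive; try apply Ho; apply HF; lra.
      - intros t Ht. rewrite Hcw by lra.
        replace (- (w t * h (u t)) * F t - u t * - (q0 * w t * F t))
          with (w t * F t * (q0 * u t - h (u t))) by ring.
        apply Rmult_le_pos; [apply Rmult_le_pos; [apply Hw | left; apply HF; lra] |].
        assert (h (u t) <= q0 * u t); [| lra].
        apply Hq. split; [apply Hnn; lra | apply Hur; lra]. }
    assert (H := MVT_lower (fun x => u x / F x) (fun x => W x / (F x)^2) xi y 0).
    assert (H' : 0 * (y - xi) <= u y / F y - u xi / F xi).
    { apply H; [lra | |].
      - intros t Ht. apply is_derive_quotient_wronskian; [| apply Ho | apply HF; lra].
        assert (0 < F t) by (apply HF; lra). lra.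
      - intros t Ht. apply Rmult_le_pos; [apply HWx; lra |].
        left. apply Rinv_0_lt_compat, pow_lt, HF. lra. }
    rewrite Exi in H'. lra. }
  assert (HFxi : 0 < F xi) by (apply HF; lra).
  assert (Hrx : 0 < r / F xi) by (apply Rdiv_lt_0_compat; lra).
  destruct (Rle_lt_dec 0 (u tau)) as [Hut|Hut].
  - specialize (Hmain tau ltac:(lra) Hut).
    assert (HFt : 0 < F tau) by (apply HF; lra).
    apply Rle_trans with (r / F xi * F tau).
    + replace (r * m / B) with (r / B * m) by (field; lra).
      apply Rmult_le_compat; [left; apply Rdiv_lt_0_compat; lra | lra | | apply Hx1; lra].
      apply Rmult_le_compat_l; [lra |]. apply Rinv_le_contravar; [exact HFxi | apply Hx2; lra].
    + replace (u tau) with (u tau / F tau * F tau) by (field; lra).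
      apply Rmult_le_compat_r; lra.
  (* A negative value at [tau] would produce a zero of [u] after [xi], where the quotient [u / F] is
     still at least [r / F xi > 0]. *)
  - exfalso. destruct (first_zero (fun x => - u x) xi tau) as [z [Hz [Ez _]]].
    + lra.
    + intros x. apply continuity_pt_opp, (ode_continuity c h u v x Ho).
    + lra.
    + lra.
    + specialize (Hmain z ltac:(lra) ltac:(lra)).
      replace (u z) with 0 in Hmain by lra. unfold Rdiv in Hmain.
      rewrite Rmult_0_l in Hmain. unfold Rdiv in Hrx. lra.
Qed.

(** * Effect of a strongly negative weight beside a hump *)

(** Some slope inside the hump is at most [r / (tau - sig)] in the relevant direction by the mean
    value theorem, and the slope decreases by at most [C * (q0 * r) * (tau - sig)] across the hump.
    The bounds do not involve [mu], which only acts outside the humps. *)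
Lemma hump_slope (c h u v : R -> R) (K C q0 r sig tau : R) :
  sublinear K h -> ode c h u v -> sig < tau -> 0 <= q0 -> 0 < r ->
  (forall s, 0 <= s <= r -> h s <= q0 * s) ->
  (forall x, sig <= x <= tau -> 0 <= c x <= C) ->
  (forall x, sig <= x <= tau -> u x <= r) ->
  (0 <= u sig -> v sig <= r / (tau - sig) + C * (q0 * r) * (tau - sig)) /\
  (0 <= u tau -> - (r / (tau - sig) + C * (q0 * r) * (tau - sig)) <= v tau).
Proof.
  intros Hh Ho Hst Hq0 Hr Hq Hc Hur.
  assert (Hhb : forall x, sig <= x <= tau -> h (u x) <= q0 * r).
  { intros x Hx. destruct (Rle_lt_dec (u x) 0) as [Hn|Hp].
    - rewrite (sublinear_nonpos K h _ Hh Hn). apply Rmult_le_pos; lra.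
    - apply Rle_trans with (q0 * u x); [apply Hq; split; [lra | apply Hur, Hx] |].
      apply Rmult_le_compat_l; [exact Hq0 | apply Hur, Hx]. }
  assert (Hslow : forall x y, sig <= x -> x <= y -> y <= tau ->
            v x - C * (q0 * r) * (tau - sig) <= v y).
  { intros x y Hx Hxy Hy.
    assert (HC : 0 <= C) by (specialize (Hc sig ltac:(lra)); lra).
    assert (HCq : 0 <= C * (q0 * r)) by (apply Rmult_le_pos; [lra | apply Rmult_le_pos; lra]).
    assert (H := MVT_lower v (fun x => - (c x * h (u x))) x y (- (C * (q0 * r))) Hxy
      (fun t _ => proj2 (Ho t))).
    assert (H' : - (C * (q0 * r)) * (y - x) <= v y - v x).
    { apply H. intros t Htx. apply Ropp_le_contravar.
      apply Rmult_le_compat; [apply Hc; lra | apply Hh | apply Hc; lra | apply Hhb; lra]. }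
    assert (C * (q0 * r) * (y - x) <= C * (q0 * r) * (tau - sig))
      by (apply Rmult_le_compat_l; lra). lra. }
  destruct (MVT_ex u v sig tau) as [t [Htt Et]]; [lra | intros; apply Ho |].
  assert (Hus := Hur sig ltac:(lra)). assert (Hut := Hur tau ltac:(lra)).
  assert (H1 := Hslow sig t ltac:(lra) ltac:(lra) ltac:(lra)).
  assert (H2 := Hslow t tau ltac:(lra) ltac:(lra) ltac:(lra)).
  split; intros Hu.
  - assert (v t <= r / (tau - sig)); [| lra].
    apply Rmult_le_reg_r with (tau - sig); [lra |].
    replace (r / (tau - sig) * (tau - sig)) with r by (field; lra). lra.
  - assert (- (r / (tau - sig)) <= v t); [| lra].
    apply Rmult_le_reg_r with (tau - sig); [lra |].
    replace (- (r / (tau - sig)) * (tau - sig)) with (- r) by (field; lra). lra.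
Qed.

(** Otherwise [u >= eps / 2] just before [sig], the slope varies there by an amount
    proportional to [mu], and going backwards [u] exceeds [M] at [t0]. *)
Lemma small_entry (N : R -> R) (t0 sig tau C q0 r M eps rho gam : R) :
  t0 < sig -> sig < tau -> 0 <= q0 -> 0 < r -> 0 <= M -> 0 < eps -> rho <= eps / 2 -> 0 < gam ->
  (forall x, continuity_pt N x) -> (forall x, 0 <= N x) ->
  (forall d, 0 < d -> exists y, sig - d < y < sig /\ 0 < N y) ->
  exists mu0, 0 < mu0 /\ forall mu c h u v K, mu0 < mu ->
    sublinear K h -> ode c h u v ->
    (forall s, 0 <= s <= r -> h s <= q0 * s) -> (forall s, rho <= s -> gam <= h s) ->
    (forall x, t0 <= x <= sig -> c x = - (mu * N x)) ->
    (forall x, sig <= x <= tau -> 0 <= c x <= C) ->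
    (forall x, t0 <= x <= sig -> 0 <= u x) -> u t0 <= M ->
    (forall x, sig <= x <= tau -> u x <= r) -> u sig <= eps.
Proof.
  intros Ht0 Hst Hq0 Hr HM He Hrho Hgam HNc HN Hacc.
  set (V := r / (tau - sig) + Rabs C * (q0 * r) * (tau - sig)).
  assert (HV : 0 < V).
  { assert (0 < r / (tau - sig)) by (apply Rdiv_lt_0_compat; lra).
    assert (0 <= Rabs C * (q0 * r) * (tau - sig)).
    { repeat apply Rmult_le_pos; try lra; apply Rabs_pos. }
    unfold V. lra. }
  (* Within distance [d] before [sig], a slope at most [V] accounts for a rise of at most [eps / 2];
     hence [u >= eps / 2 >= rho] there and [h u >= gam]. *)
  set (d := Rmin (sig - t0) (eps / 2 / V)).
  assert (Hd : 0 < d) by (apply Rmin_pos; [lra | apply Rdiv_lt_0_compat; lra]).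
  assert (Hd1 : d <= sig - t0) by apply Rmin_l.
  assert (Hd2 : V * d <= eps / 2).
  { apply Rle_trans with (V * (eps / 2 / V)); [apply Rmult_le_compat_l; [lra | apply Rmin_r] |].
    right. field. lra. }
  destruct (Hacc d Hd) as [y [Hy HNy]].
  destruct (positive_near N (sig - d) sig y (HNc y) HNy Hy) as (y1 & y2 & Hy1 & Hy12 & Hy2 & Hb).
  set (b := N y / 2) in *. assert (Hb0 : 0 < b) by (unfold b; lra).
  (* If the slope grows by more than [Q] on [[y1, y2]], it is below [- M / (y1 - t0) - 1] on
     [[t0, y1]]; from [u t0 <= M] the solution would then be negative at [y1]. *)
  set (Q := V + M / (y1 - t0) + 1).
  assert (HQ : 0 <= M / (y1 - t0)) by (apply Rmult_le_pos; [lra | left; apply Rinv_0_lt_compat; lra]).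
  assert (Hden : 0 < b * gam * (y2 - y1)) by (repeat apply Rmult_lt_0_compat; lra).
  exists (Q / (b * gam * (y2 - y1))). split; [apply Rdiv_lt_0_compat; [unfold Q |]; lra |].
  intros mu c h u v K Hmu Hh Ho Hq Hg Hcn Hcp Hu0 HuM Hur.
  assert (Hmu' : Q < mu * (b * gam * (y2 - y1))).
  { apply (Rmult_lt_compat_r _ _ _ Hden) in Hmu. unfold Rdiv in Hmu.
    rewrite Rmult_assoc, Rinv_l, Rmult_1_r in Hmu by lra. exact Hmu. }
  assert (Hmu0 : 0 < mu).
  { apply Rlt_trans with (2 := Hmu). apply Rdiv_lt_0_compat; [unfold Q |]; lra. }
  apply Rnot_lt_le. intros Hbig.
  assert (Hvs : v sig <= V).
  { destruct (hump_slope c h u v K (Rabs C) q0 r sig tau Hh Ho Hst Hq0 Hr Hq) as [H _];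
      try assumption; [| apply H; lra].
    intros x Hx. specialize (Hcp x Hx). split; [lra |].
    apply Rle_trans with C; [lra | apply Rle_abs]. }
  assert (Hvm : forall x y, t0 <= x -> x <= y -> y <= sig -> v x <= v y).
  { apply (v_increasing c h u v K t0 sig Hh Ho). intros x Hx. rewrite Hcn by exact Hx.
    assert (0 <= mu * N x) by (apply Rmult_le_pos; [lra | apply HN]). lra. }
  assert (Hux : forall x, y1 <= x <= y2 -> eps / 2 <= u x).
  { intros x Hx.
    assert (H := MVT_upper u v x sig V ltac:(lra) (fun t _ => proj1 (Ho t))).
    assert (H' : u sig - u x <= V * (sig - x)).
    { apply H. intros t Ht. apply Rle_trans with (2 := Hvs). apply Hvm; lra. }
    assert (V * (sig - x) <= V * d) by (apply Rmult_le_compat_l; lra). lra. }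
  assert (Hvy : v y1 <= V - Q).
  { assert (H := MVT_lower v (fun x => - (c x * h (u x))) y1 y2 (mu * (b * gam)) ltac:(lra)
      (fun t _ => proj2 (Ho t))).
    assert (H' : mu * (b * gam) * (y2 - y1) <= v y2 - v y1).
    { apply H. intros t Ht. rewrite Hcn by lra.
      replace (- (- (mu * N t) * h (u t))) with (mu * (N t * h (u t))) by ring.
      apply Rmult_le_compat_l; [lra |].
      apply Rmult_le_compat; [lra | lra | apply Hb, Ht |].
      apply Hg. specialize (Hux t Ht). lra. }
    assert (v y2 <= V) by (apply Rle_trans with (2 := Hvs); apply Hvm; lra). lra. }
  assert (H := MVT_upper u v t0 y1 (V - Q) ltac:(lra) (fun t _ => proj1 (Ho t))).
  assert (H' : u y1 - u t0 <= (V - Q) * (y1 - t0)).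
  { apply H. intros t Ht. apply Rle_trans with (2 := Hvy). apply Hvm; lra. }
  assert (Hlast : (V - Q) * (y1 - t0) = - M - (y1 - t0)) by (unfold Q; field; lra).
  specialize (Hu0 y1 ltac:(lra)). lra.
Qed.

(** The counterpart of [small_entry] to the right of the hump: the slope at [tau] is at least [- V],
    so [u] stays above [kap / 2] for a while, during which a large [mu] raises the slope above
    [M / (t1 - y2)]; convexity keeps it there and [u] reaches [M] before [t1]. *)
Lemma large_exit (N : R -> R) (sig tau t1 C q0 r M kap rho gam : R) :
  sig < tau -> tau < t1 -> 0 <= q0 -> 0 < r -> 0 <= M -> 0 < kap -> rho <= kap / 2 -> 0 < gam ->
  (forall x, continuity_pt N x) -> (forall x, 0 <= N x) ->
  (forall d, 0 < d -> exists y, tau < y < tau + d /\ 0 < N y) ->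
  exists mu0, 0 < mu0 /\ forall mu c h u v K, mu0 < mu ->
    sublinear K h -> ode c h u v ->
    (forall s, 0 <= s <= r -> h s <= q0 * s) -> (forall s, rho <= s -> gam <= h s) ->
    (forall x, tau <= x <= t1 -> c x = - (mu * N x)) ->
    (forall x, sig <= x <= tau -> 0 <= c x <= C) ->
    0 <= u sig -> kap <= u tau ->
    (forall x, sig <= x <= tau -> u x <= r) -> M <= u t1.
Proof.
  intros Hst Ht1 Hq0 Hr HM Hk Hrho Hgam HNc HN Hacc.
  set (V := r / (tau - sig) + Rabs C * (q0 * r) * (tau - sig)).
  assert (HV : 0 < V).
  { assert (0 < r / (tau - sig)) by (apply Rdiv_lt_0_compat; lra).
    assert (0 <= Rabs C * (q0 * r) * (tau - sig)).
    { repeat apply Rmult_le_pos; try lra; apply Rabs_pos. }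
    unfold V. lra. }
  set (d := Rmin (t1 - tau) (kap / 2 / V)).
  assert (Hd : 0 < d) by (apply Rmin_pos; [lra | apply Rdiv_lt_0_compat; lra]).
  assert (Hd1 : d <= t1 - tau) by apply Rmin_l.
  assert (Hd2 : V * d <= kap / 2).
  { apply Rle_trans with (V * (kap / 2 / V)); [apply Rmult_le_compat_l; [lra | apply Rmin_r] |].
    right. field. lra. }
  destruct (Hacc d Hd) as [y [Hy HNy]].
  destruct (positive_near N tau (tau + d) y (HNc y) HNy Hy) as (y1 & y2 & Hy1 & Hy12 & Hy2 & Hb).
  set (b := N y / 2) in *. assert (Hb0 : 0 < b) by (unfold b; lra).
  set (Q := V + M / (t1 - y2) + 1).
  assert (HQ : 0 <= M / (t1 - y2)) by (apply Rmult_le_pos; [lra | left; apply Rinv_0_lt_compat; lra]).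
  assert (Hden : 0 < b * gam * (y2 - y1)) by (repeat apply Rmult_lt_0_compat; lra).
  exists (Q / (b * gam * (y2 - y1))). split; [apply Rdiv_lt_0_compat; [unfold Q |]; lra |].
  intros mu c h u v K Hmu Hh Ho Hq Hg Hcn Hcp Hus Hut Hur.
  assert (Hmu' : Q < mu * (b * gam * (y2 - y1))).
  { apply (Rmult_lt_compat_r _ _ _ Hden) in Hmu. unfold Rdiv in Hmu.
    rewrite Rmult_assoc, Rinv_l, Rmult_1_r in Hmu by lra. exact Hmu. }
  assert (Hmu0 : 0 < mu).
  { apply Rlt_trans with (2 := Hmu). apply Rdiv_lt_0_compat; [unfold Q |]; lra. }
  assert (Hvt : - V <= v tau).
  { destruct (hump_slope c h u v K (Rabs C) q0 r sig tau Hh Ho Hst Hq0 Hr Hq) as [_ H];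
      try assumption; [| apply H; lra].
    intros x Hx. specialize (Hcp x Hx). split; [lra |].
    apply Rle_trans with C; [lra | apply Rle_abs]. }
  assert (Hvm : forall x y, tau <= x -> x <= y -> y <= t1 -> v x <= v y).
  { apply (v_increasing c h u v K tau t1 Hh Ho). intros x Hx. rewrite Hcn by exact Hx.
    assert (0 <= mu * N x) by (apply Rmult_le_pos; [lra | apply HN]). lra. }
  assert (Hux : forall x, y1 <= x <= y2 -> kap / 2 <= u x).
  { intros x Hx.
    assert (H := MVT_lower u v tau x (- V) ltac:(lra) (fun t _ => proj1 (Ho t))).
    assert (H' : - V * (x - tau) <= u x - u tau).
    { apply H. intros t Ht. apply Rle_trans with (1 := Hvt). apply Hvm; lra. }
    assert (V * (x - tau) <= V * d) by (apply Rmult_le_compat_l; lra). lra. }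
  assert (Hvy : Q - V <= v y2).
  { assert (H := MVT_lower v (fun x => - (c x * h (u x))) y1 y2 (mu * (b * gam)) ltac:(lra)
      (fun t _ => proj2 (Ho t))).
    assert (H' : mu * (b * gam) * (y2 - y1) <= v y2 - v y1).
    { apply H. intros t Ht. rewrite Hcn by lra.
      replace (- (- (mu * N t) * h (u t))) with (mu * (N t * h (u t))) by ring.
      apply Rmult_le_compat_l; [lra |].
      apply Rmult_le_compat; [lra | lra | apply Hb, Ht |].
      apply Hg. specialize (Hux t Ht). lra. }
    assert (- V <= v y1) by (apply Rle_trans with (1 := Hvt); apply Hvm; lra). lra. }
  assert (H := MVT_lower u v y2 t1 (Q - V) ltac:(lra) (fun t _ => proj1 (Ho t))).
  assert (H' : (Q - V) * (t1 - y2) <= u t1 - u y2).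
  { apply H. intros t Ht. apply Rle_trans with (1 := Hvy). apply Hvm; lra. }
  assert (Hlast : (Q - V) * (t1 - y2) = M + (t1 - y2)) by (unfold Q; field; lra).
  specialize (Hux y2 ltac:(lra)). lra.
Qed.

(** * Shooting *)

Lemma lipschitz_continuity_pt (f : R -> R) (D x : R) :
  (forall s t, Rabs (f s - f t) <= D * Rabs (s - t)) -> continuity_pt f x.
Proof.
  intros H. apply (lipschitz_continuity (fun _ => 0) f 0 D); [| exact H].
  intros _. rewrite Rabs_R0. lra.
Qed.

(** [tm] is the first time at which [m] reaches [r], and [t0] the last zero of [E] before it; that
    zero exists because [E] is positive at [tm]. *)
Lemma first_crossing (m E : R -> R) (r : R) :
  (forall t, continuity_pt m t) -> (forall t, continuity_pt E t) ->
  m 0 <= r <= m 1 -> E 0 <= 0 ->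
  (forall t, 0 <= t <= 1 -> m t = r -> 0 < E t) ->
  exists t0 tm, 0 <= t0 <= tm /\ tm <= 1 /\ m tm = r /\ E t0 = 0 /\
    forall t, t0 <= t <= tm -> 0 <= E t /\ m t <= r.
Proof.
  intros Hm HE Hr HE0 Hpos.
  destruct (first_zero (fun t => m t - r) 0 1) as [tm [Htm [Em Hle]]].
  - lra.
  - intros t. apply continuity_pt_minus; [apply Hm |].
    apply continuity_pt_const. intros ? ?. reflexivity.
  - lra.
  - lra.
  - assert (Hmr : m tm = r) by lra.
    destruct (last_zero E 0 tm) as [t0 [Ht0 [E0 Hge]]].
    + lra.
    + exact HE.
    + exact HE0.
    + left. apply Hpos; [lra | exact Hmr].
    + exists t0, tm. repeat split; try lra.
      * apply Hge. lra.
      * specialize (Hle t ltac:(lra)). simpl in Hle. lra.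
Qed.

(** [m] is the maximum on a hump and [E] the value of the solution at the next one, along
    a path of slopes. The sign changes of [E] before the first and after the last passage of
    [m] through [r] produce the small and the large branch. *)
Lemma crossing (m E : R -> R) (r : R) (b : bool) :
  (forall t, continuity_pt m t) -> (forall t, continuity_pt E t) ->
  m 0 <= r <= m 1 -> E 0 <= 0 -> E 1 <= 0 ->
  (forall t, 0 <= t <= 1 -> m t = r -> 0 < E t) ->
  exists t0 tm, 0 <= t0 <= 1 /\ 0 <= tm <= 1 /\ m tm = r /\ E t0 = 0 /\
    forall th, 0 <= th <= 1 -> 0 <= E (t0 + th * (tm - t0)) /\
      if b then r <= m (t0 + th * (tm - t0)) else m (t0 + th * (tm - t0)) <= r.
Proof.
  intros Hm HE Hr HE0 HE1 Hpos.
  assert (Hconv : forall a d th, a <= d -> 0 <= th <= 1 -> a <= a + th * (d - a) <= d).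
  { intros a d th Had Hth.
    assert (0 <= th * (d - a)) by (apply Rmult_le_pos; lra).
    assert (th * (d - a) <= 1 * (d - a)) by (apply Rmult_le_compat_r; lra). lra. }
  destruct b.
  (* Reversing the path and negating [m] and [r] turns the last passage through [r] into the first
     one. *)
  - destruct (first_crossing (fun t => - m (1 - t)) (fun t => E (1 - t)) (- r))
      as (t0 & tm & Ht0 & Htm & Em & E0 & Hb).
    + intros t. apply continuity_pt_opp, continuity_pt_reflect, Hm.
    + intros t. apply continuity_pt_reflect, HE.
    + rewrite Rminus_0_r, Rminus_diag. lra.
    + rewrite Rminus_0_r. exact HE1.
    + intros t Ht Et. apply Hpos; lra.
    + exists (1 - t0), (1 - tm). repeat split; try lra.
      * specialize (Hb (t0 + th * (tm - t0)) (Hconv t0 tm th ltac:(lra) H)).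
        replace (1 - t0 + th * (1 - tm - (1 - t0))) with (1 - (t0 + th * (tm - t0))) by ring.
        apply Hb.
      * specialize (Hb (t0 + th * (tm - t0)) (Hconv t0 tm th ltac:(lra) H)).
        replace (1 - t0 + th * (1 - tm - (1 - t0))) with (1 - (t0 + th * (tm - t0))) by ring.
        lra.
  - destruct (first_crossing m E r Hm HE Hr HE0 Hpos)
      as (t0 & tm & Ht0 & Htm & Em & E0 & Hb).
    exists t0, tm. repeat split; try lra; apply Hb, Hconv; lra.
Qed.

(** Maxima of functions that differ by at most [D * Rabs (s - t)] differ by no more. This makes the
    maximum on a hump a continuous function of the slope, as [crossing] demands. *)
Lemma max_function (U : R -> R -> R) (a b D : R) :
  a <= b -> (forall s x, continuity_pt (U s) x) ->
  (forall s t x, a <= x <= b -> Rabs (U s x - U t x) <= D * Rabs (s - t)) ->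
  exists m : R -> R,
    (forall s, (forall x, a <= x <= b -> U s x <= m s) /\
               exists x, a <= x <= b /\ U s x = m s) /\
    (forall s t, Rabs (m s - m t) <= D * Rabs (s - t)).
Proof.
  intros Hab Hc HD.
  destruct (functional_choice (fun s y => (forall x, a <= x <= b -> U s x <= y) /\
               exists x, a <= x <= b /\ U s x = y)) as [m Hm].
  { intros s. destruct (continuity_ab_maj (U s) a b Hab (fun x _ => Hc s x)) as [x [Hx Hx']].
    exists (U s x). split; [exact Hx |]. exists x. auto. }
  assert (Hhalf : forall s t, m s - m t <= D * Rabs (s - t)).
  { intros s t. destruct (Hm s) as [_ [x [Hx <-]]]. destruct (Hm t) as [Ht _].
    specialize (Ht x Hx). assert (H := HD s t x Hx). apply Rabs_le_between in H. lra. }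
  exists m. split; [exact Hm |]. intros s t. apply Rabs_le_between.
  assert (H1 := Hhalf s t). assert (H2 := Hhalf t s). rewrite (Rabs_minus_sym t s) in H2. lra.
Qed.

(** Both alternatives are closed conditions, so that they survive limits. They overlap exactly when
    the maximum on the hump is [r]; excluding this case is left to the critical estimate. *)
Definition hump_word (sigma tau : nat -> R) (r : R) (i : nat) (b : bool) (u : R -> R) : Prop :=
  if b then exists x, sigma i <= x <= tau i /\ r <= u x
  else forall x, sigma i <= x <= tau i -> u x <= r.

Section Shooting.
Variables (n : nat) (sigma tau : nat -> R) (L : R).
Hypotheses (Hn : (1 <= n)%nat) (Hs1 : sigma 1%nat = 0) (HtL : tau n = L)
  (Hst : forall i, (1 <= i <= n)%nat -> sigma i < tau i)
  (Hts : forall i, (1 <= i < n)%nat -> tau i < sigma (S i)).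

Lemma partition_bounds (i : nat) : (1 <= i <= n)%nat -> 0 <= sigma i /\ tau i <= L.
Proof.
  intros Hi. split.
  - induction i as [|i IH]; [lia |]. destruct (Nat.eq_dec i 0) as [->|Hne].
    + rewrite Hs1. lra.
    + specialize (IH ltac:(lia)). specialize (Hst i ltac:(lia)). specialize (Hts i ltac:(lia)). lra.
  - assert (H : forall k, (k <= n - 1)%nat -> tau (n - k)%nat <= L).
    { intros k. induction k as [|k IH]; intros Hk.
      - rewrite Nat.sub_0_r. lra.
      - specialize (IH ltac:(lia)). specialize (Hst (n - k)%nat ltac:(lia)).
        specialize (Hts (n - S k)%nat ltac:(lia)).
        replace (S (n - S k)) with (n - k)%nat in Hts by lia. lra. }
    specialize (H (n - i)%nat ltac:(lia)). replace (n - (n - i))%nat with i in H by lia. exact H.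
Qed.

Lemma partition_cover (x : R) : 0 <= x <= L ->
  exists i, (1 <= i <= n)%nat /\
    (sigma i <= x <= tau i \/ ((i < n)%nat /\ tau i <= x <= sigma (S i))).
Proof.
  intros Hx.
  assert (H : forall k, (1 <= k <= n)%nat -> x <= tau k ->
    exists i, (1 <= i <= n)%nat /\
    (sigma i <= x <= tau i \/ ((i < n)%nat /\ tau i <= x <= sigma (S i)))).
  { intros k. induction k as [|k IH]; intros Hk Hxk; [lia |].
    destruct (Rle_lt_dec (sigma (S k)) x) as [Hle|Hlt].
    - exists (S k). split; [lia |]. left. lra.
    - destruct (Nat.eq_dec k 0) as [->|Hne]; [lra |].
      destruct (Rle_lt_dec x (tau k)) as [Hle'|Hlt'].
      + apply IH; [lia | exact Hle'].
      + exists k. split; [lia |]. right. split; [lia | lra]. }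
  apply (H n); [lia | lra].
Qed.

Variables (c h : R -> R) (K C r M : R).
Hypotheses (Hh : sublinear K h) (HC : forall x, Rabs (c x) <= C) (HrM : r < M) (Hr : 0 < r).
Hypothesis (Hbound : forall i u v, (1 <= i <= n)%nat -> ode c h u v ->
  (forall x, sigma i <= x <= tau i -> 0 <= u x) ->
  forall x, sigma i <= x <= tau i -> u x < M).
Hypothesis (Hcrit : forall i u v xi, (1 <= i <= n)%nat -> ode c h u v -> u 0 = 0 ->
  (forall x, 0 <= x <= sigma i -> 0 <= u x) ->
  (forall x, sigma i <= x <= tau i -> u x <= r) ->
  sigma i <= xi <= tau i -> u xi = r ->
  if (i <? n)%nat then M <= u (sigma (S i)) else 0 < u L).
Hypothesis (Hneg : forall i x, (1 <= i < n)%nat -> tau i <= x <= sigma (S i) -> c x <= 0).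

(** In a gap the weight is nonpositive, so the solution is convex there and lies below its two
    endpoint values, which belong to humps. *)
Lemma nonneg_solution_bound (u v : R -> R) :
  ode c h u v -> (forall x, 0 <= x <= L -> 0 <= u x) -> forall x, 0 <= x <= L -> u x <= M.
Proof.
  intros Ho Hu x Hx.
  assert (Hhump : forall i y, (1 <= i <= n)%nat -> sigma i <= y <= tau i -> u y < M).
  { intros i y Hi Hy. apply (Hbound i u v Hi Ho); [| exact Hy].
    destruct (partition_bounds i Hi). intros t Ht. apply Hu. lra. }
  destruct (partition_cover x Hx) as [i [Hi [Hxi|[Hin Hxi]]]].
  - left. apply (Hhump i); assumption.
  - apply Rnot_lt_le. intros Hbig.
    assert (H1 := Hhump i (tau i) Hi ltac:(specialize (Hst i Hi); lra)).
    assert (H2 := Hhump (S i) (sigma (S i)) ltac:(lia)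
      ltac:(specialize (Hst (S i) ltac:(lia)); lra)).
    destruct (MVT_ex u v (tau i) x) as [t1 [Ht1 E1]]; [lra | intros; apply Ho |].
    destruct (MVT_ex u v x (sigma (S i))) as [t2 [Ht2 E2]]; [lra | intros; apply Ho |].
    assert (Hxt : tau i < x) by (destruct (Req_dec (tau i) x) as [E|]; [rewrite E in H1; lra | lra]).
    assert (Hxs : x < sigma (S i))
      by (destruct (Req_dec x (sigma (S i))) as [E|]; [rewrite <- E in H2; lra | lra]).
    assert (Hv1 : 0 < v t1) by (apply Rmult_lt_reg_r with (x - tau i); lra).
    assert (Hv2 : v t2 < 0) by (apply Rmult_lt_reg_r with (sigma (S i) - x); lra).
    assert (H := v_increasing c h u v K (tau i) (sigma (S i)) Hh Ho
      (fun y Hy => Hneg i y ltac:(lia) Hy) t1 t2 ltac:(lra) ltac:(lra) ltac:(lra)).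
    lra.
Qed.

Variables (U V : R -> R -> R) (D s0 : R).
Hypotheses (HU : forall s, ode c h (U s) (V s)) (HU0 : forall s, U s 0 = 0)
  (HV0 : forall s, V s 0 = s)
  (HD : forall s t x, 0 <= x <= L -> Rabs (U s x - U t x) <= D * Rabs (s - t))
  (Hs0 : exists x, sigma 1%nat <= x <= tau 1%nat /\ M <= U s0 x).
Variable (word : nat -> bool).

Let nonneg_until (s y x : R) : 0 <= U s y -> 0 <= x <= y -> 0 <= U s x.
Proof.
  intros Hy Hx. apply (nonneg_between c h (U s) (V s) K C 0 y x Hh HC (HU s)); try assumption.
  rewrite HU0. lra.
Qed.

(** The slopes between [p] and [q], in either order. The conditions at [p] force the
    solution of slope [p] to be nonpositive after [y]. *)
Definition shooting_segment (i : nat) (y p q : R) : Prop :=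
  (forall t, 0 <= t <= 1 -> 0 <= U (p + t * (q - p)) y /\
     forall j, (1 <= j <= i)%nat -> hump_word sigma tau r j (word j) (U (p + t * (q - p)))) /\
  U p y = 0 /\ V p y <= 0.

(** Of the two ends found by [crossing], the one where the solution vanishes at [y] becomes [p'].
    The other, where the maximum on the hump is exactly [r], becomes [q']: [Hcrit] puts its solution
    above [M] at the next hump, so that the step can be repeated. *)
Lemma shooting_step (i : nat) (p q : R) :
  (i < n)%nat -> shooting_segment i (sigma (S i)) p q ->
  (exists x, sigma (S i) <= x <= tau (S i) /\ M <= U q x) ->
  exists p' q',
    if (S i <? n)%nat then
      shooting_segment (S i) (sigma (S (S i))) p' q' /\ M <= U q' (sigma (S (S i)))
    else shooting_segment (S i) L p' q'.
Proof.
  intros Hi [Hseg [Hp Hvp]] [xq [Hxq HMq]].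
  assert (HSi : (1 <= S i <= n)%nat) by lia.
  destruct (partition_bounds (S i) HSi) as [Hsig Htau].
  assert (Hstau := Hst (S i) HSi).
  set (y := if (S i <? n)%nat then sigma (S (S i)) else L).
  assert (Hy : tau (S i) <= y <= L).
  { unfold y. destruct (Nat.ltb_spec (S i) n) as [Hlt|Hge].
    - assert (H := Hts (S i) ltac:(lia)).
      destruct (partition_bounds (S (S i)) ltac:(lia)).
      specialize (Hst (S (S i)) ltac:(lia)). lra.
    - split; [exact Htau | lra]. }
  destruct (max_function U (sigma (S i)) (tau (S i)) D) as [m [Hm HmD]].
  { lra. }
  { intros s x. apply (ode_continuity c h (U s) (V s) x (HU s)). }
  { intros s t x Hx. apply HD. lra. }
  set (sl := fun t => p + t * (q - p)).
  assert (Hsl : forall t, continuity_pt sl t).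
  { intros t. unfold sl. apply derivable_continuous_pt.
    exists (q - p). apply is_derive_Reals. auto_derive; [exact I | ring]. }
  assert (Hmc : forall t, continuity_pt (fun t => m (sl t)) t).
  { intros t. apply (continuity_pt_comp sl m); [apply Hsl |].
    apply lipschitz_continuity_pt with D, HmD. }
  assert (HEc : forall t, continuity_pt (fun t => U (sl t) y) t).
  { intros t. apply (continuity_pt_comp sl (fun s => U s y)); [apply Hsl |].
    apply lipschitz_continuity_pt with D. intros s s'. apply HD. lra. }
  assert (Hsl0 : sl 0 = p) by (unfold sl; ring).
  assert (Hsl1 : sl 1 = q) by (unfold sl; ring).
  assert (Hpneg : forall x, sigma (S i) <= x -> U p x <= 0).
  { intros x Hx.
    destruct (linear_right c h (U p) (V p) K C Hh HC (HU p) (sigma (S i)) x) as [E _];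
      [lra | exact Hvp | exact Hx |].
    rewrite E, Hp. assert (V p (sigma (S i)) * (x - sigma (S i)) <= 0); [| lra].
    rewrite <- (Rmult_0_l (x - sigma (S i))). apply Rmult_le_compat_r; lra. }
  assert (Hcr : forall t, 0 <= t <= 1 -> m (sl t) = r ->
     if (S i <? n)%nat then M <= U (sl t) (sigma (S (S i))) else 0 < U (sl t) L).
  { intros t Ht Hmt. destruct (Hm (sl t)) as [Hm1 [xi [Hxi Exi]]].
    apply (Hcrit (S i) (U (sl t)) (V (sl t)) xi HSi (HU _) (HU0 _)); try lra.
    - intros x Hx. apply (nonneg_until (sl t) (sigma (S i))); [apply Hseg, Ht | exact Hx].
    - intros x Hx. rewrite <- Hmt. apply Hm1, Hx. }
  destruct (crossing (fun t => m (sl t)) (fun t => U (sl t) y) r (word (S i)) Hmc HEc)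
    as (t0 & tm & Ht0 & Htm & Em & E0 & Hb).
  - rewrite Hsl0, Hsl1. split.
    + destruct (Hm p) as [_ [x [Hx <-]]]. specialize (Hpneg x ltac:(lra)). lra.
    + assert (H := proj1 (Hm q) xq Hxq). lra.
  - rewrite Hsl0. apply Hpneg. lra.
  (* A positive value at [y] would make the solution of slope [q] nonnegative on the whole hump, and
     [Hbound] would keep it below [M], against [M <= U q xq]. *)
  - rewrite Hsl1. apply Rnot_lt_le. intros Hlt.
    assert (H := Hbound (S i) (U q) (V q) HSi (HU q)
      (fun x Hx => nonneg_until q y x (Rlt_le _ _ Hlt) ltac:(lra)) xq Hxq). lra.
  - intros t Ht Hmt. specialize (Hcr t Ht Hmt). unfold y.
    destruct (S i <? n)%nat; [lra | exact Hcr].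
  - assert (Hsub : forall th, sl t0 + th * (sl tm - sl t0) = sl (t0 + th * (tm - t0)))
      by (intros th; unfold sl; ring).
    assert (Hnew : shooting_segment (S i) y (sl t0) (sl tm)).
    { split; [| split; [exact E0 |]].
      - intros th Hth. destruct (Hb th Hth) as [Hb1 Hb2]. rewrite Hsub.
        split; [exact Hb1 |]. intros j Hj. destruct (Nat.eq_dec j (S i)) as [->|Hne].
        + unfold hump_word. destruct (Hm (sl (t0 + th * (tm - t0)))) as [Hm1 [x [Hx Ex]]].
          destruct (word (S i)).
          * exists x. split; [exact Hx | lra].
          * intros z Hz. specialize (Hm1 z Hz). lra.
        + apply Hseg; [| lia].
          assert (0 <= th * tm <= th * 1)
            by (split; [apply Rmult_le_pos; lra | apply Rmult_le_compat_l; lra]).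
          assert (0 <= (1 - th) * t0 <= (1 - th) * 1)
            by (split; [apply Rmult_le_pos; lra | apply Rmult_le_compat_l; lra]).
          lra.
      - apply (deriv_sign_left (U (sl t0)) 0 y); [lra | apply HU | exact E0 |].
        intros x Hx. apply (nonneg_until (sl t0) y); lra. }
    exists (sl t0), (sl tm). specialize (Hcr tm Htm Em). revert Hnew Hcr. unfold y.
    destruct (S i <? n)%nat; [intros Hnew Hcr; split; assumption | intros Hnew _; exact Hnew].
Qed.

Lemma shooting_segment_exists (i : nat) :
  (i < n)%nat -> exists p q, shooting_segment i (sigma (S i)) p q /\
    exists x, sigma (S i) <= x <= tau (S i) /\ M <= U q x.
Proof.
  induction i as [|i IH]; intros Hi.
  (* No hump has been treated yet: at [sigma 1 = 0] all solutions vanish, slope [0] satisfies the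
     sign condition, and [s0] is steep enough to reach [M] on the first hump. *)
  - exists 0, s0. split; [| exact Hs0].
    split; [| rewrite Hs1, HV0; split; [apply HU0 | lra]].
    intros t Ht. rewrite Hs1, HU0. split; [lra | intros; lia].
  - destruct (IH ltac:(lia)) as (p & q & Hseg & Hq).
    destruct (shooting_step i p q ltac:(lia) Hseg Hq) as (p' & q' & H).
    destruct (Nat.ltb_spec (S i) n) as [_|]; [| lia].
    destruct H as [H1 H2]. exists p', q'. split; [exact H1 |].
    exists (sigma (S (S i))). specialize (Hst (S (S i)) ltac:(lia)). split; [lra | exact H2].
Qed.

Lemma shooting_solution :
  exists s, U s L = 0 /\ (forall x, 0 <= x <= L -> 0 <= U s x) /\
    forall i, (1 <= i <= n)%nat -> hump_word sigma tau r i (word i) (U s).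
Proof.
  destruct (shooting_segment_exists (n - 1) ltac:(lia)) as (p & q & Hseg & Hq).
  destruct (shooting_step (n - 1) p q ltac:(lia) Hseg Hq) as (p' & q' & H).
  replace (S (n - 1)) with n in H by lia. rewrite Nat.ltb_irrefl in H.
  destruct H as [Hs [Hp _]]. exists p'.
  (* Parameter [0] of the last segment is its end [p'], the slope whose solution vanishes at [L]. *)
  destruct (Hs 0 ltac:(lra)) as [H1 H2]. rewrite Rmult_0_l, Rplus_0_r in H1, H2.
  split; [exact Hp |]. split; [| exact H2].
  intros x Hx. apply (nonneg_until p' L); assumption.
Qed.

End Shooting.

(** * Limits and approximation *)

(** Inside [[0, L]] the slope vanishes somewhere and its derivative is at most [C * (K * M)] in
    absolute value; outside, the solution is nonpositive and linear. The bound covers the whole line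
    because [ultralimit_C2] works there. *)
Lemma dirichlet_slope_bound (c h u v : R -> R) (K C L M x : R) :
  0 < L -> sublinear K h -> (forall x, Rabs (c x) <= C) -> ode c h u v ->
  u 0 = 0 -> u L = 0 -> (forall x, 0 <= x <= L -> 0 <= u x <= M) ->
  Rabs (v x) <= C * (K * M) * L.
Proof.
  intros HL Hh HC Ho E0 EL Hu.
  assert (HK := sublinear_const K h Hh).
  assert (HC0 : 0 <= C) by (apply Rle_trans with (2 := HC 0), Rabs_pos).
  assert (HM : 0 <= M) by (specialize (Hu 0 ltac:(lra)); lra).
  assert (HCKM : 0 <= C * (K * M)) by (apply Rmult_le_pos; [lra | apply Rmult_le_pos; lra]).
  assert (Hin : forall x, 0 <= x <= L -> Rabs (v x) <= C * (K * M) * L).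
  { intros y Hy. destruct (MVT_ex u v 0 L) as [t [Ht Et]]; [lra | intros; apply Ho |].
    assert (Ev : v t = 0) by (apply Rmult_eq_reg_r with (L - 0); lra).
    assert (Hd : forall z, 0 <= z <= L -> Rabs (- (c z * h (u z))) <= C * (K * M)).
    { intros z Hz. rewrite Rabs_Ropp, Rabs_mult.
      apply Rmult_le_compat; try apply Rabs_pos; [apply HC |].
      assert (H := Hh (u z)). rewrite Rabs_right by lra.
      apply Rle_trans with (1 := proj2 H), Rmult_le_compat_l; [exact HK |].
      apply Rmax_lub; [apply Hu, Hz | exact HM]. }
    assert (H := increment_bound v (fun z => - (c z * h (u z))) t y (C * (K * M))).
    rewrite Ev, Rminus_0_r in H.
    apply Rle_trans with (C * (K * M) * Rabs (y - t)).
    - apply H. intros z Hz. split; [apply Ho |].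
      (* [increment_bound] asks for the derivative on an interval symmetric about [t], which may
         leave [[0, L]]; there [u] is nonpositive, so [h u = 0]. *)
      destruct (Rle_lt_dec 0 z) as [Hz0|Hz0]; [destruct (Rle_lt_dec z L) as [HzL|HzL] |].
      + apply Hd. lra.
      + destruct (linear_right c h u v K C Hh HC Ho L z) as [E _]; [lra | | lra |].
        * apply (deriv_sign_left u 0 L); [exact HL | apply Ho | exact EL | apply Hu].
        * rewrite (sublinear_nonpos K h _ Hh), Rmult_0_r, Ropp_0, Rabs_R0; [exact HCKM |].
          rewrite E, EL. assert (v L <= 0)
            by (apply (deriv_sign_left u 0 L); [exact HL | apply Ho | exact EL | apply Hu]).
          assert (0 <= - v L * (z - L)) by (apply Rmult_le_pos; lra). lra.
      + destruct (linear_left c h u v K C 0 z Hh HC Ho) as [E _]; [lra | | lra |].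
        * apply (deriv_sign_right u 0 L); [exact HL | apply Ho | exact E0 | apply Hu].
        * rewrite (sublinear_nonpos K h _ Hh), Rmult_0_r, Ropp_0, Rabs_R0; [exact HCKM |].
          rewrite E, E0. assert (0 <= v 0)
            by (apply (deriv_sign_right u 0 L); [exact HL | apply Ho | exact E0 | apply Hu]).
          assert (0 <= v 0 * - z) by (apply Rmult_le_pos; lra). lra.
    - apply Rmult_le_compat_l; [exact HCKM |]. apply Rabs_le_between. lra. }
  destruct (Rle_lt_dec 0 x) as [Hx0|Hx0]; [destruct (Rle_lt_dec x L) as [HxL|HxL] |].
  - apply Hin. lra.
  - destruct (linear_right c h u v K C Hh HC Ho L x) as [_ E]; [lra | | lra |].
    + apply (deriv_sign_left u 0 L); [exact HL | apply Ho | exact EL | apply Hu].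
    + rewrite E. apply Hin. lra.
  - destruct (linear_left c h u v K C 0 x Hh HC Ho) as [_ E]; [lra | | lra |].
    + apply (deriv_sign_right u 0 L); [exact HL | apply Ho | exact E0 | apply Hu].
    + rewrite E. apply Hin. lra.
Qed.

(** The slope bound does not depend on [k], so [ultralimit_C2] applies, and every condition on the
    solutions is closed under the limit. *)
Lemma dirichlet_limit (c h : R -> R) (hk : nat -> R -> R) (K C L M r : R)
  (n : nat) (sigma tau : nat -> R) (word : nat -> bool) :
  0 < L -> (forall x, continuity_pt c x) -> (forall x, Rabs (c x) <= C) ->
  (forall k, sublinear K (hk k)) ->
  (forall s eps, 0 < eps -> exists eta N, 0 < eta /\ forall k t, (N <= k)%nat ->
     Rabs (t - s) < eta -> Rabs (hk k t - h s) < eps) ->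
  (forall k, exists u v, ode c (hk k) u v /\ u 0 = 0 /\ u L = 0 /\
     (forall x, 0 <= x <= L -> 0 <= u x <= M) /\
     forall i, (1 <= i <= n)%nat -> hump_word sigma tau r i (word i) u) ->
  exists u v, ode c h u v /\ u 0 = 0 /\ u L = 0 /\
     (forall x, 0 <= x <= L -> 0 <= u x <= M) /\
     forall i, (1 <= i <= n)%nat -> hump_word sigma tau r i (word i) u.
Proof.
  intros HL Hc HC Hsub Hconv Hex.
  destruct free_ultrafilter_exists as [F HF].
  destruct (functional_choice (fun k (y : (R -> R) * (R -> R)) =>
     ode c (hk k) (fst y) (snd y) /\ fst y 0 = 0 /\ fst y L = 0 /\
     (forall x, 0 <= x <= L -> 0 <= fst y x <= M) /\
     forall i, (1 <= i <= n)%nat -> hump_word sigma tau r i (word i) (fst y))) as [Y HY].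
  { intros k. destruct (Hex k) as (u & v & H). exists (u, v). exact H. }
  set (uk := fun k => fst (Y k)). set (vk := fun k => snd (Y k)).
  assert (HK := sublinear_const K _ (Hsub 0%nat)).
  assert (HC0 : 0 <= C) by (apply Rle_trans with (2 := HC 0), Rabs_pos).
  set (B := C * (K * M) * L).
  assert (Hv : forall k x, Rabs (vk k x) <= B).
  { intros k x. destruct (HY k) as (Ho & E0 & EL & Hu & _).
    apply (dirichlet_slope_bound c (hk k) (uk k)); try assumption. apply Hsub. }
  assert (HB : 0 <= B) by (apply Rle_trans with (2 := Hv 0%nat 0), Rabs_pos).
  assert (Hlip : forall k x y, Rabs (uk k x - uk k y) <= B * Rabs (x - y)).
  { intros k x y. apply (increment_bound (uk k) (vk k)). intros z _. split; [apply (HY k) | apply Hv]. }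
  assert (Hu : forall k x, Rabs (uk k x) <= B * Rabs x).
  { intros k x. assert (H := Hlip k x 0). destruct (HY k) as (_ & E0 & _). fold (uk k) in E0.
    rewrite E0, !Rminus_0_r in H. exact H. }
  destruct (ultralimit_C2 F HF uk vk (fun k x => - (c x * hk k (uk k x)))
    (fun x s => - (c x * h s))) as (u & v & Lu & Lv & Ho).
  - intros k x. apply (HY k).
  - intros X. exists (B * Rabs X + B + C * (K * (B * Rabs X))). intros k x Hx.
    assert (HX : B * Rabs x <= B * Rabs X).
    { apply Rmult_le_compat_l; [exact HB |]. apply Rle_trans with (1 := Hx), Rle_abs. }
    assert (HX0 : 0 <= B * Rabs X) by (apply Rmult_le_pos; [exact HB | apply Rabs_pos]).
    assert (HCX : 0 <= C * (K * (B * Rabs X)))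
      by (apply Rmult_le_pos; [exact HC0 | apply Rmult_le_pos; assumption]).
    assert (H1 := Hu k x). assert (H2 := Hv k x).
    assert (H3 : Rabs (- (c x * hk k (uk k x))) <= C * (K * (B * Rabs X))).
    { rewrite Rabs_Ropp, Rabs_mult.
      apply Rmult_le_compat; try apply Rabs_pos; [apply HC |].
      assert (H := Hsub k (uk k x)). rewrite Rabs_right by lra.
      apply Rle_trans with (1 := proj2 H), Rmult_le_compat_l; [exact HK |].
      apply Rmax_lub; [| lra]. apply Rle_trans with (1 := Rle_abs _). lra. }
    lra.
  - intros x0 s eps He.
    set (e1 := eps / (2 * (C + Rabs (h s) + 1))).
    assert (Hp := Rabs_pos (h s)).
    assert (He1 : 0 < e1) by (apply Rdiv_lt_0_compat; lra).
    assert (Ee1 : e1 * (2 * (C + Rabs (h s) + 1)) = eps) by (unfold e1; field; lra).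
    destruct (Hconv s e1 He1) as (eta & N & Heta & HN).
    destruct (continuity_pt_eps_inv c x0 e1 (Hc x0) He1) as [d [Hd Hcd]].
    exists (Rmin eta d). split; [apply Rmin_pos; assumption |].
    apply (uf_imp F HF) with (1 := uf_tail F HF N). intros k Hk x Hx Hux.
    assert (G1 := HN k (uk k x) Hk (Rlt_le_trans _ _ _ Hux (Rmin_l _ _))).
    assert (G2 := Hcd x (Rlt_le_trans _ _ _ Hx (Rmin_r _ _))).
    replace (- (c x * hk k (uk k x)) - - (c x0 * h s))
      with (- (c x * (hk k (uk k x) - h s) + (c x - c x0) * h s)) by ring.
    rewrite Rabs_Ropp. apply Rle_lt_trans with (1 := Rabs_triang _ _). rewrite !Rabs_mult.
    assert (Rabs (c x) * Rabs (hk k (uk k x) - h s) <= C * e1)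
      by (apply Rmult_le_compat; try apply Rabs_pos; [apply HC | lra]).
    assert (Rabs (c x - c x0) * Rabs (h s) <= e1 * Rabs (h s))
      by (apply Rmult_le_compat_r; lra).
    assert (0 < e1 * (C + Rabs (h s) + 2)) by (apply Rmult_lt_0_compat; lra). lra.
  - assert (Hall : forall P : nat -> Prop, (forall k, P k) -> F P).
    { intros P HP. apply (uf_imp F HF) with (1 := uf_tail F HF 0). intros k _. apply HP. }
    exists u, v. split; [exact Ho |].
    assert (Hle : forall x b, (forall k, uk k x <= b) -> u x <= b).
    { intros x b Hb. apply (ultralimit_le F HF (fun k => uk k x)); [apply Lu | apply Hall, Hb]. }
    assert (Hge : forall x b, (forall k, b <= uk k x) -> b <= u x).
    { intros x b Hb. apply (ultralimit_ge F HF (fun k => uk k x)); [apply Lu | apply Hall, Hb]. }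
    split; [| split; [| split]].
    + apply Rle_antisym; [apply Hle | apply Hge]; intros k;
        destruct (HY k) as (_ & E0 & _); unfold uk; lra.
    + apply Rle_antisym; [apply Hle | apply Hge]; intros k;
        destruct (HY k) as (_ & _ & E0 & _); unfold uk; lra.
    + intros x Hx. split; [apply Hge | apply Hle]; intros k;
        destruct (HY k) as (_ & _ & _ & Hk & _); apply Hk, Hx.
    + intros i Hi. unfold hump_word.
      assert (Hw : forall k, hump_word sigma tau r i (word i) (uk k)) by (intros k; apply HY, Hi).
      unfold hump_word in Hw. destruct (word i).
      (* The points where level [r] is attained or exceeded vary with [k]. Their ultralimit [x]
         stays in the hump, and the common Lipschitz constant [B] compares [uk k (xk k)] with
         [uk k x]. *)
      * destruct (functional_choice _ Hw) as [xk Hxk].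
        destruct (ultralimit_exists F xk (Rabs (sigma i) + Rabs (tau i)) HF) as [x Lx].
        { intros k. destruct (Hxk k) as [H _].
          assert (H1 := Rle_abs (- sigma i)). rewrite Rabs_Ropp in H1.
          assert (H2 := Rle_abs (tau i)). assert (H3 := Rabs_pos (sigma i)).
          assert (H4 := Rabs_pos (tau i)). apply Rabs_le_between. lra. }
        exists x. split.
        { split; [apply (ultralimit_ge F HF xk) | apply (ultralimit_le F HF xk)];
            try exact Lx; apply Hall; intros k; apply Hxk. }
        apply Rnot_lt_le. intros Hlt.
        set (e := (r - u x) / 2). assert (He : 0 < e) by (unfold e; lra).
        set (e' := e / (B + 1)). assert (He' : 0 < e') by (apply Rdiv_lt_0_compat; lra).
        destruct (uf_ex F HF _ (uf_and F HF _ _ (Lx e' He') (Lu x e He))) as [k [H1 H2]].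
        assert (H3 := Hlip k (xk k) x). destruct (Hxk k) as [_ H4].
        assert (H5 : B * Rabs (xk k - x) <= e).
        { apply Rle_trans with ((B + 1) * e').
          - assert (H := Rabs_pos (xk k - x)). apply Rmult_le_compat; lra.
          - right. unfold e'. field. lra. }
        apply Rabs_le_between in H3. apply Rabs_def2 in H2. unfold e in *. lra.
      * intros x Hx. apply Hle. intros k. apply Hw, Hx.
Qed.

(** Taking the minimum of [g] with a steep line through [0] gives linear growth, and leaves [g]
    unchanged on [[0, M]] once the line is steep enough. *)
Lemma truncated_nonlinearity (g : R -> R) (q0 r q S M : R) :
  (forall s, 0 <= s -> 0 <= g s) -> continuous_on (fun s => 0 <= s) g -> g 0 = 0 ->
  (forall s, 0 < s -> 0 < g s) -> 0 <= q0 -> 0 < r -> 0 < q -> 0 < S ->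
  (forall s, 0 < s <= r -> g s <= q0 * s) -> (forall s, S <= s -> q * s <= g s) ->
  exists h K, sublinear K h /\ (forall s, continuity_pt h s) /\
    (forall s, 0 <= s <= M -> h s = g s) /\ (forall s, 0 <= s <= r -> h s <= q0 * s) /\
    (forall s, S <= s -> q * s <= h s) /\ (forall s, 0 < s -> 0 < h s).
Proof.
  intros Hg Hgc Hg0 Hgp Hq0 Hr Hq HS Hsmall Hlarge.
  set (gp := fun s => g (Rmax s 0)).
  assert (Hpos : forall s, continuity_pt (fun s => Rmax s 0) s).
  { intros s. apply lipschitz_continuity_pt with 1. apply positive_part_lipschitz. }
  assert (Hgpc : forall s, continuity_pt gp s).
  { intros s. apply continuity_pt_eps. intros eps He.
    destruct (continuous_on_eps (fun s => 0 <= s) g (Rmax s 0) eps Hgc (Rmax_r s 0) He)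
      as [d [Hd Hy]].
    exists d. split; [exact Hd |]. intros y Hyd. apply Hy; [apply Rmax_r |].
    apply Rle_lt_trans with (1 := positive_part_lipschitz y s). rewrite Rmult_1_l. exact Hyd. }
  destruct (continuity_ab_maj gp 0 (Rmax M r)) as [xm [Hxm Hxm0]].
  { apply Rle_trans with (2 := Rmax_r M r). lra. }
  { intros; apply Hgpc. }
  set (G := gp xm) in *.
  assert (HG : 0 <= G) by (apply Hg, Rmax_r).
  (* The summand [q0] puts the line above [g] on [[0, r]], [G / r] does so from [r] to [M], and [q]
     preserves the lower bound [q * s] for large [s]. *)
  set (K := q0 + q + G / r).
  assert (HGr : 0 <= G / r) by (apply Rmult_le_pos; [exact HG | left; apply Rinv_0_lt_compat, Hr]).
  assert (HK : 0 < K) by (unfold K; lra).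
  assert (HKs : forall s, Rmax s 0 * 0 <= Rmax s 0 * K).
  { intros s. apply Rmult_le_compat_l; [apply Rmax_r | lra]. }
  exists (fun s => Rmin (gp s) (K * Rmax s 0)), K.
  assert (Hgps : forall s, 0 <= s -> gp s = g s).
  { intros s Hs. unfold gp. rewrite Rmax_left by lra. reflexivity. }
  split; [| split; [| split; [| split; [| split]]]].
  - intros s. split; [| apply Rmin_r]. apply Rmin_glb; [apply Hg, Rmax_r |].
    specialize (HKs s). lra.
  - intros s. apply continuity_pt_ext with
      (fun s => (gp s + K * Rmax s 0 - Rabs (gp s - K * Rmax s 0)) / 2).
    + intros t. unfold Rmin, Rabs. destruct (Rle_dec (gp t) (K * Rmax t 0)), (Rcase_abs (gp t - K * Rmax t 0)); lra.
    + assert (HKc : continuity_pt (fun s => K * Rmax s 0) s)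
        by (apply (continuity_pt_scal (fun s => Rmax s 0)), Hpos).
      apply continuity_pt_mult; [| apply continuity_pt_const; intros ? ?; reflexivity].
      apply continuity_pt_minus; [apply continuity_pt_plus; [apply Hgpc | exact HKc] |].
      apply (continuity_pt_comp (fun s => gp s - K * Rmax s 0) Rabs);
        [apply continuity_pt_minus; [apply Hgpc | exact HKc] | apply Rcontinuity_abs].
  - intros s Hs. rewrite Hgps, (Rmax_left s) by lra. apply Rmin_left.
    destruct (Rle_lt_dec s r) as [Hsr|Hsr].
    + destruct (Req_dec s 0) as [->|Hne]; [lra |].
      apply Rle_trans with (q0 * s); [apply Hsmall; lra |].
      apply Rmult_le_compat_r; [lra | unfold K; lra].
    + apply Rle_trans with G.
      * rewrite <- Hgps by lra. apply Hxm.
        assert (H := Rmax_l M r). lra.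
      * apply Rle_trans with (G / r * s).
        -- apply Rle_trans with (G / r * r); [right; field; lra | apply Rmult_le_compat_l; lra].
        -- apply Rmult_le_compat_r; [lra | unfold K; lra].
  - intros s Hs. apply Rle_trans with (1 := Rmin_l _ _). rewrite Hgps by lra.
    destruct (Req_dec s 0) as [->|Hne]; [lra | apply Hsmall; lra].
  - intros s Hs. apply Rmin_glb; [rewrite Hgps by lra; apply Hlarge, Hs |].
    rewrite Rmax_left by lra. apply Rmult_le_compat_r; [lra | unfold K; lra].
  - intros s Hs. apply Rmin_pos; [rewrite Hgps by lra; apply Hgp, Hs |].
    rewrite Rmax_left by lra. apply Rmult_lt_0_compat; assumption.
Qed.

Lemma positive_lower_bound (h : R -> R) (q S rho : R) :
  (forall s, continuity_pt h s) -> (forall s, 0 < s -> 0 < h s) -> 0 < rho -> 0 < q -> 0 < S ->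
  (forall s, S <= s -> q * s <= h s) ->
  exists gam, 0 < gam /\ forall s, rho <= s -> gam <= h s.
Proof.
  intros Hc Hp Hrho Hq HS Hl.
  destruct (continuity_ab_min h rho (Rmax rho S)) as [x [Hx Hx']];
    [apply Rmax_l | intros; apply Hc |].
  exists (Rmin (h x) (q * S)). split.
  - apply Rmin_pos; [apply Hp; lra | apply Rmult_lt_0_compat; assumption].
  - intros s Hs. destruct (Rle_lt_dec s (Rmax rho S)) as [H|H].
    + apply Rle_trans with (1 := Rmin_l _ _), Hx. lra.
    + apply Rle_trans with (1 := Rmin_r _ _). assert (HS' := Rmax_r rho S).
      apply Rle_trans with (q * s); [apply Rmult_le_compat_l; lra | apply Hl; lra].
Qed.

(** Inf-convolutions with slopes [D k] tending to infinity. The fixed part [2 * q + gam / rho] of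
    these slopes keeps both lower bounds valid for every [k], at the price of doubled thresholds. *)
Lemma lipschitz_approximation (h : R -> R) (K q S rho gam : R) :
  sublinear K h -> (forall s, continuity_pt h s) -> 0 < q -> 0 < S -> 0 < rho -> 0 < gam ->
  (forall s, S <= s -> q * s <= h s) -> (forall s, rho <= s -> gam <= h s) ->
  exists hk : nat -> R -> R,
    (forall k s, 0 <= hk k s <= h s) /\
    (forall k s, 2 * S <= s -> q * s <= hk k s) /\
    (forall k s, 2 * rho <= s -> gam <= hk k s) /\
    (forall k, exists D, forall s t, Rabs (hk k s - hk k t) <= D * Rabs (s - t)) /\
    (forall s eps, 0 < eps -> exists eta N, 0 < eta /\ forall k t, (N <= k)%nat ->
       Rabs (t - s) < eta -> Rabs (hk k t - h s) < eps).
Proof.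
  intros Hh Hc Hq HS Hrho Hgam Hl Hg.
  set (D := fun k => INR k + (2 * q + gam / rho)).
  assert (Hgr : 0 < gam / rho) by (apply Rdiv_lt_0_compat; assumption).
  assert (HD : forall k, 2 * q <= D k /\ gam / rho <= D k /\ INR k <= D k).
  { intros k. assert (H := pos_INR k). unfold D. lra. }
  destruct (functional_choice (fun k hk => (forall s t, hk s <= h t + D k * Rabs (s - t)) /\
    (forall s m, (forall t, m <= h t + D k * Rabs (s - t)) -> m <= hk s) /\
    (forall s t, Rabs (hk s - hk t) <= D k * Rabs (s - t)))) as [hk Hhk].
  { intros k. apply lipschitz_minorant; [specialize (HD k); lra | apply Hh]. }
  assert (Hle : forall k s, hk k s <= h s).
  { intros k s. assert (H := proj1 (Hhk k) s s). rewrite Rminus_diag, Rabs_R0 in H. lra. }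
  exists hk. split; [| split; [| split; [| split]]].
  - intros k s. split; [| apply Hle]. apply (proj2 (Hhk k)). intros t.
    assert (0 <= D k * Rabs (s - t)) by (apply Rmult_le_pos; [specialize (HD k); lra | apply Rabs_pos]).
    assert (H1 := Hh t). lra.
  - intros k s Hs. apply (proj2 (Hhk k)). intros t. destruct (HD k) as [HDk _].
    assert (Hpos := Rabs_pos (s - t)). assert (Habs := Rle_abs (s - t)).
    destruct (Rle_lt_dec S t) as [Ht|Ht].
    + specialize (Hl t Ht).
      assert (q * (s - t) <= q * Rabs (s - t)) by (apply Rmult_le_compat_l; lra).
      assert (q * Rabs (s - t) <= D k * Rabs (s - t)) by (apply Rmult_le_compat_r; lra). lra.
    (* Here [t < S <= s / 2], so [s - t] exceeds [s / 2] and the penalty of slope at least [2 * q]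
       alone reaches [q * s]. *)
    + assert (H1 := Hh t).
      assert (2 * q * (s / 2) <= D k * Rabs (s - t)) by (apply Rmult_le_compat; lra). lra.
  - intros k s Hs. apply (proj2 (Hhk k)). intros t. destruct (HD k) as [HDk [HDk' _]].
    assert (Hpos := Rabs_pos (s - t)). assert (Habs := Rle_abs (s - t)).
    destruct (Rle_lt_dec rho t) as [Ht|Ht].
    + specialize (Hg t Ht).
      assert (0 <= D k * Rabs (s - t)) by (apply Rmult_le_pos; lra). lra.
    + assert (H1 := Hh t).
      assert (gam / rho * rho <= D k * Rabs (s - t)) by (apply Rmult_le_compat; lra).
      replace (gam / rho * rho) with gam in H by (field; lra). lra.
  - intros k. exists (D k). apply Hhk.
  - intros s eps He.
    destruct (continuity_pt_eps_inv h s (eps / 2) (Hc s) ltac:(lra)) as [d [Hd Hy]].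
    (* For such [k] a competitor at distance at least [d] from [s] is at distance at least [d / 2]
       from [t], and its penalty exceeds [h s]; nearer competitors are controlled by continuity. *)
    destruct (INR_unbounded (h s * (2 / d))) as [N HN].
    exists (d / 2), N. split; [lra |]. intros k t Hk Ht.
    assert (Hys := Hy t ltac:(lra)). apply Rabs_def2 in Hys.
    assert (Hupper := Hle k t).
    assert (Hlower : h s - eps / 2 <= hk k t).
    { apply (proj2 (Hhk k)). intros t'.
      destruct (HD k) as [HDk [_ HDN]].
      assert (Hpos := Rabs_pos (t - t')).
      destruct (Rlt_le_dec (Rabs (t' - s)) d) as [Hn|Hf].
      - specialize (Hy t' Hn). apply Rabs_def2 in Hy.
        assert (0 <= D k * Rabs (t - t')) by (apply Rmult_le_pos; lra). lra.
      - assert (Htri := Rabs_triang (t' - t) (t - s)).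
        replace (t' - t + (t - s)) with (t' - s) in Htri by ring.
        rewrite (Rabs_minus_sym t' t) in Htri.
        assert (HNk : INR N <= INR k) by (apply le_INR, Hk).
        assert (Hhs := proj1 (Hh s)). assert (Hht := proj1 (Hh t')).
        assert (Hd2 : 0 < 2 / d) by (apply Rdiv_lt_0_compat; lra).
        assert (h s * (2 / d) * (d / 2) <= D k * Rabs (t - t')).
        { apply Rmult_le_compat; try lra. apply Rmult_le_pos; lra. }
        replace (h s * (2 / d) * (d / 2)) with (h s) in H by (field; lra). lra. }
    apply Rabs_def1; lra.
Qed.

(** * Uniform estimates *)

Lemma finite_uniform (n : nat) (P : nat -> R -> Prop) :
  (forall i x y, P i x -> x <= y -> P i y) ->
  (forall i, (1 <= i <= n)%nat -> exists x, P i x) ->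
  exists x, forall i, (1 <= i <= n)%nat -> P i x.
Proof.
  intros Hmon. induction n as [|n IH]; intros Hex.
  - exists 0. intros i Hi. lia.
  - destruct IH as [x Hx]; [intros i Hi; apply Hex; lia |].
    destruct (Hex (S n) ltac:(lia)) as [y Hy].
    exists (Rmax x y). intros i Hi. destruct (Nat.eq_dec i (S n)) as [->|Hne].
    + apply Hmon with y; [exact Hy | apply Rmax_r].
    + apply Hmon with x; [apply Hx; lia | apply Rmax_l].
Qed.

Lemma LimSup_lt_bound (F : (R -> Prop) -> Prop) (f : R -> R) (l : R) :
  Rbar_lt (LimSup F f) (Finite l) ->
  exists A m, F A /\ m < l /\ forall s, A s -> f s <= m.
Proof.
  intros H.
  assert (HA : exists A, F A /\ Rbar_lt (Lub_Rbar (fun z => exists s, A s /\ z = f s)) (Finite l)).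
  { apply NNPP. intros Hn. apply (Rbar_lt_not_le _ _ H). unfold LimSup, Rbar_glb.
    match goal with |- Rbar_le _ (proj1_sig ?e) => destruct (proj2_sig e) as [_ Hy] end.
    apply Hy. intros z [A [HA ->]]. apply Rbar_not_lt_le. intros Hlt.
    apply Hn. exists A. split; assumption. }
  destruct HA as [A [HA Hlt]].
  assert (Hub := proj1 (Lub_Rbar_correct (fun z => exists s, A s /\ z = f s))).
  destruct (Lub_Rbar (fun z => exists s, A s /\ z = f s)) as [m| |].
  - exists A, m. split; [exact HA |]. split; [exact Hlt |].
    intros s Hs. apply (Hub (f s)). exists s. auto.
  - destruct Hlt.
  (* The supremum is minus infinity only if [A] is empty, and then any number below [l] serves. *)
  - exists A, (l - 1). split; [exact HA |]. split; [lra |].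
    intros s Hs. destruct (Hub (f s)). exists s. auto.
Qed.

Lemma LimInf_gt_bound (F : (R -> Prop) -> Prop) (f : R -> R) (l : R) :
  Rbar_lt (Finite l) (LimInf F f) ->
  exists A m, F A /\ l < m /\ forall s, A s -> m <= f s.
Proof.
  intros H.
  assert (HA : exists A, F A /\ Rbar_lt (Finite l) (Glb_Rbar (fun z => exists s, A s /\ z = f s))).
  { apply NNPP. intros Hn. apply (Rbar_lt_not_le _ _ H). unfold LimInf, Rbar_lub.
    match goal with |- Rbar_le (proj1_sig ?e) _ => destruct (proj2_sig e) as [_ Hy] end.
    apply Hy. intros z [A [HA ->]]. apply Rbar_not_lt_le. intros Hlt.
    apply Hn. exists A. split; assumption. }
  destruct HA as [A [HA Hlt]].
  assert (Hlb := proj1 (Glb_Rbar_correct (fun z => exists s, A s /\ z = f s))).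
  destruct (Glb_Rbar (fun z => exists s, A s /\ z = f s)) as [m| |].
  - exists A, m. split; [exact HA |]. split; [exact Hlt |].
    intros s Hs. apply (Hlb (f s)). exists s. auto.
  (* The infimum is plus infinity only if [A] is empty, and then any number above [l] serves. *)
  - exists A, (l + 1). split; [exact HA |]. split; [lra |].
    intros s Hs. destruct (Hlb (f s)). exists s. auto.
  - destruct Hlt.
Qed.

(** A further zero of [a] close to [x] would make the difference quotient vanish, against the
    nonzero derivative. Hence the weight is strictly negative at points arbitrarily near the hump,
    where a large [mu] is to act. *)
Lemma simple_zero_right (a : R -> R) (x b d : R) :
  simple_zero a x -> x < b -> (forall y, x <= y <= b -> a y <= 0) -> 0 < d ->
  exists y, x < y < x + d /\ y <= b /\ a y < 0.
Proof.
  intros [E0 [l [Hl Hl0]]] Hb Ha Hd. apply is_derive_Reals in Hl.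
  destruct (Hl (Rabs l) (Rabs_pos_lt l Hl0)) as [e He]. assert (He0 := cond_pos e).
  set (t := Rmin (b - x) (Rmin (d / 2) (e / 2))).
  assert (Ht : 0 < t) by (repeat apply Rmin_pos; lra).
  assert (Ht1 : t <= b - x) by apply Rmin_l.
  assert (Ht2 : t <= d / 2) by (apply Rle_trans with (1 := Rmin_r _ _), Rmin_l).
  assert (Ht3 : t <= e / 2) by (apply Rle_trans with (1 := Rmin_r _ _), Rmin_r).
  exists (x + t). split; [lra |]. split; [lra |].
  destruct (Ha (x + t) ltac:(lra)) as [|Ez]; [assumption | exfalso].
  specialize (He t ltac:(lra)). rewrite (Rabs_right t) in He by lra. specialize (He ltac:(lra)).
  rewrite Ez, E0, Rminus_diag in He. unfold Rdiv in He.
  rewrite Rmult_0_l, Rminus_0_l, Rabs_Ropp in He. lra.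
Qed.

Lemma simple_zero_left (a : R -> R) (x b d : R) :
  simple_zero a x -> b < x -> (forall y, b <= y <= x -> a y <= 0) -> 0 < d ->
  exists y, x - d < y < x /\ b <= y /\ a y < 0.
Proof.
  intros [E0 [l [Hl Hl0]]] Hb Ha Hd.
  destruct (simple_zero_right (fun y => a (- y)) (- x) (- b) d) as [y [Hy1 [Hy2 Hy3]]].
  - split; [rewrite Ropp_involutive; exact E0 |].
    exists (- l). split; [| lra].
    replace (- l) with (scal (-1) l) by (unfold scal; simpl; unfold mult; simpl; ring).
    apply (is_derive_comp a (fun x => - x)); [rewrite Ropp_involutive; exact Hl |].
    auto_derive; [exact I | ring].
  - lra.
  - intros y Hy. apply Ha. lra.
  - exact Hd.
  - exists (- y). repeat split; lra.
Qed.

(** * Estimates and approximate solutions for the weight [w - mu * N] *)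

Section Weight.
Variables (n : nat) (sigma tau : nat -> R) (L : R).
Hypotheses (Hn : (1 <= n)%nat) (Hs1 : sigma 1%nat = 0) (HtL : tau n = L)
  (Hst : forall i, (1 <= i <= n)%nat -> sigma i < tau i)
  (Hts : forall i, (1 <= i < n)%nat -> tau i < sigma (S i)).
Variables (w N : R -> R) (C : R).
Hypotheses (Hwc : forall x, continuity_pt w x) (HNc : forall x, continuity_pt N x)
  (Hw : forall x, 0 <= w x <= C) (HN : forall x, 0 <= N x <= C)
  (Hhump : forall i x, (1 <= i <= n)%nat -> sigma i <= x <= tau i -> N x = 0)
  (Hgap : forall i x, (1 <= i < n)%nat -> tau i <= x <= sigma (S i) -> w x = 0)
  (Hright : forall i d, (1 <= i < n)%nat -> 0 < d -> exists y, tau i < y < tau i + d /\ 0 < N y)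
  (Hleft : forall i d, (1 <= i < n)%nat -> 0 < d ->
     exists y, sigma (S i) - d < y < sigma (S i) /\ 0 < N y).

Let bounds := partition_bounds n sigma tau L Hn Hs1 HtL Hst Hts.

Definition weight_mu (mu x : R) : R := w x - mu * N x.

Lemma weight_mu_hump (mu : R) (i : nat) (x : R) :
  (1 <= i <= n)%nat -> sigma i <= x <= tau i -> weight_mu mu x = w x.
Proof. intros Hi Hx. unfold weight_mu. rewrite (Hhump i x Hi Hx). ring. Qed.

Lemma weight_mu_gap (mu : R) (i : nat) (x : R) :
  (1 <= i < n)%nat -> tau i <= x <= sigma (S i) -> weight_mu mu x = - (mu * N x).
Proof. intros Hi Hx. unfold weight_mu. rewrite (Hgap i x Hi Hx). ring. Qed.

Lemma weight_mu_bound (mu x : R) : 0 <= mu -> Rabs (weight_mu mu x) <= C + mu * C.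
Proof.
  intros Hmu. specialize (Hw x). specialize (HN x). unfold weight_mu.
  assert (0 <= mu * N x <= mu * C)
    by (split; [apply Rmult_le_pos; lra | apply Rmult_le_compat_l; lra]).
  apply Rabs_le_between. assert (0 <= mu * C) by lra. lra.
Qed.

Lemma weight_mu_continuity (mu x : R) : continuity_pt (weight_mu mu) x.
Proof.
  apply continuity_pt_minus; [apply Hwc |]. apply (continuity_pt_scal N), HNc.
Qed.

(** All constants are uniform in the nonlinearity, so that the estimates apply both to
    the Lipschitz approximations and to their limit. *)
Lemma uniform_estimates (lam0 q0 q r S0 : R) (lam1 : nat -> R) :
  0 < L -> is_first_eigenvalue w 0 L lam0 -> 0 <= q0 < lam0 -> 0 < r -> 0 < S0 ->
  (forall i, (1 <= i <= n)%nat -> is_eigenvalue w (sigma i) (tau i) (lam1 i) /\ 0 <= lam1 i < q) ->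
  exists M rho, r < M /\ 0 < rho /\ forall gam, 0 < gam ->
    exists mustar, 0 < mustar /\ forall mu h K, mustar < mu ->
      sublinear K h -> (forall s, 0 <= s <= r -> h s <= q0 * s) ->
      (forall s, S0 <= s -> q * s <= h s) -> (forall s, rho <= s -> gam <= h s) ->
      (forall i u v, (1 <= i <= n)%nat -> ode (weight_mu mu) h u v ->
         (forall x, sigma i <= x <= tau i -> 0 <= u x) ->
         forall x, sigma i <= x <= tau i -> u x < M) /\
      (forall i u v xi, (1 <= i <= n)%nat -> ode (weight_mu mu) h u v -> u 0 = 0 ->
         (forall x, 0 <= x <= sigma i -> 0 <= u x) ->
         (forall x, sigma i <= x <= tau i -> u x <= r) ->
         sigma i <= xi <= tau i -> u xi = r ->
         if (i <? n)%nat then M <= u (sigma (S i)) else 0 < u L).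
Proof.
  intros HL Hlam0 Hq0 Hr HS0 Hlam1.
  destruct (finite_uniform n (fun i M => forall c h u v K,
    sublinear K h -> (forall s, S0 <= s -> q * s <= h s) -> ode c h u v ->
    (forall x, sigma i <= x <= tau i -> c x = w x) ->
    (forall x, sigma i <= x <= tau i -> 0 <= u x) ->
    forall x, sigma i <= x <= tau i -> u x < M)) as [M0 HM0].
  { intros i x y H Hxy c h u v K H1 H2 H3 H4 H5 t Ht.
    apply Rlt_le_trans with (2 := Hxy). apply (H c h u v K); assumption. }
  { intros i Hi. destruct (Hlam1 i Hi) as [Hev Hlq].
    destruct (hump_bound w (sigma i) (tau i) (lam1 i) q S0) as [M HM];
      [apply Hst, Hi | exact Hwc | intros; apply Hw | exact Hev | exact Hlq | lra |].
    exists M. exact HM. }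
  set (M := Rmax M0 (r + 1)).
  assert (HMr : r + 1 <= M) by apply Rmax_r. assert (HMM0 : M0 <= M) by apply Rmax_l.
  destruct (small_hump w L q0 lam0 C r HL Hwc Hw Hlam0 Hq0 Hr)
    as (eps & kap & Heps & Hkap & Hsmall).
  (* The solution is known to exceed [eps / 2] just before a hump and [kap / 2] just after one, and
     [h] has to be at least [gam] at such values. *)
  set (rho := Rmin eps kap / 2).
  assert (Hrho1 : rho <= eps / 2) by (assert (H := Rmin_l eps kap); unfold rho; lra).
  assert (Hrho2 : rho <= kap / 2) by (assert (H := Rmin_r eps kap); unfold rho; lra).
  assert (Hrho : 0 < rho) by (assert (H := Rmin_pos eps kap Heps Hkap); unfold rho; lra).
  (* [M] and [rho] are fixed before [gam], because [gam] is a lower bound for a nonlinearity that is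
     truncated only once [M] is known. *)
  exists M, rho. split; [lra |]. split; [exact Hrho |]. intros gam Hgam.
  destruct (finite_uniform n (fun i m => (i < n)%nat -> forall mu c h u v K, m < mu ->
    sublinear K h -> ode c h u v ->
    (forall s, 0 <= s <= r -> h s <= q0 * s) -> (forall s, rho <= s -> gam <= h s) ->
    (forall x, tau i <= x <= sigma (S i) -> c x = - (mu * N x)) ->
    (forall x, sigma (S i) <= x <= tau (S i) -> 0 <= c x <= C) ->
    (forall x, tau i <= x <= sigma (S i) -> 0 <= u x) -> u (tau i) <= M ->
    (forall x, sigma (S i) <= x <= tau (S i) -> u x <= r) -> u (sigma (S i)) <= eps))
    as [m1 Hm1].
  { intros i x y H Hxy Hin mu c h u v K Hmu. apply H; [exact Hin | lra]. }
  { intros i Hi. destruct (Nat.lt_ge_cases i n) as [Hin|Hin].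
    - destruct (small_entry N (tau i) (sigma (S i)) (tau (S i)) C q0 r M eps rho gam)
        as [m [_ Hm]]; try assumption; try lra.
      + apply Hts. lia.
      + apply Hst. lia.
      + intros x. apply HN.
      + intros d Hd. apply Hleft; [lia | exact Hd].
      + exists m. intros _. exact Hm.
    - exists 0. intros H. lia. }
  destruct (finite_uniform n (fun i m => (i < n)%nat -> forall mu c h u v K, m < mu ->
    sublinear K h -> ode c h u v ->
    (forall s, 0 <= s <= r -> h s <= q0 * s) -> (forall s, rho <= s -> gam <= h s) ->
    (forall x, tau i <= x <= sigma (S i) -> c x = - (mu * N x)) ->
    (forall x, sigma i <= x <= tau i -> 0 <= c x <= C) ->
    0 <= u (sigma i) -> kap <= u (tau i) ->
    (forall x, sigma i <= x <= tau i -> u x <= r) -> M <= u (sigma (S i))))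
    as [m2 Hm2].
  { intros i x y H Hxy Hin mu c h u v K Hmu. apply H; [exact Hin | lra]. }
  { intros i Hi. destruct (Nat.lt_ge_cases i n) as [Hin|Hin].
    - destruct (large_exit N (sigma i) (tau i) (sigma (S i)) C q0 r M kap rho gam)
        as [m [_ Hm]]; try assumption; try lra.
      + apply Hst. lia.
      + apply Hts. lia.
      + intros x. apply HN.
      + intros d Hd. apply Hright; [lia | exact Hd].
      + exists m. intros _. exact Hm.
    - exists 0. intros H. lia. }
  set (ms := Rmax 1 (Rmax m1 m2)).
  assert (Hms0 : 1 <= ms) by apply Rmax_l.
  assert (Hms1 : m1 <= ms) by (apply Rle_trans with (2 := Rmax_r _ _), Rmax_l).
  assert (Hms2 : m2 <= ms) by (apply Rle_trans with (2 := Rmax_r _ _), Rmax_r).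
  exists ms. split; [lra |].
  intros mu h K Hmu Hh Hhq0 Hhq Hhg.
  assert (Hcp : forall i x, (1 <= i <= n)%nat -> sigma i <= x <= tau i -> 0 <= weight_mu mu x <= C).
  { intros i x Hi Hx. rewrite (weight_mu_hump mu i x Hi Hx). apply Hw. }
  assert (Hbd : forall i u v, (1 <= i <= n)%nat -> ode (weight_mu mu) h u v ->
         (forall x, sigma i <= x <= tau i -> 0 <= u x) ->
         forall x, sigma i <= x <= tau i -> u x < M).
  { intros i u v Hi Ho Hu x Hx. apply Rlt_le_trans with (2 := HMM0).
    apply (HM0 i Hi (weight_mu mu) h u v K); try assumption.
    intros t Ht. apply weight_mu_hump with i; assumption. }
  split; [exact Hbd |].
  intros i u v xi Hi Ho E0 Hu Hur Hxi Exi.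
  destruct (bounds i Hi) as [Hsi Hti]. assert (Hsti := Hst i Hi).
  assert (Husig : 0 <= u (sigma i)) by (apply Hu; lra).
  (* On the first hump [u] starts from [0]; for a later one the preceding hump provides [u <= M] at
     the start of the gap, as [small_entry] demands. *)
  assert (Huse : u (sigma i) <= eps).
  { destruct i as [|[|j]]; [lia | rewrite Hs1, E0; lra |].
    destruct (bounds (S j) ltac:(lia)) as [Hsj _]. assert (Hstj := Hst (S j) ltac:(lia)).
    assert (Htsj := Hts (S j) ltac:(lia)).
    apply (Hm1 (S j) ltac:(lia) ltac:(lia) mu (weight_mu mu) h u v K); try assumption.
    - lra.
    - intros x Hx. apply weight_mu_gap with (S j); [lia | exact Hx].
    - intros x Hx. apply (Hcp (S (S j))); assumption.
    - intros x Hx. apply Hu. lra.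
    - left. apply (Hbd (S j) u v); [lia | exact Ho | | lra].
      intros x Hx. apply Hu. lra. }
  assert (Hkt : kap <= u (tau i)).
  { apply (Hsmall (sigma i) (tau i) (weight_mu mu) h u v K (C + mu * C) xi); try assumption.
    - intros x. apply weight_mu_bound. lra.
    - intros x Hx. apply weight_mu_hump with i; assumption.
    - lra. }
  destruct (Nat.ltb_spec i n) as [Hin|Hin].
  - apply (Hm2 i Hi Hin mu (weight_mu mu) h u v K); try assumption.
    + lra.
    + intros x Hx. apply weight_mu_gap with i; [lia | exact Hx].
    + intros x Hx. apply (Hcp i); assumption.
  - replace i with n in Hkt by lia. rewrite HtL in Hkt. lra.
Qed.

Lemma lipschitz_solution (mu K r M D : R) (h : R -> R) (word : nat -> bool) :
  0 <= mu -> sublinear K h -> (forall s t, Rabs (h s - h t) <= D * Rabs (s - t)) ->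
  0 < r < M ->
  (forall i u v, (1 <= i <= n)%nat -> ode (weight_mu mu) h u v ->
     (forall x, sigma i <= x <= tau i -> 0 <= u x) ->
     forall x, sigma i <= x <= tau i -> u x < M) ->
  (forall i u v xi, (1 <= i <= n)%nat -> ode (weight_mu mu) h u v -> u 0 = 0 ->
     (forall x, 0 <= x <= sigma i -> 0 <= u x) ->
     (forall x, sigma i <= x <= tau i -> u x <= r) ->
     sigma i <= xi <= tau i -> u xi = r ->
     if (i <? n)%nat then M <= u (sigma (S i)) else 0 < u L) ->
  exists u v, ode (weight_mu mu) h u v /\ u 0 = 0 /\ u L = 0 /\
     (forall x, 0 <= x <= L -> 0 <= u x <= M) /\
     forall i, (1 <= i <= n)%nat -> hump_word sigma tau r i (word i) u.
Proof.
  intros Hmu Hh Hlip HrM Hbd Hcr.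
  set (c := weight_mu mu). set (Cc := C + mu * C).
  assert (HCc : forall x, Rabs (c x) <= Cc) by (intros; apply weight_mu_bound, Hmu).
  assert (Hcc : forall x, continuity_pt c x) by apply weight_mu_continuity.
  destruct (picard_constants c h Cc D HCc Hlip) as [HCc0 HD0].
  assert (HK := sublinear_const K h Hh).
  destruct (functional_choice (fun s (y : (R -> R) * (R -> R)) =>
     ode c h (fst y) (snd y) /\ fst y 0 = 0 /\ snd y 0 = s)) as [Y HY].
  { intros s. destruct (ivp_exists c h Cc D Hcc HCc Hlip 0 s) as (u & v & H).
    exists (u, v). exact H. }
  set (U := fun s => fst (Y s)). set (V := fun s => snd (Y s)).
  assert (HUV : forall s, ode c h (U s) (V s)) by (intros s; apply HY).
  assert (HU0 : forall s, U s 0 = 0) by (intros s; apply HY).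
  assert (HV0 : forall s, V s 0 = s) by (intros s; apply HY).
  set (eY := exp ((1 + 2 * (Cc * D)) * L)).
  assert (HL : 0 < L).
  { destruct (bounds 1%nat ltac:(lia)) as [H1 H2]. assert (H3 := Hst 1%nat ltac:(lia)). lra. }
  assert (HCD : 0 <= Cc * D) by (apply Rmult_le_pos; assumption).
  assert (HDL : forall s t x, 0 <= x <= L -> Rabs (U s x - U t x) <= eY * Rabs (s - t)).
  { intros s t x Hx.
    assert (Hdep := ode_dependence c c h (U s) (V s) (U t) (V t) Cc D 0 x
      ltac:(lra) ltac:(lra) HCc Hlip (HUV s) (HUV t)).
    rewrite !HU0, !HV0, Rminus_diag in Hdep.
    assert (Hx0 : 0 <= (1 + 2 * (Cc * D)) * x) by (apply Rmult_le_pos; lra).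
    apply Rle_trans with (Rabs (s - t) * exp ((1 + 2 * (Cc * D)) * x)).
    - apply Rabs_le_of_pow2_exp; [apply Rabs_pos | exact Hx0 |].
      rewrite pow2_abs.
      replace (0 ^ 2 + (s - t) ^ 2 + 0 ^ 2) with ((s - t) ^ 2) in Hdep by ring.
      apply Hdep. intros y Hy. rewrite Rminus_diag, Rmult_0_l, Rabs_R0. lra.
    - rewrite Rmult_comm. apply Rmult_le_compat_r; [apply Rabs_pos |]. unfold eY.
      assert (Hle : (1 + 2 * (Cc * D)) * x <= (1 + 2 * (Cc * D)) * L)
        by (apply Rmult_le_compat_l; lra).
      destruct Hle as [Hlt|Heq]; [left; apply exp_increasing, Hlt | rewrite Heq; lra]. }
  set (l := tau 1%nat).
  assert (Hl : 0 < l) by (assert (H := Hst 1%nat ltac:(lia)); unfold l; lra).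
  assert (HKM : 0 <= Cc * (K * M)) by (apply Rmult_le_pos; [lra | apply Rmult_le_pos; lra]).
  (* While [u] stays below [M] on the first hump, its slope decreases by at most [Cc * (K * M) * l];
     the remaining slope [M / l] suffices to reach [M] at [l]. *)
  set (s0 := Cc * (K * M) * l + M / l).
  assert (Hs0 : exists x, sigma 1%nat <= x <= tau 1%nat /\ M <= U s0 x).
  { apply NNPP. intros Hno. rewrite Hs1 in Hno. fold l in Hno.
    assert (HuM : forall x, 0 <= x <= l -> U s0 x < M).
    { intros x Hx. apply Rnot_le_lt. intros Hle. apply Hno. exists x. auto. }
    assert (HVl : forall x, 0 <= x <= l -> M / l <= V s0 x).
    { intros x Hx.
      assert (H := MVT_lower (V s0) (fun x => - (c x * h (U s0 x))) 0 x (- (Cc * (K * M)))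
        ltac:(lra) (fun t _ => proj2 (HUV s0 t))).
      assert (H' : - (Cc * (K * M)) * (x - 0) <= V s0 x - V s0 0).
      { apply H. intros t Ht. apply Ropp_le_contravar.
        apply Rle_trans with (1 := Rle_abs _). rewrite Rabs_mult.
        apply Rmult_le_compat; try apply Rabs_pos; [apply HCc |].
        assert (Hht := Hh (U s0 t)). rewrite Rabs_right by lra.
        apply Rle_trans with (1 := proj2 Hht), Rmult_le_compat_l; [exact HK |].
        apply Rmax_lub; [left; apply HuM; lra | lra]. }
      rewrite HV0 in H'. unfold s0 in H' at 2.
      assert (Cc * (K * M) * x <= Cc * (K * M) * l) by (apply Rmult_le_compat_l; lra). lra. }
    assert (H := MVT_lower (U s0) (V s0) 0 l (M / l) ltac:(lra) (fun t _ => proj1 (HUV s0 t)) HVl).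
    rewrite HU0, !Rminus_0_r in H. replace (M / l * l) with M in H by (field; lra).
    specialize (HuM l ltac:(lra)). lra. }
  assert (Hneg : forall i x, (1 <= i < n)%nat -> tau i <= x <= sigma (S i) -> c x <= 0).
  { intros i x Hi Hx. unfold c. rewrite (weight_mu_gap mu i x Hi Hx).
    assert (0 <= mu * N x) by (apply Rmult_le_pos; [exact Hmu | apply HN]). lra. }
  destruct (shooting_solution n sigma tau L Hn Hs1 HtL Hst Hts c h K Cc r M Hh HCc
    (proj2 HrM) (proj1 HrM) Hbd Hcr U V eY s0 HUV HU0 HV0 HDL Hs0 word)
    as (s & EL & Hnn & Hword).
  exists (U s), (V s). split; [apply HUV |]. split; [apply HU0 |]. split; [exact EL |].
  split; [| exact Hword].
  intros x Hx. split; [apply Hnn, Hx |].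
  apply (nonneg_solution_bound n sigma tau L Hn Hs1 HtL Hst Hts c h K M Hh Hbd Hneg
    (U s) (V s) (HUV s) Hnn x Hx).
Qed.

End Weight.

(** * Coding of the words by integers, and the conclusion *)

(** Hump [i] reads the binary digit [i - 1] of [S k]. The successor shifts the codes to
    [1, ..., 2^n - 1], which leaves out [0], the word without large humps. *)
Lemma testbit_separates (n j k : nat) :
  (j < 2 ^ n - 1)%nat -> (k < 2 ^ n - 1)%nat -> j <> k ->
  exists i, (1 <= i <= n)%nat /\ Nat.testbit (S j) (i - 1) <> Nat.testbit (S k) (i - 1).
Proof.
  intros Hj Hk Hne. apply NNPP. intros Hno. apply Hne.
  assert (E : S j = S k); [| lia]. apply Nat.bits_inj. intros i.
  destruct (Nat.lt_ge_cases i n) as [Hi|Hi].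
  - destruct (Bool.bool_dec (Nat.testbit (S j) i) (Nat.testbit (S k) i)) as [|Hb]; [assumption |].
    exfalso. apply Hno. exists (S i). split; [lia |].
    replace (S i - 1)%nat with i by lia. exact Hb.
  - assert (Hhigh : forall m, (S m < 2 ^ n)%nat -> Nat.testbit (S m) i = false).
    { intros m Hm. apply Nat.bits_above_log2.
      apply Nat.lt_le_trans with (2 := Hi). apply Nat.log2_lt_pow2; lia. }
    rewrite !Hhigh by lia. reflexivity.
Qed.

Lemma testbit_nonzero (n k : nat) :
  (k < 2 ^ n - 1)%nat -> exists i, (1 <= i <= n)%nat /\ Nat.testbit (S k) (i - 1) = true.
Proof.
  intros Hk. exists (S (Nat.log2 (S k))). split.
  - assert (Nat.log2 (S k) < n)%nat by (apply Nat.log2_lt_pow2; lia). lia.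
  - replace (S (Nat.log2 (S k)) - 1)%nat with (Nat.log2 (S k)) by lia.
    apply Nat.bit_log2. lia.
Qed.

Theorem theorem1p1 :
  forall (n : nat) (L : R) (a : R -> R) (sigma tau : nat -> R)
         (g : R -> R) (lambda0 : R) (lambda1 : nat -> R),
    (1 <= n)%nat ->
    0 < L ->
    continuous_on (Icc 0 L) a ->
    sigma 1%nat = 0 ->
    tau n = L ->
    (forall i, (1 <= i <= n)%nat -> sigma i < tau i) ->
    (forall i, (1 <= i < n)%nat -> tau i < sigma (i + 1)%nat) ->
    (forall i, (1 <= i < n)%nat ->
       simple_zero a (tau i) /\ simple_zero a (sigma (i + 1)%nat)) ->
    (forall i, (1 <= i <= n)%nat ->
       forall x, Icc (sigma i) (tau i) x -> 0 <= a x) ->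
    (forall i, (1 <= i < n)%nat ->
       forall x, Icc (tau i) (sigma (i + 1)%nat) x -> a x <= 0) ->
    (exists x, Icc 0 L x /\ a x <> 0) ->
    (forall s, 0 <= s -> 0 <= g s) ->
    continuous_on (fun s => 0 <= s) g ->
    g 0 = 0 ->
    (forall s, 0 < s -> 0 < g s) ->
    is_first_eigenvalue (pos_part a) 0 L lambda0 ->
    (forall i, (1 <= i <= n)%nat ->
       is_first_eigenvalue (pos_part a) (sigma i) (tau i) (lambda1 i)) ->
    Rbar_lt (LimSup (at_right 0) (fun s => g s / s)) (Finite lambda0) ->
    Rbar_lt (Finite (MaxRlist (map lambda1 (seq 1 n))))
            (LimInf (Rbar_locally p_infty) (fun s => g s / s)) ->
    exists mustar : R, 0 < mustar /\
      forall mu, mustar < mu ->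
        at_least (2 ^ n - 1) (Icc 0 L)
          (positive_solution
             (fun x => pos_part a x - mu * neg_part a x) g L).
Proof.
  intros n L a sigma tau g lambda0 lambda1 Hn HL Hac Hs1 HtL Hst Hts Hsz Hap Han _ Hg Hgc Hg0
    Hgp Hlam0 Hlam1 Hsup Hinf.
  assert (Hts' : forall i, (1 <= i < n)%nat -> tau i < sigma (S i)).
  { intros i Hi. rewrite <- Nat.add_1_r. apply Hts, Hi. }
  assert (Hpart := partition_bounds n sigma tau L Hn Hs1 HtL Hst Hts').
  (* [a] is known only on [[0, L]]; its constant extension is continuous on the line, and the
     eigenvalue data carry over because they only involve the interval. *)
  set (A := fun x => a (clamp 0 L x)).
  assert (HA : forall x, 0 <= x <= L -> A x = a x).
  { intros x Hx. unfold A. rewrite clamp_id by exact Hx. reflexivity. }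
  assert (HAc : forall x, continuity_pt A x).
  { apply (continuity_clamp a); [lra |]. intros x Hx eps He.
    apply (continuous_on_eps (Icc 0 L)); assumption. }
  assert (Hpc : forall s, continuity_pt (fun s => Rmax s 0) s).
  { intros s. apply lipschitz_continuity_pt with 1. apply positive_part_lipschitz. }
  set (w := pos_part A). set (N := neg_part A).
  assert (Hwc : forall x, continuity_pt w x).
  { intros x. apply (continuity_pt_comp A (fun s => Rmax s 0)); [apply HAc | apply Hpc]. }
  assert (HNc : forall x, continuity_pt N x).
  { intros x. apply (continuity_pt_comp (fun x => - A x) (fun s => Rmax s 0)); [| apply Hpc].
    apply continuity_pt_opp, HAc. }
  assert (Hw0 : forall x, 0 <= w x) by (intros x; apply Rmax_r).
  assert (HN0 : forall x, 0 <= N x) by (intros x; apply Rmax_r).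
  destruct (continuity_ab_maj (fun x => w x + N x) 0 L) as [xm [Hxm _]].
  { lra. } { intros x _. apply continuity_pt_plus; [apply Hwc | apply HNc]. }
  set (C := w xm + N xm) in *.
  assert (HwN : forall x, w x + N x <= C).
  { intros x. specialize (Hxm (clamp 0 L x) (clamp_Icc 0 L x ltac:(lra))). simpl in Hxm.
    unfold w, N, pos_part, neg_part, A in Hxm.
    rewrite (clamp_id 0 L (clamp 0 L x)) in Hxm by (apply clamp_Icc; lra). exact Hxm. }
  assert (Hw : forall x, 0 <= w x <= C)
    by (intros x; specialize (Hw0 x); specialize (HN0 x); specialize (HwN x); lra).
  assert (HN : forall x, 0 <= N x <= C)
    by (intros x; specialize (Hw0 x); specialize (HN0 x); specialize (HwN x); lra).
  assert (Hhump : forall i x, (1 <= i <= n)%nat -> sigma i <= x <= tau i -> N x = 0).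
  { intros i x Hi Hx. destruct (Hpart i Hi). unfold N, neg_part. rewrite HA by lra.
    apply Rmax_right. specialize (Hap i Hi x Hx). lra. }
  assert (Hgapb : forall i, (1 <= i < n)%nat -> 0 <= tau i /\ sigma (S i) <= L).
  { intros i Hi. destruct (Hpart i ltac:(lia)). destruct (Hpart (S i) ltac:(lia)).
    assert (H3 := Hst i ltac:(lia)). assert (H4 := Hst (S i) ltac:(lia)). lra. }
  assert (Han' : forall i x, (1 <= i < n)%nat -> tau i <= x <= sigma (S i) -> a x <= 0).
  { intros i x Hi Hx. rewrite <- Nat.add_1_r in Hx. apply (Han i Hi x Hx). }
  assert (Hgap : forall i x, (1 <= i < n)%nat -> tau i <= x <= sigma (S i) -> w x = 0).
  { intros i x Hi Hx. destruct (Hgapb i Hi). unfold w, pos_part. rewrite HA by lra.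
    apply Rmax_right. apply (Han' i x Hi Hx). }
  assert (HNpos : forall y, 0 <= y <= L -> a y < 0 -> 0 < N y).
  { intros y Hy Hay. unfold N, neg_part. rewrite HA by exact Hy.
    apply Rlt_le_trans with (2 := Rmax_l _ _). lra. }
  assert (Hright : forall i d, (1 <= i < n)%nat -> 0 < d ->
     exists y, tau i < y < tau i + d /\ 0 < N y).
  { intros i d Hi Hd. destruct (Hgapb i Hi).
    destruct (simple_zero_right a (tau i) (sigma (S i)) d) as [y [Hy1 [Hy2 Hy3]]].
    - apply Hsz, Hi.
    - apply Hts', Hi.
    - intros y Hy. apply (Han' i y Hi Hy).
    - exact Hd.
    - exists y. split; [exact Hy1 | apply HNpos; [lra | exact Hy3]]. }
  assert (Hleft : forall i d, (1 <= i < n)%nat -> 0 < d ->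
     exists y, sigma (S i) - d < y < sigma (S i) /\ 0 < N y).
  { intros i d Hi Hd. destruct (Hgapb i Hi).
    destruct (simple_zero_left a (sigma (S i)) (tau i) d) as [y [Hy1 [Hy2 Hy3]]].
    - rewrite <- Nat.add_1_r. apply Hsz, Hi.
    - apply Hts', Hi.
    - intros y Hy. apply (Han' i y Hi Hy).
    - exact Hd.
    - exists y. split; [exact Hy1 | apply HNpos; [lra | exact Hy3]]. }
  assert (Hwa : forall x, 0 <= x <= L -> pos_part a x = w x).
  { intros x Hx. unfold w, pos_part. rewrite HA by exact Hx. reflexivity. }
  assert (Hlam0w : is_first_eigenvalue w 0 L lambda0).
  { destruct Hlam0 as [H1 [H2 H3]]. split; [exact H1 |]. split.
    - apply (is_eigenvalue_ext (pos_part a)); assumption.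
    - intros nu Hnu Hev. apply H3; [exact Hnu |].
      apply (is_eigenvalue_ext w); [| exact Hev]. intros x Hx. symmetry. apply Hwa, Hx. }
  destruct (LimSup_lt_bound _ _ _ Hsup) as (B0 & m0 & [d0 Hd0] & Hm0 & HB0).
  destruct (LimInf_gt_bound _ _ _ Hinf) as (B1 & q & [X HX] & Hq & HB1).
  set (q0 := Rmax m0 0). set (r := d0 / 2). set (T := Rmax X 0 + 1).
  assert (Hd0p := cond_pos d0).
  assert (Hr : 0 < r) by (unfold r; lra).
  assert (Hq0 : 0 <= q0 < lambda0).
  { split; [apply Rmax_r |]. apply Rmax_lub_lt; [exact Hm0 | apply Hlam0]. }
  assert (HT : 0 < T /\ X < T).
  { assert (H1 := Rmax_l X 0). assert (H2 := Rmax_r X 0). unfold T. lra. }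
  assert (Hgsmall : forall s, 0 < s <= r -> g s <= q0 * s).
  { intros s Hs.
    assert (H : g s / s <= q0).
    { apply Rle_trans with (2 := Rmax_l m0 0). apply HB0, Hd0; [| lra].
      unfold ball; simpl. unfold AbsRing_ball, abs, minus, plus, opp; simpl.
      rewrite Ropp_0, Rplus_0_r, Rabs_right by lra. unfold r in Hs. lra. }
    apply Rmult_le_compat_r with (r := s) in H; [| lra].
    replace (g s / s * s) with (g s) in H by (field; lra). exact H. }
  assert (Hglarge : forall s, T <= s -> q * s <= g s).
  { intros s Hs.
    assert (H : q <= g s / s) by (apply HB1, HX; lra).
    apply Rmult_le_compat_r with (r := s) in H; [| lra].
    replace (g s / s * s) with (g s) in H by (field; lra). exact H. }
  assert (Hlam1w : forall i, (1 <= i <= n)%nat ->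
     is_eigenvalue w (sigma i) (tau i) (lambda1 i) /\ 0 <= lambda1 i < q).
  { intros i Hi. destruct (Hlam1 i Hi) as [H1 [H2 _]]. destruct (Hpart i Hi). split.
    - apply (is_eigenvalue_ext (pos_part a)); [| exact H2]. intros x Hx. apply Hwa. lra.
    - split; [lra |]. apply Rle_lt_trans with (2 := Hq).
      apply MaxRlist_P1, in_map, in_seq. lia. }
  assert (Hq1 : 0 < q).
  { destruct (Hlam1w 1%nat ltac:(lia)) as [_ H]. lra. }
  (* The estimates are asked from [2 * T] and [rho] on, while [h] satisfies its bounds already from
     [T] and [rho / 2] on: the Lipschitz approximations double both thresholds. *)
  destruct (uniform_estimates n sigma tau L Hn Hs1 HtL Hst Hts' w N C Hwc HNc Hw HN Hhump
    Hgap Hright Hleft lambda0 q0 q r (2 * T) lambda1 HL Hlam0w Hq0 Hr ltac:(lra) Hlam1w)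
    as (M & rho & HrM & Hrho & Hest).
  destruct (truncated_nonlinearity g q0 r q T M Hg Hgc Hg0 Hgp (proj1 Hq0) Hr Hq1 (proj1 HT)
    Hgsmall Hglarge) as (h & K & Hh & Hhc & Hhg & Hhsmall & Hhlarge & Hhp).
  destruct (positive_lower_bound h q T (rho / 2) Hhc Hhp ltac:(lra) Hq1 (proj1 HT) Hhlarge)
    as (gam & Hgam & Hhgam).
  destruct (Hest gam Hgam) as (mustar & Hmustar & Hmu).
  exists mustar. split; [exact Hmustar |]. intros mu Hmumu.
  destruct (Hmu mu h K Hmumu Hh Hhsmall) as [Hbd Hcr].
  { intros s Hs. apply Hhlarge. lra. } { intros s Hs. apply Hhgam. lra. }
  destruct (lipschitz_approximation h K q T (rho / 2) gam Hh Hhc Hq1 (proj1 HT) ltac:(lra) Hgam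
    Hhlarge Hhgam) as (hk & Hk1 & Hk2 & Hk3 & Hk4 & Hk5).
  assert (Hhk : forall k, sublinear K (hk k)).
  { intros k s. specialize (Hk1 k s). specialize (Hh s). lra. }
  set (c := weight_mu w N mu).
  assert (Hex : forall word : nat -> bool, exists u v, ode c h u v /\ u 0 = 0 /\ u L = 0 /\
     (forall x, 0 <= x <= L -> 0 <= u x <= M) /\
     forall i, (1 <= i <= n)%nat -> hump_word sigma tau r i (word i) u).
  { intros word. apply (dirichlet_limit c h hk K (C + mu * C)); try assumption.
    - intros x. apply weight_mu_continuity; assumption.
    - intros x. apply weight_mu_bound; [exact Hw | exact HN | lra].
    - intros k. destruct (Hk4 k) as [D HD].
      destruct (Hmu mu (hk k) K Hmumu (Hhk k)) as [Hbdk Hcrk].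
      + intros s Hs. specialize (Hk1 k s). specialize (Hhsmall s Hs). lra.
      + intros s Hs. apply Hk2, Hs.
      + intros s Hs. apply Hk3. lra.
      + apply (lipschitz_solution n sigma tau L Hn Hs1 HtL Hst Hts' w N C Hwc HNc Hw HN Hgap
          mu K r M D (hk k) word ltac:(lra) (Hhk k) HD ltac:(lra) Hbdk Hcrk). }
  set (word := fun k i => Nat.testbit (S k) (i - 1)).
  destruct (functional_choice (fun k u => exists v, ode c h u v /\ u 0 = 0 /\ u L = 0 /\
     (forall x, 0 <= x <= L -> 0 <= u x <= M) /\
     forall i, (1 <= i <= n)%nat -> hump_word sigma tau r i (word k i) u)) as [us Hus].
  { intros k. apply (Hex (word k)). }
  assert (Hcabs : forall x, Rabs (c x) <= C + mu * C)
    by (intros x; apply weight_mu_bound; [exact Hw | exact HN | lra]).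
  exists us. split.
  - intros k Hk. destruct (Hus k) as (v & Ho & E0 & EL & Hb & Hword).
    split; [| split; [exact E0 | split; [exact EL |]]].
    + exists (fun x => - (c x * h (us k x))).
      split; [exists v; split; intros x Hx; apply is_derive_D_in, Ho |].
      intros x Hx. rewrite Hhg by (apply Hb, Hx). unfold c, weight_mu, w, N, pos_part, neg_part.
      rewrite HA by exact Hx. ring.
    (* An interior zero would make the solution identically zero, but every code [S k] has a nonzero
       digit, that is, a hump on which level [r] is reached. *)
    + intros x Hx. destruct (proj1 (Hb x ltac:(lra))) as [|Ez]; [assumption | exfalso].
      assert (Hall := interior_zero_trivial c h (us k) v K (C + mu * C) 0 L x Hh Hcabs Ho
        (fun y Hy => proj1 (Hb y Hy)) Hx (eq_sym Ez)).
      destruct (testbit_nonzero n k Hk) as [i [Hi Hbit]].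
      specialize (Hword i Hi). unfold hump_word, word in Hword. rewrite Hbit in Hword.
      destruct Hword as [y [_ Hy]]. rewrite Hall in Hy. lra.
  (* The estimates hold for the limit nonlinearity as well: a hump maximum equal to [r] would force
     [u >= M] at the next hump, against the bound there, or [u L > 0] on the last one. So a hump
     cannot be small and large at once, and different words give different solutions. *)
  - assert (Hlevel : forall k i, (1 <= i <= n)%nat ->
      (forall x, sigma i <= x <= tau i -> us k x <= r) ->
      (exists x, sigma i <= x <= tau i /\ r <= us k x) -> False).
    { intros k i Hi Hle [xi [Hxi Hge]]. destruct (Hus k) as (v & Ho & E0 & EL & Hb & _).
      destruct (Hpart i Hi) as [Hsi Hti]. assert (Hsti := Hst i Hi).
      assert (H := Hcr i (us k) v xi Hi Ho E0 (fun x Hx => proj1 (Hb x ltac:(lra))) Hle Hxi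
        (Rle_antisym _ _ (Hle xi Hxi) Hge)).
      destruct (Nat.ltb_spec i n) as [Hin|Hin]; [| lra].
      destruct (Hpart (S i) ltac:(lia)). assert (Hst' := Hst (S i) ltac:(lia)).
      assert (H' := Hbd (S i) (us k) v ltac:(lia) Ho
        (fun x Hx => proj1 (Hb x ltac:(lra))) (sigma (S i)) ltac:(lra)). lra. }
    intros j k Hj Hk Hjk. apply NNPP. intros Hno.
    assert (Heq : forall x, 0 <= x <= L -> us j x = us k x).
    { intros x Hx. apply NNPP. intros Hne. apply Hno. exists x. split; [exact Hx | exact Hne]. }
    destruct (testbit_separates n j k Hj Hk Hjk) as [i [Hi Hbit]].
    destruct (Hpart i Hi) as [Hsi Hti].
    destruct (Hus j) as (vj & _ & _ & _ & _ & Hwj). destruct (Hus k) as (vk & _ & _ & _ & _ & Hwk).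
    specialize (Hwj i Hi). specialize (Hwk i Hi). unfold hump_word, word in Hwj, Hwk.
    destruct (Nat.testbit (S j) (i - 1)), (Nat.testbit (S k) (i - 1));
      try (apply Hbit; reflexivity).
    + apply (Hlevel k i Hi Hwk). destruct Hwj as [x [Hx Hrx]]. exists x. split; [exact Hx |].
      rewrite <- Heq by lra. exact Hrx.
    + apply (Hlevel j i Hi Hwj). destruct Hwk as [x [Hx Hrx]]. exists x. split; [exact Hx |].
      rewrite Heq by lra. exact Hrx.
Qed.
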